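(* Consider the problem $\min_xg(x)-h(x)+r(x)$ with possibly non-smooth non-convex $r$, assume $h$ is $L$-smooth and condition (S) holds, and apply the stagewise algorithm with SPG as subproblem solver to its DC reformulation with smoothing parameter $\mu$. Let $\tau\in\{1,\dots,K\}$ be the sampled index and $w_\tau=\mathrm{prox}_{\mu r}(x_\tau)$. (a) If $r$ is Lipschitz continuous, then with $\mu=\epsilon$, $\gamma_k=3Lk^{1/3}$ and $T_k=3Lk/\gamma_k+3$, the algorithm returns after $K=O(1/\epsilon^3)$ stages a solution $x_\tau$ satisfying $$\mathbb{E}[\|x_\tau-w_\tau\|]\le O(\epsilon),\qquad\mathbb{E}\big[\mathrm{dist}\big(\nabla h(w_\tau),\nabla g(w_\tau)+\hat\partial r(w_\tau)\big)\big]\le O(\epsilon),$$ and the total iteration complexity is $\sum_{k=1}^KT_k\le O(K^{5/3})=O(1/\epsilon^5)$. (b) If $r$ is lower bounded and finite-valued over $\mathbb{R}^d$, then with $\mu=\epsilon^2$, $\gamma_k=3Lk^{1/2}$ and $T_k=3Lk/\gamma_k+3$, the algorithm returns after $K=O(1/\epsilon^4)$ stages a solution $x_\tau$ satisfying $$\mathbb{E}[\|x_\tau-w_\tau\|]\le O(\epsilon),\qquad\mathbb{E}\big[\mathrm{dist}\big(\nabla h(w_\tau),\nabla g(w_\tau)+\hat\partial r(w_\tau)\big)\big]\le O(\epsilon),$$ and the total iteration complexity is $\sum_{k=1}^KT_k\le O(K^{3/2})=O(1/\epsilon^6)$.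
   Context: Setting: $g=\mathbb{E}_\xi[g(\cdot;\xi)]$, $h=\mathbb{E}_\varsigma[h(\cdot;\varsigma)]$ are real-valued lower-semicontinuous convex functions on $\mathbb{R}^d$ with unbiased stochastic gradients $\nabla g(x;\xi)$, $\partial h(x;\varsigma)$; $g$ is $L$-smooth (differentiable with $L$-Lipschitz gradient); $r$ is a proper lower-semicontinuous (possibly non-smooth and non-convex) function whose proximal mapping $\mathrm{prox}_{\mu r}(x)=\arg\min_y\{\frac1{2\mu}\|y-x\|^2+r(y)\}$ exists. $\mathrm{prox}_{\mu r}(x)$ may be set-valued; when used as a vector it denotes a fixed selection (the same wherever it appears). $\hat\partial r(\bar x)=\{v:\liminf_{x\to\bar x}\frac{r(x)-r(\bar x)-v^\top(x-\bar x)}{\|x-\bar x\|}\ge0\}$ is the Fr\'echet subdifferential; $\mathrm{dist}$ is the distance between sets. DC reformulation: $r_\mu(x)=\min_y\{\frac1{2\mu}\|y-x\|^2+r(y)\}=\frac1{2\mu}\|x\|^2-R_\mu(x)$ with $R_\mu(x)=\max_y\{\frac1\mu y^\top x-\frac1{2\mu}\|y\|^2-r(y)\}$ convex and $\frac1\mu\mathrm{prox}_{\mu r}(x)\subseteq\partial R_\mu(x)$. The algorithm is applied to $F(x)=g(x)+\frac1{2\mu}\|x\|^2-(h(x)+R_\mu(x))=g(x)-h(x)+r_\mu(x)$. Stagewise algorithm: from $x_1$, for $k=1,\dots,K$ obtain $x_{k+1}$ by running SPG, initialized at $x_k$, on $$F_k(x)=g(x)+\tfrac1{2\mu}\|x\|^2-\big(\nabla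 h(x_k)+\tfrac1\mu\mathrm{prox}_{\mu r}(x_k)\big)^\top(x-x_k)+\tfrac{\gamma_k}2\|x-x_k\|^2.$$ Return $x_\tau$ with $\tau$ sampled by $p(\tau=k)=k^\alpha/\sum_{j=1}^Kj^\alpha$, $\alpha\ge1$ fixed. SPG at stage $k$ ($T_k$ iterations, rounded up, $\eta_t=3/(\gamma_k(t+1))$): $y_1=x_k$; for $t=1,\dots,T_k$ with fresh independent samples, $$y_{t+1}=\arg\min_xx^\top\big(\nabla g(y_t;\xi_t)-\partial h(x_k;\varsigma_t)-\tfrac1\mu\mathrm{prox}_{\mu r}(x_k)\big)+\tfrac1{2\mu}\|x\|^2+\tfrac{\gamma_k}2\|x-x_k\|^2+\tfrac1{2\eta_t}\|x-y_t\|^2;$$ output $x_{k+1}=\sum_{t=2}^{T_k+1}ty_t/\sum_{t=2}^{T_k+1}t$. Condition (S): $g$ is $L$-smooth and there is $G>0$ with $\mathbb{E}\|(\nabla g(x;\xi)-\partial h(x;\varsigma))-\mathbb{E}[\nabla g(x;\xi)-\partial h(x;\varsigma)]\|^2\le G^2$. Standing assumption: there is $\Delta>0$ (independent of $\epsilon$) with $\mathbb{E}[F(x_k)-\min_xF(x)]\le\Delta$ for all $k\in\{1,\dots,K\}$. ''After $K=O(q(\epsilon))$ stages'' means $K=\lceil Cq(\epsilon)\rceil$ for a constant $C$ independent of $\epsilon\in(0,1)$; all $O(\cdot)$ constants are independent of $\epsilon$. *)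

(* Defs.v *)
From HB Require Import structures.
From mathcomp Require Import all_boot all_order all_algebra.
From mathcomp Require Import all_classical all_reals all_analysis.
From mathcomp Require Import ring.

Set Implicit Arguments.
Unset Strict Implicit.
Unset Printing Implicit Defensive.

Import Order.TTheory GRing.Theory Num.Theory.
Import numFieldNormedType.Exports.

Local Open Scope classical_set_scope.
Local Open Scope ring_scope.

Definition nceil (R : realType) (a : R) : nat := `|Num.ceil a|%N.

(* The library norm on 'rV[R]_d is the sup norm; the Euclidean one is needed. *)
Definition dotv (R : realType) (d : nat) (u v : 'rV[R]_d) : R :=
  \sum_(i < d) u 0 i * v 0 i.

Definition enorm (R : realType) (d : nat) (u : 'rV[R]_d) : R :=
  Num.sqrt (dotv u u).

Definition set_dist (R : realType) (d : nat) (A B : set 'rV[R]_d) : \bar R :=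
  ereal_inf [set (enorm (a - b))%:E | a in A & b in B].

Definition argmin (T : Type) (disp : Order.disp_t) (V : porderType disp)
  (f : T -> V) : set T := [set y | forall z, (f y <= f z)%O].

Definition gradient (R : realType) (d : nat) (f : 'rV[R]_d -> R)
  (x : 'rV[R]_d) : 'rV[R]_d := \row_(i < d) 'D_(delta_mx 0 i) f x.

Definition L_smooth (R : realType) (d : nat) (L : R) (f : 'rV[R]_d -> R) :=
  (forall x, differentiable f x) /\
  (forall x y, enorm (gradient f x - gradient f y) <= L * enorm (x - y)).

Definition lsc_convex (R : realType) (d : nat) (f : 'rV[R]_d -> R) :=
  lower_semicontinuous (EFin \o f) /\
  convex_function (E := 'rV[R]_d) [set: 'rV[R]_d] f.

Definition proper_fun (R : realType) (d : nat) (r : 'rV[R]_d -> \bar R) :=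
  (forall x, -oo < r x)%E /\ (exists x, r x < +oo)%E.

(* If r xb = +oo the difference quotient is -oo everywhere, because
   +oo - +oo = -oo in \bar R; the subdifferential is then empty. *)
Definition frechet_subdiff (R : realType) (d : nat) (r : 'rV[R]_d -> \bar R)
  (xb : 'rV[R]_d) : set 'rV[R]_d :=
  [set v | (0 <= limf_einf (fun x =>
      (r x - r xb - (dotv v (x - xb))%:E) * ((enorm (x - xb))^-1)%:E) xb^')%E].

Definition prox (R : realType) (d : nat) (mu : R) (r : 'rV[R]_d -> \bar R)
  (x : 'rV[R]_d) : set 'rV[R]_d :=
  argmin (fun y => (((2 * mu)^-1 * enorm (y - x) ^+ 2)%:E + r y)%E).

Definition moreau (R : realType) (d : nat) (mu : R) (r : 'rV[R]_d -> \bar R)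
  (x : 'rV[R]_d) : \bar R :=
  ereal_inf (range (fun y => (((2 * mu)^-1 * enorm (y - x) ^+ 2)%:E + r y)%E)).

Definition R_mu (R : realType) (d : nat) (mu : R) (r : 'rV[R]_d -> \bar R)
  (x : 'rV[R]_d) : \bar R :=
  ereal_sup (range (fun y =>
    ((mu^-1 * dotv y x - (2 * mu)^-1 * enorm y ^+ 2)%:E - r y)%E)).

Definition dc_objective (R : realType) (d : nat) (g h : 'rV[R]_d -> R)
  (r : 'rV[R]_d -> \bar R) (mu : R) (x : 'rV[R]_d) : \bar R :=
  ((g x + (2 * mu)^-1 * enorm x ^+ 2)%:E - ((h x)%:E + R_mu mu r x))%E.

Lemma dotv_sub_sqr (R : realType) (d : nat) (x y : 'rV[R]_d) :
  enorm (y - x) ^+ 2 = enorm y ^+ 2 - 2 * dotv y x + enorm x ^+ 2.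
Proof.
have e2 (u : 'rV[R]_d) : enorm u ^+ 2 = dotv u u.
  by rewrite sqr_sqrtr//; apply: sumr_ge0 => i _; rewrite -expr2 sqr_ge0.
rewrite !e2 /dotv mulr_sumr -sumrB -big_split/=.
by apply: eq_bigr => i _; rewrite !mxE; ring.
Qed.

Lemma R_muE (R : realType) (d : nat) (mu : R) (r : 'rV[R]_d -> \bar R)
  (x : 'rV[R]_d) : mu != 0 ->
  R_mu mu r x = (((2 * mu)^-1 * enorm x ^+ 2)%:E - moreau mu r x)%E.
Proof.
move=> mu0; set c := ((2 * mu)^-1 * enorm x ^+ 2).
have E y : ((mu^-1 * dotv y x - (2 * mu)^-1 * enorm y ^+ 2)%:E - r y =
    c%:E - (((2 * mu)^-1 * enorm (y - x) ^+ 2)%:E + r y))%E.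
  rewrite oppeD ?fin_num_adde_defr// addeA -EFinB dotv_sub_sqr /c; congr (_%:E - _)%E.
  by field.
rewrite /R_mu /moreau /ereal_inf oppeK.
under eq_fun do rewrite E.
apply/eqP; rewrite eq_le; apply/andP; split.
  apply: ge_ereal_sup => _ [y _ <-]; apply: leeD2l.
  by apply: ereal_sup_ubound; exists (((2 * mu)^-1 * enorm (y - x) ^+ 2)%:E + r y)%E => //; exists y.
rewrite -leeBrDl//.
apply: ge_ereal_sup => _ [_ [y _ <-] <-].
rewrite leeBrDl//.
by apply: ereal_sup_ubound; exists y.
Qed.

Lemma dc_objectiveE (R : realType) (d : nat) (g h : 'rV[R]_d -> R)
  (r : 'rV[R]_d -> \bar R) (mu : R) (x : 'rV[R]_d) : mu != 0 ->
  dc_objective g h r mu x = ((g x - h x)%:E + moreau mu r x)%E.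
Proof.
move=> mu0; rewrite /dc_objective R_muE// addeA -EFinD oppeB ?fin_num_adde_defr//.
by rewrite addeA -EFinB; congr (_%:E + _)%E; ring.
Qed.

Definition borelV (R : realType) (d : nat) :=
  g_sigma_algebraType (@open 'rV[R]_d).

Definition vmean (R : realType) (d : nat) (dS : measure_display)
  (S : measurableType dS) (Q : {measure set S -> \bar R}) (X : S -> 'rV[R]_d) :
  'rV[R]_d := \row_(i < d) \int[Q]_s (X s 0 i).

(* f is the mean of the random functions fs(.; s), s ~ Q, and df(x; s) is a
   jointly measurable unbiased stochastic gradient of f (which is used only for
   differentiable f); df need not be a pathwise derivative of fs. *)
Record stochastic_oracle (R : realType) (d : nat) (dS : measure_display)
  (S : measurableType dS) (Q : probability S R) (f : 'rV[R]_d -> R)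
  (fs : 'rV[R]_d -> S -> R) (df : 'rV[R]_d -> S -> 'rV[R]_d) : Prop := {
  oracle_value_integrable : forall x, Q.-integrable [set: S] (EFin \o fs x);
  oracle_value : forall x, (\int[Q]_s (fs x s)%:E = (f x)%:E)%E;
  oracle_measurable : measurable_fun [set: borelV R d * S]
    (fun p : borelV R d * S => df p.1 p.2 : borelV R d);
  oracle_integrable : forall x i,
    Q.-integrable [set: S] (fun s => (df x s 0 i)%:E);
  oracle_unbiased : forall x, vmean Q (df x) = gradient f x }.

(* The two samples are independent, hence the product law. *)
Definition bounded_variance (R : realType) (d : nat)
  (dXi dSg : measure_display) (Xi : measurableType dXi) (Sg : measurableType dSg)
  (PXi : probability Xi R) (PSg : probability Sg R)
  (dg : 'rV[R]_d -> Xi -> 'rV[R]_d) (dh : 'rV[R]_d -> Sg -> 'rV[R]_d) (G : R) :=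
  forall x, let noise (z : Xi * Sg) := dg x z.1 - dh x z.2 in
    (\int[PXi \x PSg]_z
       (enorm (noise z - vmean (PXi \x PSg) noise) ^+ 2)%:E <= (G ^+ 2)%:E)%E.

Record prox_selection (R : realType) (d : nat) (r : 'rV[R]_d -> \bar R)
  (px : R -> 'rV[R]_d -> 'rV[R]_d) : Prop := {
  px_prox : forall mu x, 0 < mu -> prox mu r x (px mu x);
  px_measurable : forall mu, 0 < mu ->
    measurable_fun [set: borelV R d] (px mu : borelV R d -> borelV R d) }.

Definition mutually_independent (R : realType) (dO : measure_display)
  (O : measurableType dO) (P : probability O R) (I : eqType)
  (F : I -> set (set O)) :=
  forall (s : seq I) (A : I -> set O), uniq s ->
    (forall i, i \in s -> F i (A i)) ->
    P (\bigcap_(i in [set` s]) A i) = (\prod_(i <- s) P (A i))%E.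

Definition generated_by (dO dT : measure_display) (O : measurableType dO)
  (T : measurableType dT) (X : O -> T) : set (set O) :=
  preimage_set_system [set: O] X (@measurable dT T).

Definition run_sigma (dO dXi dSg : measure_display) (O : measurableType dO)
  (Xi : measurableType dXi) (Sg : measurableType dSg)
  (xi : nat -> nat -> O -> Xi) (sg : nat -> nat -> O -> Sg) (tau : O -> nat)
  (i : (nat * nat + nat * nat) + unit) : set (set O) :=
  match i with
  | inl (inl (k, t)) => generated_by (xi k t)
  | inl (inr (k, t)) => generated_by (sg k t)
  | inr _ => generated_by tau
  end.

(* xi k t and sg k t are the samples drawn at iteration t of stage k. *)
Record run_samples (R : realType) (dO dXi dSg : measure_display)
  (O : measurableType dO) (Xi : measurableType dXi) (Sg : measurableType dSg)
  (P : probability O R) (PXi : probability Xi R) (PSg : probability Sg R)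
  (alpha : R) (K : nat)
  (xi : nat -> nat -> {RV P >-> Xi}) (sg : nat -> nat -> {RV P >-> Sg})
  (tau : {RV P >-> nat}) : Prop := {
  xi_law : forall k t A, measurable A -> distribution P (xi k t) A = PXi A;
  sg_law : forall k t A, measurable A -> distribution P (sg k t) A = PSg A;
  tau_range : forall w, (1 <= tau w <= K)%N;
  tau_law : forall k, (1 <= k <= K)%N ->
    P (tau @^-1` [set k]) =
      (k%:R `^ alpha / \sum_(1 <= j < K.+1) j%:R `^ alpha)%:E;
  samples_independent : mutually_independent P
    (run_sigma (fun k t => xi k t) (fun k t => sg k t) tau) }.

Definition spg_eta (R : realType) (gamma : R) (t : nat) : R :=
  3 / (gamma * t.+1%:R).

(* v is the stochastic linear term, xk the stage's starting point. *)
Definition spg_objective (R : realType) (d : nat) (mu gamma eta : R)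
  (v xk y z : 'rV[R]_d) : R :=
  dotv z v + (2 * mu)^-1 * enorm z ^+ 2 + gamma / 2 * enorm (z - xk) ^+ 2
  + (2 * eta)^-1 * enorm (z - y) ^+ 2.

(* x k is the input of stage k and y k t its t-th inner iterate. *)
Record stagewise_spg (R : realType) (d : nat) (O Xi Sg : Type)
  (dg : 'rV[R]_d -> Xi -> 'rV[R]_d) (dh : 'rV[R]_d -> Sg -> 'rV[R]_d)
  (pr : 'rV[R]_d -> 'rV[R]_d) (mu : R) (gamma : nat -> R) (T : nat -> nat)
  (K : nat) (x1 : 'rV[R]_d) (xi : nat -> nat -> O -> Xi)
  (sg : nat -> nat -> O -> Sg) (x : nat -> O -> 'rV[R]_d)
  (y : nat -> nat -> O -> 'rV[R]_d) : Prop := {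
  stage_init : forall w, x 1%N w = x1;
  spg_init : forall k w, (1 <= k <= K)%N -> y k 1%N w = x k w;
  spg_step : forall k t w, (1 <= k <= K)%N -> (1 <= t <= T k)%N ->
    argmin (spg_objective mu (gamma k) (spg_eta (gamma k) t)
              (dg (y k t w) (xi k t w) - dh (x k w) (sg k t w)
                 - mu^-1 *: pr (x k w))
              (x k w) (y k t w))
      (y k t.+1 w);
  spg_output : forall k w, (1 <= k <= K)%N ->
    x k.+1 w = (\sum_(2 <= t < (T k).+2) t%:R)^-1 *:
               (\sum_(2 <= t < (T k).+2) t%:R *: y k t w) }.

Definition stationarity_gap (R : realType) (d : nat) (g h : 'rV[R]_d -> R)
  (r : 'rV[R]_d -> \bar R) (w : 'rV[R]_d) : \bar R :=
  set_dist [set gradient h w]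
    [set gradient g w + v | v in frechet_subdiff r w].

(* Main.v *)
Require Import Defs.
From HB Require Import structures.
From mathcomp Require Import all_boot all_order all_algebra.
From mathcomp Require Import all_classical all_reals all_analysis.
From mathcomp Require Import measurable_realfun zify ring lra.

Set Implicit Arguments.
Unset Strict Implicit.
Unset Printing Implicit Defensive.

Import Order.TTheory GRing.Theory Num.Theory.
Import numFieldNormedType.Exports.

Local Open Scope classical_set_scope.
Local Open Scope ring_scope.

(* Write q_k for the gradient of the surrogate F_k at x_k and put
   Lambda_k = L + 1/mu + gamma_k. Since h and R_mu are convex, F_k - F exceeds
   its value at x_k by at least gamma_k/2 |x - x_k|^2.
   A proximal stochastic gradient step obeys a three-point inequality; weighted by
   t + 1 these inequalities telescope, and Jensen's inequality bounds
   F_k(x_{k+1}) - F_k(z) for every z determined before the stage. With the explicit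
   gradient step z = x_k - q_k / Lambda_k in place of the minimiser of F_k, whose
   measurability would have to be proved, and since the noise is centred given the
   earlier samples,
     E|q_k|^2 / (8 Lambda_k) + gamma_k/2 E|x_{k+1} - x_k|^2
       <= E[F(x_k) - F(x_{k+1})] + 16 G^2 / (L k).
   Abel summation with the weights k^alpha gives E|q_tau|^2 = O(Lambda_K / K) = O(eps^2).
   As (x - w)/mu is a Frechet subgradient of r at w = prox(x), the stationarity gap
   at w is controlled by |q| and |x - w|. Finally |x - w| = O(mu) if r is Lipschitz;
   if r is bounded below, E|x - w|^2 = O(mu) comes from comparing F_mu with F_mu0 for
   one fixed mu0. *)

(** * Euclidean inequalities for smooth convex functions *)

(** No second moment of an iterate is assumed, yet the noise is paired with y_t - z, and this
    pairing must be integrable before its mean can vanish. The descent achieved by the step z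
    converts the bound on E F(x_k) into E|q_k|^2 < +oo, and an induction along the stage carries
    this over to E|y_t - x_k|^2. The standing assumption says nothing about x_{K+1}, and the
    distance to the subdifferential is not shown to be measurable. Integrals of non-negative
    functions are therefore compared rather than subtracted, and the distance is majorized by the
    norm of one measurable vector. The term gamma_k |x_k - z|^2 left over by the telescoping does
    not fade as the stage gets longer. It is at most |q_k|^2 / Lambda_k, and the descent of z
    absorbs it because T_k >= 3 makes the total weight at least 9; this is the role of the summand 3
    in T_k. The exponents balance the two growing parts of Lambda_K: gamma_K and 1/mu have the same
    order. *)

Section euclidean.
Variables (R : realType) (d : nat).
Implicit Types (u v w x y z : 'rV[R]_d) (c : R).

Lemma enorm_sqr u : enorm u ^+ 2 = dotv u u.
Proof.
by rewrite sqr_sqrtr//; apply: sumr_ge0 => i _; rewrite -expr2 sqr_ge0.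
Qed.

Lemma enorm_ge0 u : 0 <= enorm u.
Proof. exact: sqrtr_ge0. Qed.

Lemma dotv_ge0 u : 0 <= dotv u u.
Proof. by rewrite -enorm_sqr sqr_ge0. Qed.

Lemma dotvC u v : dotv u v = dotv v u.
Proof. by apply: eq_bigr => i _; rewrite mulrC. Qed.

Lemma dotvDl u v w : dotv (u + v) w = dotv u w + dotv v w.
Proof. by rewrite -big_split; apply: eq_bigr => i _; rewrite !mxE mulrDl. Qed.

Lemma dotvZl c u v : dotv (c *: u) v = c * dotv u v.
Proof. by rewrite mulr_sumr; apply: eq_bigr => i _; rewrite !mxE mulrA. Qed.

Lemma dotvNl u v : dotv (- u) v = - dotv u v.
Proof. by rewrite -scaleN1r dotvZl mulN1r. Qed.

Lemma dotvDr u v w : dotv u (v + w) = dotv u v + dotv u w.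
Proof. by rewrite !(dotvC u) dotvDl. Qed.

Lemma dotvZr c u v : dotv u (c *: v) = c * dotv u v.
Proof. by rewrite !(dotvC u) dotvZl. Qed.

Lemma dotvNr u v : dotv u (- v) = - dotv u v.
Proof. by rewrite !(dotvC u) dotvNl. Qed.

Definition dotvE := (dotvDl, dotvDr, dotvNl, dotvNr, dotvZl, dotvZr).

Lemma dotv_distC u v : dotv (u - v) (u - v) = dotv (v - u) (v - u).
Proof. by rewrite -opprB dotvNl dotvNr opprK. Qed.

Lemma dotv0_eq0 u : dotv u u = 0 -> u = 0.
Proof.
move=> u0; apply/rowP => i; rewrite mxE; apply/eqP; rewrite -sqrf_eq0.
have s0 j : j \in enum 'I_d -> true -> 0 <= u 0 j * u 0 j by rewrite -expr2 sqr_ge0.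
by have /psumr_eq0P/(_ i) := u0; rewrite -expr2 => ->// j _; rewrite -expr2 sqr_ge0.
Qed.

Lemma dotv_young c u v : 0 < c ->
  2 * dotv u v <= c * dotv u u + c^-1 * dotv v v.
Proof.
move=> c0; rewrite -subr_ge0.
have -> : c * dotv u u + c^-1 * dotv v v - 2 * dotv u v =
    c * dotv (u - c^-1 *: v) (u - c^-1 *: v).
  by rewrite !dotvE (dotvC v u); field; rewrite gt_eqF.
by rewrite mulr_ge0 ?dotv_ge0// ltW.
Qed.

Lemma dotvD_le u v : dotv (u + v) (u + v) <= 2 * dotv u u + 2 * dotv v v.
Proof.
by have := dotv_young u v ltr01; rewrite !dotvE (dotvC v u) invr1; lra.
Qed.

(** Arithmetic-geometric mean inequality at the target scale [e]: a second moment of order e^2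
    yields a first moment of order e without a square root of an integral. *)
Lemma enorm_le_sqr e u : 0 < e -> enorm u <= e / 2 + dotv u u / (2 * e).
Proof.
move=> e0; rewrite -enorm_sqr -subr_ge0.
have -> : e / 2 + enorm u ^+ 2 / (2 * e) - enorm u = (enorm u - e) ^+ 2 / (2 * e).
  by field; rewrite gt_eqF.
by rewrite mulr_ge0 ?sqr_ge0// invr_ge0 mulr_ge0// ltW.
Qed.

(** Neighbourhoods are those of the sup norm. If every coordinate is at most c/(d+1), the Euclidean
    norm is at most c sqrt(d)/(d+1) <= c; dividing by d+1 also covers d = 0. *)
Lemma near_enorm x c : 0 < c -> \forall y \near x, enorm (y - x) <= c.
Proof.
move=> c0; have e0 : 0 < c / (d%:R + 1) by rewrite divr_gt0// ltr_wpDl.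
near=> y; have xy : ball x (c / (d%:R + 1)) y by near: y; exact: nbhsx_ballx.
rewrite -[leRHS]ger0_norm ?(ltW c0)// -[leRHS]sqrtr_sqr ler_wsqrtr//.
apply: (@le_trans _ _ (\sum_(i < d) (c / (d%:R + 1)) ^+ 2)).
  apply: ler_sum => i _; rewrite -expr2 -real_normK ?num_real//.
  rewrite lerXn2r ?nnegrE ?(ltW e0)//.
  by rewrite !mxE distrC; apply/ltW; exact: (xy.2 0 i).
rewrite sumr_const card_ord -[leLHS]mulr_natl.
have d0 : 0 <= d%:R :> R by [].
have -> : d%:R * (c / (d%:R + 1)) ^+ 2 = c ^+ 2 * (d%:R / (d%:R + 1) ^+ 2) :> R.
  by rewrite expr_div_n mulrCA !mulrA.
rewrite ler_piMr ?sqr_ge0// ler_pdivrMr ?mul1r ?exprn_gt0 ?ltr_wpDl//.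
nra.
Unshelve. all: by end_near.
Qed.

Lemma coord_le_enorm u i : `|u 0 i| <= enorm u.
Proof.
rewrite -sqrtr_sqr ler_wsqrtr// expr2 /dotv (bigD1 i)//= lerDl.
by apply: sumr_ge0 => j _; rewrite -expr2 sqr_ge0.
Qed.

End euclidean.

(** Merges [dotv a b] and [dotv b a] into one atom, so that expanded quadratic identities become
    linear arithmetic. *)
Ltac dotv_sort := repeat match goal with
  | |- context [dotv ?a ?b] =>
      match goal with |- context [dotv b a] =>
        assert_fails (unify a b); rewrite (dotvC b a) end
  end.

Section smooth_convex.
Variables (R : realType) (d : nat).
Implicit Types (f : 'rV[R]_d -> R) (x y v : 'rV[R]_d).

Lemma derive_gradient f x v : differentiable f x ->
  'D_v f x = dotv (gradient f x) v.
Proof.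
move=> df; rewrite deriveE// /dotv [in LHS](row_sum_delta v) linear_sum /=.
by apply: eq_bigr => i _; rewrite linearZ /= mxE -deriveE// mulrC.
Qed.

Lemma convex_gradient_le f x y :
  convex_function (E := 'rV[R]_d) [set: 'rV[R]_d] f -> differentiable f x ->
  f x + dotv (gradient f x) (y - x) <= f y.
Proof.
move=> cf df; rewrite -derive_gradient// -lerBrDl.
have dv : derivable f x (y - x) by exact: diff_derivable.
(* Convexity controls the difference quotient only for t in (0, 1], so the limit is taken from the
   right. *)
have right0 : 0^'+ `=>` nbhs (0 : R)^'.
  by move=> A [e e0 Ae]; exists e => // z ze z0; apply: Ae => //; exact/lt0r_neq0.
apply: (cvgr_to_le (cvg_trans (cvg_app _ right0) dv)).
near=> t.
have t0 : 0 < t by near: t; exact: nbhs_right_gt.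
have t1 : t <= 1 by near: t; exact: nbhs_right_le.
have : f (t *: y + (1 - t) *: x) <= t * f y + (1 - t) * f x.
  exact: (cf (Itv01 (ltW t0) t1) y x (mem_set I) (mem_set I)).
rewrite -[t^-1 *: _]/(t^-1 * _) ler_pdivrMl//=.
have -> : t *: y + (1 - t) *: x = t *: (y - x) + x.
  by rewrite scalerBl scale1r scalerBr -!addrA [x + _]addrC.
by lra.
Unshelve. all: by end_near.
Qed.

(** Evaluating gradients only at [y] and at the midpoint avoids an integral along the segment. The
    price is 3/4 instead of 1/2, from (L + L/2)/2; the step sizes satisfy 2 L <= 1/eta, which leaves
    room for it. *)
Lemma smooth_convex_le (L : R) f x y :
  convex_function (E := 'rV[R]_d) [set: 'rV[R]_d] f -> 0 < L -> L_smooth L f ->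
  f y <= f x + dotv (gradient f x) (y - x) + 3 / 4 * L * dotv (y - x) (y - x).
Proof.
move=> cf L0 [df Lf].
have grad_le a b : dotv (gradient f a - gradient f b) (a - b) <= L * dotv (a - b) (a - b).
  have iL0 : 0 < L^-1 by rewrite invr_gt0.
  have := dotv_young (gradient f a - gradient f b) (a - b) iL0.
  rewrite invrK; move: (Lf a b) => Lab.
  have : enorm (gradient f a - gradient f b) ^+ 2 <= (L * enorm (a - b)) ^+ 2.
    by rewrite lerXn2r ?nnegrE ?enorm_ge0 ?mulr_ge0 ?enorm_ge0// ltW.
  rewrite exprMn !enorm_sqr => Lab2 H.
  suff : L^-1 * dotv (gradient f a - gradient f b) (gradient f a - gradient f b)
      <= L * dotv (a - b) (a - b) by lra.
  by rewrite ler_pdivrMl// mulrA -expr2.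
(* Two half steps, each bounded by the gradient at its far end. *)
pose m := 2^-1 *: (x + y).
have := convex_gradient_le m cf (df y); have := convex_gradient_le x cf (df m).
have := grad_le y x; have := grad_le m x.
have -> : m - x = 2^-1 *: (y - x) by apply/rowP => i; rewrite !mxE; field.
have -> : m - y = - (2^-1 *: (y - x)) by apply/rowP => i; rewrite !mxE; field.
have -> : x - m = - (2^-1 *: (y - x)) by apply/rowP => i; rewrite !mxE; field.
move: (y - x) => v; rewrite !dotvE; lra.
Qed.

End smooth_convex.

(** * The stochastic proximal gradient step *)

Section spg_step.
Variables (R : realType) (d : nat) (g : 'rV[R]_d -> R) (L mu gamma : R).
Hypotheses (g_convex : convex_function (E := 'rV[R]_d) [set: 'rV[R]_d] g)
  (L_gt0 : 0 < L) (g_smooth : L_smooth L g) (mu_gt0 : 0 < mu) (gamma_gt0 : 0 < gamma).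
Implicit Types (c e v w x y z : 'rV[R]_d) (eta : R).

(** The objective is a quadratic with Hessian k times the identity. Solving the first-order
    condition for [v], with the stationary point [w] as parameter, makes it an exact square around
    [w]. *)
Lemma spg_objective_quad eta x y w z :
  let k := mu^-1 + gamma + eta^-1 in
  let v := gamma *: x + eta^-1 *: y - k *: w in
  spg_objective mu gamma eta v x y z =
    spg_objective mu gamma eta v x y w + k / 2 * dotv (z - w) (z - w).
Proof.
rewrite /spg_objective !enorm_sqr !invfM !dotvE; dotv_sort.
by move: eta^-1 mu^-1 => p q; field.
Qed.

(** The closed form makes each iterate a measurable function of the earlier iterates and the current
    samples. *)
Lemma spg_argminE eta v x y y' : 0 < eta ->
  argmin (spg_objective mu gamma eta v x y) y' ->
  y' = (mu^-1 + gamma + eta^-1)^-1 *: (gamma *: x + eta^-1 *: y - v).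
Proof.
move=> eta0; set k := mu^-1 + gamma + eta^-1 => ymin.
have k0 : 0 < k by rewrite !addr_gt0 ?invr_gt0.
set w := _ *: _.
have vE : v = gamma *: x + eta^-1 *: y - k *: w.
  by rewrite scalerA mulfV ?gt_eqF// scale1r opprB addrC subrK.
have := ymin w; rewrite vE [X in (X <= _)%O]spg_objective_quad -subr_ge0 -/k => H.
have : k / 2 * dotv (y' - w) (y' - w) <= 0 by lra.
rewrite pmulr_rle0 ?divr_gt0// => H0.
by apply/eqP; rewrite -subr_eq0; apply/eqP/dotv0_eq0/le_anti; rewrite H0 dotv_ge0.
Qed.

Lemma spg_three_point eta v x y y' z : 0 < eta ->
  argmin (spg_objective mu gamma eta v x y) y' ->
  spg_objective mu gamma eta v x y z = spg_objective mu gamma eta v x y y' +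
    (mu^-1 + gamma + eta^-1) / 2 * dotv (z - y') (z - y').
Proof.
move=> eta0 /spg_argminE-/(_ eta0) yE.
have k0 : 0 < mu^-1 + gamma + eta^-1 by rewrite !addr_gt0 ?invr_gt0.
have -> : v = gamma *: x + eta^-1 *: y - (mu^-1 + gamma + eta^-1) *: y'.
  by rewrite yE scalerA mulfV ?gt_eqF// scale1r opprB addrC subrK.
exact: spg_objective_quad.
Qed.

(* The convex surrogate F_k of the DC objective, with linear term c at x. *)
Definition stage_objective c x z : R :=
  g z + (2 * mu)^-1 * dotv z z - dotv c (z - x) + gamma / 2 * dotv (z - x) (z - x).

(** The term |y' - y|^2 / (2 eta) of the three-point identity is spent exactly: 3/8 of 1/eta on the
    curvature of [g], 1/8 on Young's inequality for [e] against y' - y. What remains pairs [e] with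
    y - z, which does not involve the new iterate. *)
Lemma spg_step_le eta c e x y y' z : 0 < eta -> 2 * L <= eta^-1 ->
  argmin (spg_objective mu gamma eta (gradient g y + e - c) x y) y' ->
  stage_objective c x y' - stage_objective c x z <=
    - dotv e (y - z) + 2 * eta * dotv e e + (2 * eta)^-1 * dotv (y - z) (y - z)
    - ((2 * eta)^-1 + gamma / 2) * dotv (y' - z) (y' - z).
Proof.
move=> eta0 Leta /spg_three_point-/(_ z eta0).
have := smooth_convex_le y y' g_convex L_gt0 g_smooth.
have := convex_gradient_le z g_convex (g_smooth.1 y).
have eta40 : 0 < (4 * eta) by rewrite mulr_gt0.
have := dotv_young (- e) (y' - y) eta40.
have : 3 / 4 * L * dotv (y' - y) (y' - y) <= 3 / 8 * eta^-1 * dotv (y' - y) (y' - y).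
  by rewrite ler_wpM2r ?dotv_ge0//; lra.
have : 0 <= mu^-1 / 2 * dotv (z - y') (z - y').
  by rewrite mulr_ge0 ?dotv_ge0// divr_ge0// invr_ge0 ltW.
rewrite /spg_objective /stage_objective !enorm_sqr !invfM !dotvE.
dotv_sort.
move: eta^-1 mu^-1 => p q.
lra.
Qed.

End spg_step.

(** * Weighted telescoping over one stage *)

Section spg_stage.
Variables (R : realType) (d : nat) (g : 'rV[R]_d -> R) (L mu gamma : R).
Hypotheses (g_convex : convex_function (E := 'rV[R]_d) [set: 'rV[R]_d] g)
  (L_gt0 : 0 < L) (g_smooth : L_smooth L g) (mu_gt0 : 0 < mu)
  (gamma_ge : 3 * L <= gamma).
Implicit Types (c q x z : 'rV[R]_d) (y e : nat -> 'rV[R]_d).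

Let gamma_gt0 : 0 < gamma.
Proof. by apply: lt_le_trans gamma_ge; rewrite mulr_gt0. Qed.

Lemma stage_objective_le c x z z' :
  stage_objective g mu gamma c x z' +
    dotv (gradient g z' + mu^-1 *: z' - c + gamma *: (z' - x)) (z - z') <=
  stage_objective g mu gamma c x z.
Proof.
have := convex_gradient_le z g_convex (g_smooth.1 z').
have : 0 <= (mu^-1 / 2 + gamma / 2) * dotv (z - z') (z - z').
  by rewrite mulr_ge0 ?dotv_ge0// addr_ge0// divr_ge0 ?invr_ge0// ltW.
rewrite /stage_objective !invfM !dotvE; dotv_sort.
by move: mu^-1 => p; lra.
Qed.

(** Sum the tangent inequalities at the weighted mean; their linear parts cancel there. *)
Lemma stage_objective_jensen c x (s : seq nat) (a : nat -> R) y :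
  (forall t, 0 <= a t) -> 0 < \sum_(t <- s) a t ->
  (\sum_(t <- s) a t) * stage_objective g mu gamma c x
      ((\sum_(t <- s) a t)^-1 *: \sum_(t <- s) a t *: y t) <=
  \sum_(t <- s) a t * stage_objective g mu gamma c x (y t).
Proof.
move=> a0 S0; set S := \sum_(t <- s) a t; set m := _ *: _.
set p := gradient g m + mu^-1 *: m - c + gamma *: (m - x).
have dotv_sumr (v : 'rV[R]_d) (f : nat -> 'rV[R]_d) :
    dotv v (\sum_(t <- s) f t) = \sum_(t <- s) dotv v (f t).
  elim: s {S S0 m p} => [|i s IH]; last by rewrite !big_cons dotvDr IH.
  by rewrite !big_nil /dotv big1// => i _; rewrite mxE mulr0.
have p0 : \sum_(t <- s) a t * dotv p (y t - m) = 0.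
  have -> : \sum_(t <- s) a t * dotv p (y t - m) =
      dotv p (\sum_(t <- s) a t *: y t) - S * dotv p m.
    rewrite dotv_sumr mulr_suml -sumrB; apply: eq_bigr => t _.
    by rewrite dotvZr dotvDr dotvNr mulrBr.
  have -> : \sum_(t <- s) a t *: y t = S *: m.
    by rewrite scalerA mulfV ?gt_eqF// scale1r.
  by rewrite dotvZr subrr.
rewrite mulr_suml -[leLHS]addr0 -[X in _ + X <= _]p0 -big_split; apply: ler_sum => t _ /=.
by rewrite -mulrDr ler_wpM2l// stage_objective_le.
Qed.

(** Put s = t + 1. With eta = 3/(gamma s), the inequality multiplied by s has distance coefficients
    gamma s^2/6 before the step and gamma (s^2 + 3 s)/6 after it. The latter exceeds gamma (s +
    1)^2/6, so the sum telescopes, starting from gamma 2^2/6 = 2 gamma/3. The noise enters with 2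
    eta s = 6/gamma. The condition 2 L <= 1/eta follows from s >= 2 and gamma >= 3 L. *)
Lemma spg_sum_le c x z y e T :
  y 1%N = x ->
  (forall t, (1 <= t <= T)%N ->
     argmin (spg_objective mu gamma (spg_eta gamma t)
               (gradient g (y t) + e t - c) x (y t)) (y t.+1)) ->
  \sum_(1 <= t < T.+1) t.+1%:R * (stage_objective g mu gamma c x (y t.+1)
                                  - stage_objective g mu gamma c x z) <=
  \sum_(1 <= t < T.+1) (- (t.+1%:R * dotv (e t) (y t - z))
                        + 6 / gamma * dotv (e t) (e t))
  + 2 / 3 * gamma * dotv (x - z) (x - z)
  - gamma * T.+2%:R ^+ 2 / 6 * dotv (y T.+1 - z) (y T.+1 - z).
Proof.
move=> y1; elim: T => [|T IH] step.
  by rewrite !big_geq// y1; move: (dotv _ _) => D; lra.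
rewrite big_nat_recr//= [in X in _ <= X]big_nat_recr//=.
have {}IH := IH (fun t tT => step t (andb_true_intro
  (conj (andP tT).1 (leq_trans (andP tT).2 (leqnSn T))))).
set s := (T.+2%:R : R); have s0 : 0 < s by rewrite ltr0n.
have s1 : T.+3%:R = s + 1 :> R by rewrite -natr1.
have s2 : 2 <= s by rewrite ler_nat.
have etaE : spg_eta gamma T.+1 = 3 / (gamma * s) by [].
have eta0 : 0 < spg_eta gamma T.+1 by rewrite etaE divr_gt0// mulr_gt0.
have etaV : (spg_eta gamma T.+1)^-1 = gamma * s / 3 by rewrite etaE invf_div.
have Leta : 2 * L <= (spg_eta gamma T.+1)^-1.
  rewrite etaV; have : 3 * L * 2 <= gamma * s.
    by apply: ler_pM => //; rewrite mulr_ge0// ltW.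
  by lra.
have := spg_step_le g_convex L_gt0 g_smooth mu_gt0 gamma_gt0 z eta0 Leta
  (step T.+1 (leqnn _)).
rewrite invfM etaV etaE.
move: (stage_objective _ _ _ _ _ _ - _) => X.
set A := dotv (e _) _; set B := dotv (e _) _.
set D := dotv (y T.+1 - z) _ in IH *; set D' := dotv (y T.+2 - z) _.
have D'0 : 0 <= D' by exact: dotv_ge0.
move=> H.
have : s * X <= - (s * A) + 6 / gamma * B + gamma * s ^+ 2 / 6 * D
    - gamma * (s ^+ 2 / 6 + s / 2) * D'.
  have -> : - (s * A) + 6 / gamma * B + gamma * s ^+ 2 / 6 * D
      - gamma * (s ^+ 2 / 6 + s / 2) * D' =
    s * (- A + 2 * (3 / (gamma * s)) * B + 2^-1 * (gamma * s / 3) * D -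
      (2^-1 * (gamma * s / 3) + gamma / 2) * D').
    by field; rewrite !gt_eqF.
  by rewrite ler_wpM2l// ltW.
have : gamma * (s + 1) ^+ 2 / 6 * D' <= gamma * (s ^+ 2 / 6 + s / 2) * D'.
  rewrite ler_wpM2r// -mulrA ler_pM2l//.
  by lra.
rewrite s1; lra.
Qed.

(** [Lam] dominates the curvature of the surrogate. The step -q/Lam gains |q|^2/Lam to first order
    and pays at most 3/4 of it back, which leaves 1/4. *)
Lemma stage_descent c x Lam q z : Lam = L + mu^-1 + gamma ->
  q = gradient g x + mu^-1 *: x - c -> z = x - Lam^-1 *: q ->
  stage_objective g mu gamma c x z + (4 * Lam)^-1 * dotv q q <=
  stage_objective g mu gamma c x x.
Proof.
move=> LamE qE zE.
have imu0 : 0 < mu^-1 by rewrite invr_gt0.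
have Lam0 : 0 < Lam by rewrite LamE !addr_gt0.
have : stage_objective g mu gamma c x z <= stage_objective g mu gamma c x x
    + dotv q (z - x) + 3 / 4 * Lam * dotv (z - x) (z - x).
  have := smooth_convex_le x z g_convex L_gt0 g_smooth.
  have : 0 <= (mu^-1 / 4 + gamma / 4) * dotv (z - x) (z - x).
    by rewrite mulr_ge0 ?dotv_ge0// addr_ge0// divr_ge0// ltW.
  rewrite /stage_objective !invfM qE LamE !dotvE; dotv_sort.
  by move: mu^-1 => p; lra.
have -> : z - x = - (Lam^-1 *: q) by rewrite zE addrC addrA addNr add0r.
rewrite !dotvE; move: (dotv q q) => Q.
suff -> : 3 / 4 * Lam * - - (Lam^-1 * (Lam^-1 * Q)) = 3 / 4 * (Lam^-1 * Q).
  by rewrite invfM -mulrA; lra.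
by field; rewrite gt_eqF.
Qed.

(** The initial term 2/3 gamma |x - z|^2 is at most 2/3 |q|^2/Lam because gamma <= Lam. As S >= 2 +
    3 + 4 = 9, division by [S] leaves at most 2/27 |q|^2/Lam, less than the difference between the
    1/4 of [stage_descent] and the 1/8 claimed. *)
Lemma spg_stage_le c x y e T (x' : 'rV[R]_d) Lam q z S : (3 <= T)%N ->
  y 1%N = x ->
  (forall t, (1 <= t <= T)%N ->
     argmin (spg_objective mu gamma (spg_eta gamma t)
               (gradient g (y t) + e t - c) x (y t)) (y t.+1)) ->
  S = \sum_(2 <= t < T.+2) t%:R ->
  x' = S^-1 *: (\sum_(2 <= t < T.+2) t%:R *: y t) ->
  Lam = L + mu^-1 + gamma ->
  q = gradient g x + mu^-1 *: x - c -> z = x - Lam^-1 *: q ->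
  stage_objective g mu gamma c x x' + (8 * Lam)^-1 * dotv q q <=
  stage_objective g mu gamma c x x + S^-1 *
    \sum_(1 <= t < T.+1) (- (t.+1%:R * dotv (e t) (y t - z))
                          + 6 / gamma * dotv (e t) (e t)).
Proof.
move=> T3 y1 step SE x'E LamE qE zE.
have Lam0 : 0 < Lam by rewrite LamE !addr_gt0 ?invr_gt0.
have S9 : 9 <= S.
  rewrite SE -(subnK T3) addn3 big_nat_recr//= big_nat_recr//= big_nat_recr//=.
  have : 0 <= \sum_(2 <= i < (T - 3).+2) i%:R :> R by apply: sumr_ge0.
  have : 4 <= (T - 3).+4%:R :> R by rewrite ler_nat.
  have : 3 <= (T - 3).+3%:R :> R by rewrite ler_nat.
  have : 2 <= (T - 3).+2%:R :> R by rewrite ler_nat.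
  by lra.
have S0 : 0 < S by apply: lt_le_trans S9.
have := @stage_objective_jensen c x (index_iota 2 T.+2) (fun t => t%:R) y
  (fun=> ler0n _ _).
rewrite -SE => /(_ S0); rewrite -x'E => J.
have := spg_sum_le z y1 step.
have -> : \sum_(1 <= t < T.+1) t.+1%:R * (stage_objective g mu gamma c x (y t.+1)
      - stage_objective g mu gamma c x z) =
    \sum_(2 <= t < T.+2) t%:R * stage_objective g mu gamma c x (y t)
    - S * stage_objective g mu gamma c x z.
  rewrite SE mulr_suml -sumrB [RHS]big_add1; apply: eq_bigr => t _.
  by rewrite mulrBr.
set N := \sum_(1 <= t < T.+1) _.
have : 0 <= gamma * T.+2%:R ^+ 2 / 6 * dotv (y T.+1 - z) (y T.+1 - z).
  by rewrite !mulr_ge0 ?dotv_ge0 ?exprn_ge0// ltW.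
have -> : dotv (x - z) (x - z) = Lam^-1 * (Lam^-1 * dotv q q).
  by rewrite zE opprD addrA subrr add0r opprK !dotvE.
have := stage_descent LamE qE zE; rewrite !invfM; set Q := dotv q q.
have Q0 : 0 <= Lam^-1 * Q by rewrite mulr_ge0 ?dotv_ge0// invr_ge0 ltW.
have : gamma * (Lam^-1 * (Lam^-1 * Q)) <= Lam^-1 * Q.
  rewrite (mulrA gamma) ler_piMl// ler_pdivrMr// mul1r LamE.
  by rewrite lerDr addr_ge0// ?invr_ge0 ltW.
move=> H1 H2 H3 H4.
suff : S * (stage_objective g mu gamma c x x' + 8^-1 / Lam * Q) <=
    S * (stage_objective g mu gamma c x x + S^-1 * N) by rewrite ler_pM2l.
rewrite [in X in _ <= X]mulrDr mulrA mulfV ?gt_eqF// mul1r.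
have : S * (stage_objective g mu gamma c x z + 4^-1 / Lam * Q) <=
    S * stage_objective g mu gamma c x x by rewrite ler_pM2l.
have : 9 * (Lam^-1 * Q) <= S * (Lam^-1 * Q) by rewrite ler_wpM2r.
by move: J; lra.
Qed.

End spg_stage.

(** * Moreau envelope and DC objective *)

Section prox_moreau.
Variables (R : realType) (d : nat) (r : 'rV[R]_d -> \bar R) (mu : R).
Hypothesis r_proper : proper_fun r.
Implicit Types (u x y z : 'rV[R]_d).

Lemma moreau_prox x u : prox mu r x u ->
  moreau mu r x = (((2 * mu)^-1 * enorm (u - x) ^+ 2)%:E + r u)%E.
Proof.
move=> ux; apply/eqP; rewrite eq_le; apply/andP; split.
  by apply: ereal_inf_lbound; exists u.
by apply: le_ereal_inf_tmp => _ [y _ <-]; exact: ux.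
Qed.

Lemma prox_fin_num x u : prox mu r x u -> r u \is a fin_num.
Proof.
move=> ux; have [y] := r_proper.2; move: (r_proper.1 u) (ux y).
by case: (r u) => [//||//] _; case: (r y).
Qed.

Lemma moreau_fin_num x u : prox mu r x u -> moreau mu r x \is a fin_num.
Proof. by move=> ux; rewrite (moreau_prox ux) fin_numD (prox_fin_num ux). Qed.

Lemma fine_moreau_prox x u : prox mu r x u ->
  fine (moreau mu r x) = (2 * mu)^-1 * dotv (u - x) (u - x) + fine (r u).
Proof.
by move=> ux; rewrite (moreau_prox ux) fineD ?(prox_fin_num ux)// enorm_sqr.
Qed.

Lemma fine_moreau_le x u y : prox mu r x u -> r y \is a fin_num ->
  fine (moreau mu r x) <= (2 * mu)^-1 * dotv (y - x) (y - x) + fine (r y).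
Proof.
move=> ux ry; rewrite -lee_fin fineK ?(moreau_fin_num ux)// EFinD fineK// -enorm_sqr.
by rewrite (moreau_prox ux); exact: ux.
Qed.

Lemma moreau_ge_prox x u y : prox mu r x u -> r y \is a fin_num ->
  (2 * mu)^-1 * dotv (u - x) (u - x) + fine (r u) <=
  (2 * mu)^-1 * dotv (y - x) (y - x) + fine (r y).
Proof. by move=> ux ry; rewrite -(fine_moreau_prox ux) (fine_moreau_le ux). Qed.

(** Optimality of [u] bounds r y - r u - <v, y - u> below by -|y - u|^2/(2 mu). The quotient is thus
    at least -|y - u|/(2 mu), hence at least -eps within radius 2 mu eps; where r y = +oo the
    quotient is +oo. *)
Lemma prox_frechet_subdiff x u : 0 < mu -> prox mu r x u ->
  frechet_subdiff r u (mu^-1 *: (x - u)).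
Proof.
move=> mu0 ux; rewrite /frechet_subdiff/= limf_einfE.
apply/lee_addgt0Pr => /= eps eps0; rewrite -leeBlDr// sub0e.
pose V := [set y : 'rV[R]_d | enorm (y - u) <= 2 * mu * eps /\ y != u].
have VF : u^' V.
  near=> y; split; last by near: y; exact: nbhs_dnbhs_neq.
  by near: y; apply: nbhs_dnbhs; apply: near_enorm; rewrite !mulr_gt0.
apply: (@le_trans _ _ (ereal_inf [set ((r y - r u - (dotv (mu^-1 *: (x - u)) (y - u))%:E)
    * ((enorm (y - u))^-1)%:E)%E | y in V])); last first.
  by apply: ereal_sup_ubound; exists V.
apply: le_ereal_inf_tmp => _ [y [yV yu] <-].
have n0 : 0 < enorm (y - u).
  rewrite lt_def enorm_ge0 andbT; apply: contra yu => /eqP yu0.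
  by rewrite -subr_eq0; apply/eqP/dotv0_eq0; rewrite -enorm_sqr yu0 expr0n.
have ru := prox_fin_num ux.
have [ry|] := boolP (r y \is a fin_num); last first.
  rewrite fin_numElt (r_proper.1 y)/= -leNgt leye_eq => /eqP ->.
  rewrite -(fineK ru) [X in (_ <= X * _)%E](_ : _ = +oo%E)// gt0_mulye ?leey//.
  by rewrite lte_fin invr_gt0.
have := moreau_ge_prox ux ry.
rewrite -(fineK ry) -(fineK ru) -!EFinB -EFinM -EFinN lee_fin => H.
rewrite ler_pdivlMr// mulNr.
have : (2 * mu)^-1 * dotv (y - u) (y - u) <= eps * enorm (y - u).
  rewrite -enorm_sqr expr2 mulrA ler_wpM2r// ?(ltW n0)// ler_pdivrMl ?mulr_gt0//; exact: yV.
suff : - ((2 * mu)^-1 * dotv (y - u) (y - u)) <=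
    fine (r y) - fine (r u) - dotv (mu^-1 *: (x - u)) (y - u) by lra.
move: H; rewrite !invfM !dotvE; dotv_sort.
by move: mu^-1 => p; lra.
Unshelve. all: by end_near.
Qed.

End prox_moreau.

Section dc_objective_real.
Variables (R : realType) (d : nat) (g h : 'rV[R]_d -> R) (r : 'rV[R]_d -> \bar R).
Variables (L mu : R).
Hypotheses (g_convex : convex_function (E := 'rV[R]_d) [set: 'rV[R]_d] g)
  (h_convex : convex_function (E := 'rV[R]_d) [set: 'rV[R]_d] h)
  (L_gt0 : 0 < L) (g_smooth : L_smooth L g) (h_smooth : L_smooth L h)
  (r_proper : proper_fun r) (mu_gt0 : 0 < mu).
Variable (pr : 'rV[R]_d -> 'rV[R]_d).
Hypothesis pr_prox : forall x, prox mu r x (pr x).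
Implicit Types (x y z w : 'rV[R]_d).

Definition dc_real x : R := g x - h x + fine (moreau mu r x).

Lemma dc_objective_EFin x : dc_objective g h r mu x = (dc_real x)%:E.
Proof.
by rewrite dc_objectiveE ?gt_eqF// /dc_real [in RHS]EFinD fineK// (moreau_fin_num r_proper (pr_prox x)).
Qed.

(** A subgradient at [x] of h + R_mu, the convex function that the algorithm linearizes. *)
Definition dc_linear x : 'rV[R]_d := gradient h x + mu^-1 *: pr x.

(* The gradient at x of the surrogate F_k, when x = x_k. *)
Definition dc_residual x : 'rV[R]_d := gradient g x - gradient h x + mu^-1 *: (x - pr x).

Lemma dc_residualE x : dc_residual x = gradient g x + mu^-1 *: x - dc_linear x.
Proof. by rewrite /dc_residual scalerBr /dc_linear opprD addrACA. Qed.

(* h and R_mu lie above their tangents at x. *)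
Lemma dc_real_majorized gamma x y :
  dc_real y - dc_real x <=
  stage_objective g mu gamma (dc_linear x) x y -
  stage_objective g mu gamma (dc_linear x) x x - gamma / 2 * dotv (y - x) (y - x).
Proof.
have := convex_gradient_le y h_convex (h_smooth.1 x).
have := fine_moreau_le r_proper (pr_prox y) (prox_fin_num r_proper (pr_prox x)).
have := fine_moreau_prox r_proper (pr_prox x).
rewrite /dc_real /stage_objective /dc_linear !invfM !dotvE; dotv_sort.
by move: mu^-1 => p; lra.
Qed.

(** A deterministic bound, free of the iterates: together with a lower bound on F it makes the
    residual square-integrable as soon as F(x_k) is integrable. *)
Lemma dc_residual_le gamma x Lam : 3 * L <= gamma -> Lam = L + mu^-1 + gamma ->
  (4 * Lam)^-1 * dotv (dc_residual x) (dc_residual x) <=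
  dc_real x - dc_real (x - Lam^-1 *: dc_residual x).
Proof.
move=> gammaL LamE.
have gamma0 : 0 < gamma by apply: lt_le_trans gammaL; rewrite mulr_gt0.
set z := x - _ *: _.
have := stage_descent g_convex L_gt0 g_smooth mu_gt0 gammaL LamE (dc_residualE x) (erefl z).
have := dc_real_majorized gamma x z.
have : 0 <= gamma / 2 * dotv (z - x) (z - x).
  by rewrite mulr_ge0 ?dotv_ge0// divr_ge0// ltW.
lra.
Qed.

Lemma spg_stage_dc_le gamma x x' (y e : nat -> 'rV[R]_d) T Lam z S : 3 * L <= gamma -> (3 <= T)%N ->
  y 1%N = x ->
  (forall t, (1 <= t <= T)%N ->
     argmin (spg_objective mu gamma (spg_eta gamma t)
               (gradient g (y t) + e t - dc_linear x) x (y t)) (y t.+1)) ->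
  S = \sum_(2 <= t < T.+2) t%:R ->
  x' = S^-1 *: (\sum_(2 <= t < T.+2) t%:R *: y t) ->
  Lam = L + mu^-1 + gamma -> z = x - Lam^-1 *: dc_residual x ->
  dc_real x' + (8 * Lam)^-1 * dotv (dc_residual x) (dc_residual x)
    + gamma / 2 * dotv (x' - x) (x' - x) <=
  dc_real x + S^-1 *
    \sum_(1 <= t < T.+1) (- (t.+1%:R * dotv (e t) (y t - z))
                          + 6 / gamma * dotv (e t) (e t)).
Proof.
move=> gammaL T3 y1 step SE x'E LamE zE.
have := spg_stage_le g_convex L_gt0 g_smooth mu_gt0 gammaL T3 y1 step SE x'E
  LamE (dc_residualE x) zE.
have := dc_real_majorized gamma x x'; lra.
Qed.

(** The difference between the gradient of [h] at w = [pr x] and one particular element of the set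
    whose distance to it is sought, the one given by the Frechet subgradient (x - w)/mu. *)
Definition prox_gap x : 'rV[R]_d :=
  gradient h (pr x) - gradient g (pr x) - mu^-1 *: (x - pr x).

Lemma stationarity_gap_le x :
  (stationarity_gap g h r (pr x) <= (enorm (prox_gap x))%:E)%E.
Proof.
apply: ereal_inf_lbound => /=; exists (gradient h (pr x)) => //.
exists (gradient g (pr x) + mu^-1 *: (x - pr x)).
  by exists (mu^-1 *: (x - pr x)) => //; apply: prox_frechet_subdiff.
by rewrite /prox_gap opprD addrA.
Qed.

Lemma stationarity_gap_ge0 w : (0 <= stationarity_gap g h r w)%E.
Proof.
by apply: le_ereal_inf_tmp => _ [a _ [b _ <-]]; rewrite lee_fin enorm_ge0.
Qed.

Lemma gradient_sqr_le f x y : L_smooth L f ->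
  dotv (gradient f x - gradient f y) (gradient f x - gradient f y) <=
  L ^+ 2 * dotv (x - y) (x - y).
Proof.
move=> [_ /(_ x y) H]; rewrite -!enorm_sqr -exprMn.
by rewrite lerXn2r ?nnegrE ?enorm_ge0 ?mulr_ge0 ?enorm_ge0// ltW.
Qed.

(** The gap at w is minus the residual at [x], up to the changes of the two gradients between [x]
    and w. Splitting squares twice gives 2 and 2 (2 L^2 + 2 L^2) = 8 L^2. *)
Lemma prox_gap_sqr_le x : dotv (prox_gap x) (prox_gap x) <=
  2 * dotv (dc_residual x) (dc_residual x)
  + 8 * L ^+ 2 * dotv (x - pr x) (x - pr x).
Proof.
have -> : prox_gap x = - dc_residual x + ((gradient g x - gradient g (pr x))
    + (- (gradient h x - gradient h (pr x)))).
  by apply/rowP => i; rewrite !mxE; ring.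
have := dotvD_le (- dc_residual x) ((gradient g x - gradient g (pr x))
    + (- (gradient h x - gradient h (pr x)))).
have := dotvD_le (gradient g x - gradient g (pr x)) (- (gradient h x - gradient h (pr x))).
have := gradient_sqr_le x (pr x) g_smooth; have := gradient_sqr_le x (pr x) h_smooth.
rewrite 2!dotvNl 2!dotvNr !opprK.
lra.
Qed.

End dc_objective_real.

(** * Borel measurability of random vectors *)

Section borel_rV.
Variables (R : realType) (d : nat).

Lemma continuous_borelV_measurable_real (f : 'rV[R]_d -> R) :
  continuous f -> measurable_fun setT (f : borelV R d -> R).
Proof.
move=> /continuousP cf; apply: (measurability _ (RGenOpens.measurableE R)).
move=> _ [_ [a [b ->] <-]]; rewrite setTI; apply: sub_sigma_algebra.
exact/cf/interval_open.
Qed.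

Lemma lower_semicontinuous_borelV_measurable (f : 'rV[R]_d -> \bar R) :
  lower_semicontinuous f -> measurable_fun setT (f : borelV R d -> \bar R).
Proof.
move=> lscf; apply: (measurability _ (ErealGenOInfty.measurableE R)).
move=> /= _ [_ [a ->]] <-; rewrite setTI; apply: sub_sigma_algebra.
by rewrite preimage_itvoy; move/lower_semicontinuousP : lscf; exact.
Qed.

Lemma measurable_coord i :
  measurable_fun setT (fun v : borelV R d => (v : 'rV[R]_d) 0 i).
Proof. by apply: continuous_borelV_measurable_real => v; exact: coord_continuous. Qed.

Context {dT : measure_display} {T : measurableType dT}.
Implicit Types (X Y : T -> borelV R d) (c : T -> R).

(* Open sets are countable unions of boxes with rational centres and radii. *)
Lemma measurable_borelVP X :
  measurable_fun setT X <-> forall i, measurable_fun setT (fun t => (X t : 'rV[R]_d) 0 i).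
Proof.
split=> [mX i|mX]; first exact: (measurableT_comp (measurable_coord i) mX).
apply: (measurability (@open 'rV[R]_d : set (set (borelV R d))) erefl) => // _ [U oU <-]; rewrite setTI.
pose ctr (p : 'rV[rat]_d) : 'rV[R]_d := \row_i ratr (p 0 i).
pose box (pn : 'rV[rat]_d * nat) := [set v : 'rV[R]_d |
  forall i, ctr pn.1 0 i - pn.2.+1%:R^-1 < v 0 i < ctr pn.1 0 i + pn.2.+1%:R^-1].
have -> : X @^-1` U = \bigcup_(pn in [set: 'rV[rat]_d * nat])
    (if `[< box pn `<=` U >] then X @^-1` (box pn) else set0).
  apply/seteqP; split=> [t /= Ut|t [pn _]]; last first.
    by case: asboolP => // sub; exact: sub.
  have [e /= e0 eU] : \forall e \near 0^'+, ball (X t : 'rV[R]_d) e `<=` U.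
    by apply: open_subball; [exact: oU|].
  pose e2 := e / 2.
  have e20 : 0 < e2 by rewrite divr_gt0.
  have /eU : ball_ Num.norm 0 e e2.
    by rewrite /= sub0r normrN gtr0_norm// /e2 ltr_pdivrMr// mulr_natr mulr2n ltrDl.
  move=> /(_ e20) e2U.
  (* The rational centre lies within a = 1/(n+1) of X t and the box has half-width a, so 2 a < [e2]
     keeps the box inside the ball. *)
  have [n nE] : exists n, n.+1%:R^-1 < e2 / 2 :> R.
    exists (Num.truncn (e2 / 2)^-1); rewrite invf_plt ?posrE ?divr_gt0//.
    exact: truncnS_gt.
  have n0 : 0 < n.+1%:R^-1 :> R by rewrite invr_gt0.
  set a := n.+1%:R^-1 in nE n0.
  have rq i : {q : rat | (X t : 'rV[R]_d) 0 i - a < ratr q <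
      (X t : 'rV[R]_d) 0 i + a}.
    apply: cid; have /rat_in_itvoo[q] : (X t : 'rV[R]_d) 0 i - a <
      (X t : 'rV[R]_d) 0 i + a by lra.
    by rewrite in_itv/= => qX; exists q.
  exists (\row_i (sval (rq i)), n) => //.
  case: asboolP => [_ i|[]].
    rewrite !mxE; case: (rq i) => q /= /andP[qX Xq].
    by rewrite ltrBlDr Xq -ltrBlDr qX.
  move=> v /= bv; apply: e2U; split => // i j; rewrite (ord1 i).
  have := bv j; rewrite !mxE; case: (rq j) => q /= /andP[qX Xq] vq.
  have /andP[? ?] : ratr q - a < v 0 j < ratr q + a by exact: vq.
  by rewrite /ball/= ltr_distlC; apply/andP; split; lra.
apply: countable_bigcupT_measurable => // pn.
case: asboolP => _ //.
have -> : X @^-1` (box pn) = \bigcap_(i in [set: 'I_d])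
    ((fun t => (X t : 'rV[R]_d) 0 i) @^-1`
       `]ctr pn.1 0 i - pn.2.+1%:R^-1, ctr pn.1 0 i + pn.2.+1%:R^-1[%classic).
  by apply/seteqP; split=> [t bt i _|t bt i]; have := bt i; rewrite /= in_itv/=; apply.
apply: fin_bigcap_measurable => // i _.
by rewrite -[X in measurable X]setTI; exact: mX.
Qed.

Lemma measurable_borelVD X Y : measurable_fun setT X -> measurable_fun setT Y ->
  measurable_fun setT (fun t => X t + Y t : borelV R d).
Proof.
move=> /measurable_borelVP mX /measurable_borelVP mY; apply/measurable_borelVP => i.
by under eq_fun do rewrite mxE; exact: measurable_funD.
Qed.

Lemma measurable_borelVZ c X : measurable_fun setT c -> measurable_fun setT X ->
  measurable_fun setT (fun t => c t *: X t : borelV R d).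
Proof.
move=> mc /measurable_borelVP mX; apply/measurable_borelVP => i.
by under eq_fun do rewrite mxE; exact: measurable_funM.
Qed.

Lemma measurable_borelVN X : measurable_fun setT X ->
  measurable_fun setT (fun t => - X t : borelV R d).
Proof.
move=> /measurable_borelVP mX; apply/measurable_borelVP => i.
by under eq_fun do rewrite mxE; exact: measurable_funN.
Qed.

Lemma measurable_borelVB X Y : measurable_fun setT X -> measurable_fun setT Y ->
  measurable_fun setT (fun t => X t - Y t : borelV R d).
Proof. by move=> mX mY; apply: measurable_borelVD => //; exact: measurable_borelVN. Qed.

Lemma measurable_borelV_sum (I : eqType) (s : seq I) (X : I -> T -> borelV R d) :
  (forall i, i \in s -> measurable_fun setT (X i)) ->
  measurable_fun setT (fun t => \sum_(i <- s) X i t : borelV R d).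
Proof.
elim: s => [|i s IH] mX; first by under eq_fun do rewrite big_nil; exact: measurable_cst.
under eq_fun do rewrite big_cons; apply: measurable_borelVD.
  by apply: mX; rewrite inE eqxx.
by apply: IH => j js; apply: mX; rewrite inE js orbT.
Qed.

Lemma measurable_dotv X Y : measurable_fun setT X -> measurable_fun setT Y ->
  measurable_fun setT (fun t => dotv (X t) (Y t)).
Proof.
move=> /measurable_borelVP mX /measurable_borelVP mY.
by apply: measurable_sum => i; exact: measurable_funM.
Qed.

End borel_rV.

(** * Independence *)

Section independence.
Context {R : realType} {dO : measure_display} {O : measurableType dO}.
Variables (P : probability O R) (I : eqType) (F : I -> set (set O)).

Definition joint_sigma (J : set I) : set (set O) := \bigcup_(i in J) F i.

(** A pi-system generating the joint sigma-algebra, on which mutual independence of finite families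
    is directly applicable. *)
Let cylinder (J : set I) : set (set O) := [set X | exists s A,
  [/\ uniq s, forall i, i \in s -> J i /\ F i (A i) & X = \bigcap_(i in [set` s]) A i]].

Hypotheses (F_measurable : forall i, F i `<=` measurable)
  (F_setI : forall i, setI_closed (F i)) (F_setT : forall i, F i setT)
  (F_indep : mutually_independent P F).

Let cylinder_measurable J : cylinder J `<=` measurable.
Proof.
move=> _ [s [A [us sA ->]]]; apply: fin_bigcap_measurable => // i /= si.
by apply: (@F_measurable i); exact: (sA i si).2.
Qed.

Let cylinder_setI J : setI_closed (cylinder J).
Proof.
move=> _ _ [s1 [A1 [u1 sA1 ->]]] [s2 [A2 [u2 sA2 ->]]].
(* An index absent from one of the two families contributes [setT] on that side. *)
exists (undup (s1 ++ s2)), (fun i => (if i \in s1 then A1 i else setT) `&`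
  (if i \in s2 then A2 i else setT)); split; first exact: undup_uniq.
  move=> i; rewrite mem_undup mem_cat => /orP s12; split.
    by case: s12 => [/sA1[]|/sA2[]].
  apply: F_setI; first by case: ifP => // /sA1[].
  by case: ifP => // /sA2[].
apply/seteqP; split=> [w [H1 H2] i _|w H].
  by split; case: ifP => // si; [exact: H1|exact: H2].
split=> i /= si; have /(_ i) := H; rewrite /= mem_undup mem_cat si ?orbT => /(_ isT)[];
  by rewrite ?si.
Qed.

Lemma sub_cylinder J : <<s joint_sigma J >> `<=` <<s cylinder J >>.
Proof.
apply: sub_sigma_algebra2 => A [i Ji FA]; exists [:: i], (fun=> A); split => //.
  by move=> j; rewrite inE => /eqP ->.
by apply/seteqP; split=> [w Aw j _ //|w]; apply; rewrite /= inE.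
Qed.

Lemma joint_sigma_measurable J : <<s joint_sigma J >> `<=` measurable.
Proof.
apply: smallest_sub; first exact: sigma_algebra_measurable.
by move=> A [i _ /F_measurable].
Qed.

(** For fixed [B], the events independent of [B] form a Dynkin class that contains the cylinders
    over [J]. *)
Lemma joint_sigma_indep J i A B : ~ J i -> <<s joint_sigma J >> A -> F i B ->
  (P (A `&` B) = P A * P B)%E.
Proof.
move=> Ji /sub_cylinder sA FB; have mB := F_measurable FB.
have cm : <<s cylinder J >> `<=` measurable.
  by apply: smallest_sub; [exact: sigma_algebra_measurable|exact: cylinder_measurable].
apply: (@dynkin_induction _ (g_sigma_algebraType (cylinder J)) (cylinder J)
  (fun A => P (A `&` B) = P A * P B)%E) => //.
- by rewrite setTI probability_setT mul1e.
- move=> _ [s [C [us sC ->]]].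
  have is_ : i \notin s by apply/negP => /sC[].
  (* The family of the cylinder extended by [B] at the new index [i]. *)
  pose C' j := if j == i then B else C j.
  have C'E j : j \in s -> C' j = C j.
    by rewrite /C'; case: eqP => // -> si; rewrite si in is_.
  have := @F_indep (i :: s) C'; rewrite /= is_ us => /(_ isT).
  have -> : \bigcap_(j in [set` i :: s]) C' j = \bigcap_(j in [set` s]) C j `&` B.
    apply/seteqP; split=> [w H|w [H Bw] j /=].
      split=> [j /= js|]; last by have := H i; rewrite /= inE eqxx /C' eqxx; apply.
      by rewrite -C'E//; apply: H; rewrite /= inE js orbT.
    rewrite inE => /orP[/eqP ->|js]; first by rewrite /C' eqxx.
    by rewrite C'E//; exact: H.
  rewrite big_cons [C' i]/C' eqxx => ->; last first.
    by move=> j; rewrite inE => /orP[/eqP ->|js]; [rewrite /C' eqxx|rewrite C'E//; have [] := sC j js].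
  rewrite muleC; congr (_ * _)%E.
  rewrite (@F_indep s C us); last by move=> j /sC[].
  by rewrite !big_seq; apply: eq_bigr => j js; rewrite C'E.
- move=> S /cm mS PS; rewrite probability_setC//.
  have -> : ~` S `&` B = B `\` (S `&` B).
    by apply/seteqP; split=> [w [Sw Bw]|w [Bw SBw]]; split => //; [case|move=> Sw; apply: SBw].
  rewrite measureD//; last 2 first.
  - exact: measurableI.
  - by rewrite -ge0_fin_numE// fin_num_measure.
  rewrite setICA setIid; etransitivity; first exact: (congr1 (fun z => P B - z)%E PS).
  rewrite muleBl ?mul1e ?fin_num_measure// ?fin_num_adde_defl ?fin_numN ?fin_num_measure//.
- move=> E sE tE PE; have mE n : measurable (E n : set O) := cm _ (sE n).
  rewrite setI_bigcupl measure_semi_bigcup//; last 3 first.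
  - by move=> n; exact: measurableI.
  - exact: trivIset_setIr.
  - by apply: bigcupT_measurable => n; exact: measurableI.
  rewrite measure_semi_bigcup//; last exact: bigcupT_measurable.
  transitivity (\sum_(n <oo) (P B * P (E n)))%E.
    by apply: eq_eseriesr => n _; rewrite muleC; exact: PE.
  by rewrite -(fineK (fin_num_measure P B mB)) nneseriesZl// muleC.
Qed.

End independence.

Section independent_integral.
Context {R : realType} {dO d1 d2 : measure_display} {O : measurableType dO}
  {T1 : measurableType d1} {T2 : measurableType d2}.
Variables (P : probability O R) (Q : probability T2 R).
Variables (X : O -> T1) (Y : O -> T2).
Hypotheses (mX : measurable_fun setT X) (mY : measurable_fun setT Y).
Hypothesis XY_indep : forall A B, measurable A -> measurable B ->
  (P (X @^-1` A `&` Y @^-1` B) = P (X @^-1` A) * Q B)%E.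

(** Stands in for conditional expectation: a fresh sample is integrated out with the past frozen.
    The joint law agrees with the product on rectangles, hence everywhere, and Tonelli's theorem
    applies. *)
Lemma indep_integral (f : T1 * T2 -> \bar R) : measurable_fun setT f ->
  (forall z, (0 <= f z)%E) ->
  (\int[P]_w f (X w, Y w) = \int[P]_w \int[Q]_s f (X w, s))%E.
Proof.
move=> mf f0.
pose X' : {mfun O >-> T1} := mfun_Sub (mem_set mX).
have mXY : measurable_fun setT (fun w => (X w, Y w)) by exact: measurable_fun_pair.
pose XY : {mfun O >-> (T1 * T2)%type} := mfun_Sub (mem_set mXY).
transitivity (\int[distribution P XY]_z f z)%E.
  by rewrite ge0_integral_distribution.
rewrite (@eq_measure_integral _ _ _ setT (distribution P X' \x Q)%E).
  rewrite fubini_tonelli1//.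
  rewrite [LHS]ge0_integral_distribution//.
  - exact: measurable_fun_fubini_tonelli_F.
  - by move=> x; apply: integral_ge0.
move=> A mA _; apply/esym.
apply: (@product_measure_unique _ _ _ _ _ (distribution P X') Q (distribution P XY)) => //.
Qed.

End independent_integral.

(** * Stochastic gradients *)

Section mean_zero.
Context {R : realType} {d0 : measure_display} {T : measurableType d0}
  (P : {measure set T -> \bar R}).

(* If phi is not integrable the bound is trivial, otherwise phi - xi dominates psi. *)
Lemma le_integral_mean0 (psi phi xi : T -> R) :
  measurable_fun setT psi -> measurable_fun setT phi ->
  (forall x, 0 <= psi x) -> (forall x, 0 <= phi x) ->
  P.-integrable setT (EFin \o xi) -> (\int[P]_x (xi x)%:E = 0)%E ->
  (forall x, psi x + xi x <= phi x) ->
  (\int[P]_x (psi x)%:E <= \int[P]_x (phi x)%:E)%E.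
Proof.
move=> mpsi mphi psi0 phi0 ixi xi0 le.
have [->|phiy] := eqVneq (\int[P]_x (phi x)%:E)%E +oo%E; first by rewrite leey.
have iphi : P.-integrable setT (EFin \o phi).
  apply/integrableP; split; first exact/measurable_EFinP.
  by under eq_integral => x _ do rewrite /= ger0_norm//; rewrite ltey.
rewrite -[leRHS]sube0 -xi0 -integralB//.
apply: ge0_le_integral => //.
- by move=> x _; rewrite lee_fin.
- exact/measurable_EFinP.
- by apply: emeasurable_funB; [exact/measurable_EFinP|exact: measurable_int ixi].
- by move=> x _; rewrite -EFinB lee_fin lerBrDr.
Qed.

(** The integral of a non-negative function is a supremum over simple functions below it, so it is
    monotone without any measurability; [stationarity_gap] requires this generality. *)
Lemma le_nonmeasurable_integral (f1 f2 : T -> \bar R) :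
  (forall x, 0 <= f1 x)%E -> (forall x, f1 x <= f2 x)%E ->
  (\int[P]_x f1 x <= \int[P]_x f2 x)%E.
Proof.
move=> f10 f12; rewrite !ge0_integralTE//; last first.
  by move=> x; exact: le_trans (f10 x) (f12 x).
apply: le_ereal_sup => _ [h hf1 <-]; exists h => //.
by move=> x; exact: le_trans (hf1 x) (f12 x).
Qed.

End mean_zero.

Lemma probability_integral_cst {R : realType} {d0 : measure_display}
    {T : measurableType d0} (P : probability T R) (c : R) :
  (\int[P]_x c%:E = c%:E)%E.
Proof. by rewrite integral_cst//= probability_setT mule1. Qed.

Section stochastic_gradient.
Context {R : realType} {d : nat} {dS : measure_display} {S : measurableType dS}.
Variables (Q : probability S R) (f : 'rV[R]_d -> R) (fs : 'rV[R]_d -> S -> R)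
  (df : 'rV[R]_d -> S -> 'rV[R]_d) (L : R).
Hypotheses (oracle : stochastic_oracle Q f fs df) (f_smooth : L_smooth L f).

Lemma measurable_gradient :
  measurable_fun setT (gradient f : borelV R d -> borelV R d).
Proof.
apply/measurable_borelVP => i; apply: continuous_borelV_measurable_real => x.
apply/(@cvgrPdist_le _ _ _ (nbhs (x : 'rV[R]_d)) _ _ _) => e e0.
(* [L] carries no sign in this section; [|L| + 1] is a positive Lipschitz constant. *)
have L1 : 0 < `|L| + 1 by rewrite ltr_wpDl.
have e1 : 0 < e / (`|L| + 1) by rewrite divr_gt0.
apply: filterS (near_enorm x e1) => y xy.
rewrite distrC; apply: (@le_trans _ _ (enorm (gradient f y - gradient f x))).
  by rewrite (le_trans _ (coord_le_enorm _ i))// !mxE.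
apply: le_trans (f_smooth.2 y x) _.
apply: (@le_trans _ _ ((`|L| + 1) * enorm (y - x))).
  by rewrite ler_wpM2r ?enorm_ge0// (le_trans (ler_norm _))// lerDl.
by rewrite -ler_pdivlMl// mulrC.
Qed.

Lemma measurable_smooth : measurable_fun setT (f : borelV R d -> R).
Proof.
by apply: continuous_borelV_measurable_real => x; exact: differentiable_continuous (f_smooth.1 x).
Qed.

Definition noise (v : 'rV[R]_d) (s : S) : 'rV[R]_d := df v s - gradient f v.

Lemma measurable_noise : measurable_fun [set: borelV R d * S]
  (fun p : borelV R d * S => noise p.1 p.2 : borelV R d).
Proof.
apply: measurable_borelVB; first exact: oracle_measurable oracle.
exact: (measurableT_comp measurable_gradient measurable_fst).
Qed.

Lemma measurable_noise_at v : measurable_fun setT (noise v : S -> borelV R d).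
Proof.
exact: (measurableT_comp measurable_noise (@pair1_measurable _ _ (borelV R d) S v)).
Qed.

Lemma integrable_noise v i : Q.-integrable setT (fun s => (noise v s 0 i)%:E).
Proof.
under eq_fun do rewrite !mxE EFinB.
apply: integrableB => //; first exact: (oracle_integrable oracle).
exact: finite_measure_integrable_cst.
Qed.

Lemma integral_noise v i : (\int[Q]_s (noise v s 0 i)%:E = 0)%E.
Proof.
under eq_integral do rewrite !mxE EFinB.
rewrite integralB//; last 2 first.
- exact: (oracle_integrable oracle).
- exact: finite_measure_integrable_cst.
rewrite probability_integral_cst.
have := oracle_unbiased oracle v => /rowP/(_ i); rewrite !mxE => <-.
rewrite /Rintegral fineK ?subee//; apply: integrable_fin_num => //;
  exact: (oracle_integrable oracle).
Qed.

Lemma dotv_noise v u : Q.-integrable setT (fun s => (dotv (noise v s) u)%:E) /\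
  (\int[Q]_s (dotv (noise v s) u)%:E = 0)%E.
Proof.
have E : (fun s => (dotv (noise v s) u)%:E) =
    (fun s => \sum_(i < d) ((u 0 i)%:E * (noise v s 0 i)%:E))%E.
  apply/funext => s; rewrite sumEFin; congr (_%:E).
  by apply: eq_bigr => i _; rewrite mulrC.
rewrite E; split.
  apply: integrable_sum => // i _; apply: integrableZl => //; exact: integrable_noise.
rewrite integral_sum//; last by move=> i; apply: integrableZl => //; exact: integrable_noise.
by apply: big1 => i _; rewrite integralZl ?integral_noise ?mule0//; exact: integrable_noise.
Qed.

(** The mean minimizes the second moment: in |df - c|^2 = |noise|^2 + 2 <noise, grad f - c> + |grad
    f - c|^2 the cross term integrates to zero. The next lemma keeps the other square of the same
    identity. *)
Lemma noise_le_sqr_dist v (c : 'rV[R]_d) :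
  (\int[Q]_s (dotv (noise v s) (noise v s))%:E <=
   \int[Q]_s (dotv (df v s - c) (df v s - c))%:E)%E.
Proof.
have [ixi xi0] := dotv_noise v (2 *: (gradient f v - c)).
have mn := measurable_noise_at v.
have dfE s : df v s - c = noise v s + (gradient f v - c) by rewrite /noise addrA subrK.
apply: (le_integral_mean0 _ _ _ _ ixi xi0).
- exact: measurable_dotv.
- by under eq_fun do rewrite dfE; apply: measurable_dotv; exact: measurable_borelVD.
- by move=> s; exact: dotv_ge0.
- by move=> s; exact: dotv_ge0.
- move=> s; rewrite dfE; have := dotv_ge0 (gradient f v - c).
  by move: (_ - c) => u; rewrite !dotvE; dotv_sort; lra.
Qed.

Lemma sqr_dist_mean_le v (c : 'rV[R]_d) :
  ((dotv (gradient f v - c) (gradient f v - c))%:E <=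
   \int[Q]_s (dotv (df v s - c) (df v s - c))%:E)%E.
Proof.
have [ixi xi0] := dotv_noise v (2 *: (gradient f v - c)).
have mn := measurable_noise_at v.
have dfE s : df v s - c = noise v s + (gradient f v - c) by rewrite /noise addrA subrK.
have -> : (dotv (gradient f v - c) (gradient f v - c))%:E =
    (\int[Q]_s (dotv (gradient f v - c) (gradient f v - c))%:E)%E.
  by rewrite probability_integral_cst.
apply: (le_integral_mean0 _ _ _ _ ixi xi0).
- exact: measurable_cst.
- by under eq_fun do rewrite dfE; apply: measurable_dotv; exact: measurable_borelVD.
- by move=> s; exact: dotv_ge0.
- by move=> s; exact: dotv_ge0.
- move=> s; rewrite dfE; have := dotv_ge0 (noise v s).
  by move: (_ - c) => u; rewrite !dotvE; dotv_sort; lra.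
Qed.

Section random_point.
Context {dO : measure_display} {O : measurableType dO} (P : probability O R).
Variables (X V : O -> borelV R d) (Y : O -> S).
Hypotheses (mX : measurable_fun setT X) (mV : measurable_fun setT V)
  (mY : measurable_fun setT Y).
Hypothesis XVY_indep : forall A B, measurable A -> measurable B ->
  (P ((fun w => (X w, V w)) @^-1` A `&` Y @^-1` B) =
   P ((fun w => (X w, V w)) @^-1` A) * Q B)%E.

Let mXV : measurable_fun setT (fun w => (X w, V w)).
Proof. exact: measurable_fun_pair. Qed.

Lemma measurable_noise_comp : measurable_fun setT
  (fun w => noise (X w) (Y w) : borelV R d).
Proof. exact: (measurableT_comp measurable_noise (measurable_fun_pair mX mY)). Qed.

Let measurable_noise3 : measurable_fun setT
  (fun z : (borelV R d * borelV R d) * S => noise z.1.1 z.2 : borelV R d).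
Proof.
have mp : measurable_fun setT
    (fun z : (borelV R d * borelV R d) * S => (z.1.1, z.2)).
  apply: measurable_fun_pair => //.
  exact: (measurableT_comp measurable_fst measurable_fst).
exact: (measurableT_comp measurable_noise mp).
Qed.

Lemma noise_sqr_integral_le (B : R) :
  (forall v, (\int[Q]_s (dotv (noise v s) (noise v s))%:E <= B%:E)%E) ->
  (\int[P]_w (dotv (noise (X w) (Y w)) (noise (X w) (Y w)))%:E <= B%:E)%E.
Proof.
move=> HB.
rewrite (indep_integral mXV mY XVY_indep
  (f := fun z : (borelV R d * borelV R d) * S => (dotv (noise z.1.1 z.2) (noise z.1.1 z.2))%:E)).
- apply: (@le_trans _ _ (\int[P]_w B%:E)%E).
    apply: le_nonmeasurable_integral => [w|w]; last exact: HB.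
    by apply: integral_ge0 => s _; rewrite lee_fin dotv_ge0.
  by rewrite probability_integral_cst.
- by apply/measurable_EFinP; apply: measurable_dotv; exact: measurable_noise3.
- by move=> z; rewrite lee_fin dotv_ge0.
Qed.

(** Conditional centring with the pair (X, V) as the past. Young's inequality and the two second
    moments give integrability, which permits the split into positive and negative parts. *)
Lemma noise_dotv_mean0 (B : R) :
  (forall v, (\int[Q]_s (dotv (noise v s) (noise v s))%:E <= B%:E)%E) ->
  (\int[P]_w (dotv (V w) (V w))%:E < +oo)%E ->
  P.-integrable setT (fun w => (dotv (noise (X w) (Y w)) (V w))%:E) /\
  (\int[P]_w (dotv (noise (X w) (Y w)) (V w))%:E = 0)%E.
Proof.
move=> HB Vfin.
pose F := (fun z : (borelV R d * borelV R d) * S => (dotv (noise z.1.1 z.2) z.1.2)%:E).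
have mf : measurable_fun setT F.
  apply/measurable_EFinP; apply: measurable_dotv; first exact: measurable_noise3.
  exact: (measurableT_comp measurable_snd measurable_fst).
have intF : P.-integrable setT (fun w => (dotv (noise (X w) (Y w)) (V w))%:E).
  apply/integrableP; split.
    apply/measurable_EFinP; apply: measurable_dotv => //; exact: measurable_noise_comp.
  apply: (@le_lt_trans _ _ (\int[P]_w
    ((dotv (noise (X w) (Y w)) (noise (X w) (Y w)))%:E + (dotv (V w) (V w))%:E))%E).
    apply: le_nonmeasurable_integral => // w; rewrite -EFinD abse_EFin lee_fin.
    set a := noise _ _; have := dotv_young a (V w) ltr01.
    have := dotv_young (- a) (V w) ltr01.
    have := dotv_ge0 a; have := dotv_ge0 (V w).
    by rewrite invr1 !dotvE ler_norml => *; apply/andP; split; lra.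
  rewrite ge0_integralD//.
  - apply: lte_add_pinfty => //; apply: le_lt_trans (noise_sqr_integral_le HB) _.
    exact: ltry.
  - by move=> w _; rewrite lee_fin dotv_ge0.
  - by apply/measurable_EFinP; apply: measurable_dotv; exact: measurable_noise_comp.
  - by move=> w _; rewrite lee_fin dotv_ge0.
  - by apply/measurable_EFinP; exact: measurable_dotv.
split => //.
(* [indep_integral] covers non-negative functions only, so the zero mean is used as equality of the
   two parts at each frozen past. *)
have ip w : (\int[Q]_s F^\+ ((X w, V w), s) = \int[Q]_s F^\- ((X w, V w), s))%E.
  have [ixi xi0] := dotv_noise (X w) (V w).
  have pE : (fun s => F^\+ ((X w, V w), s))%E = (fun s => (dotv (noise (X w) s) (V w))%:E)^\+%E.
    by apply/funext => s; rewrite !funeposE.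
  have nE : (fun s => F^\- ((X w, V w), s))%E = (fun s => (dotv (noise (X w) s) (V w))%:E)^\-%E.
    by apply/funext => s; rewrite !funenegE.
  have pfin := integrable_pos_fin_num measurableT ixi.
  have nfin := integrable_neg_fin_num measurableT ixi.
  move: xi0; rewrite integralE pE nE => /eqP.
  by rewrite sube_eq ?add0e ?fin_num_adde_defl ?fin_numN// => /eqP.
have iE : (\int[P]_w F^\+ ((X w, V w), Y w) = \int[P]_w F^\- ((X w, V w), Y w))%E.
  rewrite (indep_integral mXV mY XVY_indep (measurable_funepos mf) (funepos_ge0 _)).
  rewrite (indep_integral mXV mY XVY_indep (measurable_funeneg mf) (funeneg_ge0 _)).
  by apply: eq_integral => w _; exact: ip.
have pE : (fun w => F^\+ ((X w, V w), Y w))%E =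
    (fun w => (dotv (noise (X w) (Y w)) (V w))%:E)^\+%E.
  by apply/funext => s; rewrite !funeposE.
have nE : (fun w => F^\- ((X w, V w), Y w))%E =
    (fun w => (dotv (noise (X w) (Y w)) (V w))%:E)^\-%E.
  by apply/funext => s; rewrite !funenegE.
rewrite integralE -pE -nE iE subee// nE; exact: integrable_neg_fin_num.
Qed.

End random_point.
End stochastic_gradient.

(** * Separate variances from the joint bound *)

Section variance.
Context {R : realType} {d : nat} {dXi dSg : measure_display}
  {Xi : measurableType dXi} {Sg : measurableType dSg}.
Variables (PXi : probability Xi R) (PSg : probability Sg R)
  (g h : 'rV[R]_d -> R) (gs : 'rV[R]_d -> Xi -> R) (hs : 'rV[R]_d -> Sg -> R)
  (dg : 'rV[R]_d -> Xi -> 'rV[R]_d) (dh : 'rV[R]_d -> Sg -> 'rV[R]_d) (L G : R).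
Hypotheses (g_oracle : stochastic_oracle PXi g gs dg)
  (h_oracle : stochastic_oracle PSg h hs dh)
  (g_smooth : L_smooth L g) (h_smooth : L_smooth L h)
  (noise_bound : bounded_variance PXi PSg dg dh G).

Let measurable_oracle {dS} {S : measurableType dS} (Q : probability S R)
    (f : 'rV[R]_d -> R) (fs : 'rV[R]_d -> S -> R) (df : 'rV[R]_d -> S -> 'rV[R]_d) v :
  stochastic_oracle Q f fs df -> measurable_fun setT (df v : S -> borelV R d).
Proof.
move=> o; exact: (measurableT_comp (oracle_measurable o) (@pair1_measurable _ _ (borelV R d) S v)).
Qed.

Let sqr_noise v (m : 'rV[R]_d) (z : Xi * Sg) : \bar R :=
  (dotv (dg v z.1 - dh v z.2 - m) (dg v z.1 - dh v z.2 - m))%:E.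

Let measurable_sqr_noise v m : measurable_fun setT (sqr_noise v m).
Proof.
apply/measurable_EFinP; apply: measurable_dotv;
  apply: measurable_borelVB => //; apply: measurable_borelVB;
  do [exact: (measurableT_comp (measurable_oracle v g_oracle) measurable_fst)
     |exact: (measurableT_comp (measurable_oracle v h_oracle) measurable_snd)].
Qed.

(* By independence and Jensen's inequality, averaging out the other sample can
   only decrease the second moment. *)
Lemma variance_g_le v :
  (\int[PXi]_s (dotv (noise g dg v s) (noise g dg v s))%:E <= (G ^+ 2)%:E)%E.
Proof.
have := noise_bound v; rewrite /=; set m := vmean _ _; apply: le_trans.
under [leRHS]eq_integral do rewrite enorm_sqr.
rewrite (@fubini_tonelli1 _ _ _ _ _ PXi PSg (sqr_noise v m))//; last by move=> z; rewrite lee_fin dotv_ge0.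
(* With this centre, the deviation of dg v s is the mean over s' of dg v s - dh v s' - m, and
   Jensen's inequality applies for each s; the value of [m] is irrelevant. *)
apply: le_trans (noise_le_sqr_dist g_oracle g_smooth v (gradient h v + m)) _.
apply: le_nonmeasurable_integral => s; first by rewrite lee_fin dotv_ge0.
apply: le_trans (le_trans _ (sqr_dist_mean_le h_oracle h_smooth v (dg v s - m))) _.
  by rewrite lee_fin dotv_distC (_ : gradient h v + m - dg v s =
    gradient h v - (dg v s - m))// opprB addrA.
apply: le_nonmeasurable_integral => s'; first by rewrite lee_fin dotv_ge0.
rewrite lee_fin dotv_distC.
by rewrite (_ : dg v s - m - dh v s' = dg v s - dh v s' - m)// addrAC.
Qed.

Lemma variance_h_le v :
  (\int[PSg]_s (dotv (noise h dh v s) (noise h dh v s))%:E <= (G ^+ 2)%:E)%E.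
Proof.
have := noise_bound v; rewrite /=; set m := vmean _ _; apply: le_trans.
under [leRHS]eq_integral do rewrite enorm_sqr.
rewrite (@fubini_tonelli1 _ _ _ _ _ PXi PSg (sqr_noise v m))//; last by move=> z; rewrite lee_fin dotv_ge0.
(* The order of integration is exchanged so that the sample of [g] is averaged out first. *)
rewrite -/(fubini_F PSg (sqr_noise v m)) (@fubini_tonelli _ _ _ _ _ PXi PSg (sqr_noise v m))//; last by move=> z; rewrite lee_fin dotv_ge0.
apply: le_trans (noise_le_sqr_dist h_oracle h_smooth v (gradient g v - m)) _.
apply: le_nonmeasurable_integral => s; first by rewrite lee_fin dotv_ge0.
apply: le_trans (le_trans _ (sqr_dist_mean_le g_oracle g_smooth v (dh v s + m))) _.
  by rewrite lee_fin dotv_distC (_ : gradient g v - m - dh v s =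
    gradient g v - (dh v s + m))// opprD addrA addrAC.
by apply: le_nonmeasurable_integral => s'; rewrite lee_fin ?dotv_ge0// opprD addrA.
Qed.

End variance.

(** * Runs of the algorithm *)

Section run.
Context {R : realType} {d : nat} {dXi dSg dO : measure_display}
  {Xi : measurableType dXi} {Sg : measurableType dSg} {O : measurableType dO}.
Variables (PXi : probability Xi R) (PSg : probability Sg R) (P : probability O R)
  (g h : 'rV[R]_d -> R) (gs : 'rV[R]_d -> Xi -> R) (hs : 'rV[R]_d -> Sg -> R)
  (dg : 'rV[R]_d -> Xi -> 'rV[R]_d) (dh : 'rV[R]_d -> Sg -> 'rV[R]_d)
  (alpha mu L : R) (K : nat) (gamma : nat -> R) (T : nat -> nat)
  (pr : 'rV[R]_d -> 'rV[R]_d) (x1 : 'rV[R]_d)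
  (xi : nat -> nat -> {RV P >-> Xi}) (sg : nat -> nat -> {RV P >-> Sg})
  (tau : {RV P >-> nat})
  (x : nat -> O -> 'rV[R]_d) (y : nat -> nat -> O -> 'rV[R]_d).
Hypotheses (g_oracle : stochastic_oracle PXi g gs dg)
  (h_oracle : stochastic_oracle PSg h hs dh)
  (mu_gt0 : 0 < mu) (gamma_gt0 : forall k, (1 <= k <= K)%N -> 0 < gamma k)
  (pr_measurable : measurable_fun setT (pr : borelV R d -> borelV R d))
  (samples : run_samples PXi PSg alpha K xi sg tau)
  (algo : stagewise_spg dg dh pr mu gamma T K x1
            (fun k t => xi k t) (fun k t => sg k t) x y).

Let F := run_sigma (fun k t => xi k t) (fun k t => sg k t) tau.

(** Strict lexicographic order on (stage, iteration): the samples of iteration [t] itself stay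
    fresh. The index of [tau] belongs to no such set, which makes [tau] independent of all
    iterates. *)
Definition drawn_before (k t : nat) : set ((nat * nat + nat * nat) + unit) :=
  [set i | match i with
           | inl (inl (k', t')) | inl (inr (k', t')) => (k' < k)%N || ((k' == k) && (t' < t))%N
           | inr _ => false
           end].

(** Placing the generated sigma-algebra on the domain type lets every closure property of measurable
    functions serve for adaptedness. *)
Definition adapted k t {dT} {S : measurableType dT} (X : O -> S) :=
  measurable_fun setT
    (X : g_sigma_algebraType (joint_sigma F (drawn_before k t)) -> S).

Let F_measurable i : F i `<=` measurable.
Proof.
by case: i => [[[k t]|[k t]]|[]] _ [B mB <-]; exact: measurable_funPT.
Qed.

Let F_setI i : setI_closed (F i).
Proof.
by case: i => [[[k t]|[k t]]|[]] _ _ [A mA <-] [B mB <-];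
  exists (A `&` B); rewrite ?preimage_setI ?setTI//; exact: measurableI.
Qed.

Let F_setT i : F i setT.
Proof.
by case: i => [[[k t]|[k t]]|[]]; exists setT; rewrite ?preimage_setT ?setIT//.
Qed.

Lemma adapted_mono k t k' t' dT (S : measurableType dT) (X : O -> S) :
  drawn_before k t `<=` drawn_before k' t' -> adapted k t X -> adapted k' t' X.
Proof.
move=> sub mX mT B mB; have := mX measurableT B mB.
apply: sub_sigma_algebra2; exact: bigcup_subset.
Qed.

Lemma adapted_measurable k t dT (S : measurableType dT) (X : O -> S) :
  adapted k t X -> measurable_fun setT X.
Proof.
by move=> mX mT B mB; apply: (joint_sigma_measurable F_measurable (mX measurableT B mB)).
Qed.

Lemma adapted_indep k t i dT (S : measurableType dT) (X : O -> S) A B :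
  adapted k t X -> ~ drawn_before k t i -> measurable A -> F i B ->
  (P (X @^-1` A `&` B) = P (X @^-1` A) * P B)%E.
Proof.
move=> mX Ji mA FB.
apply: (joint_sigma_indep F_measurable F_setI F_setT (samples_independent samples) Ji) => //.
by have := mX measurableT A mA; rewrite setTI.
Qed.

Lemma adapted_xi_indep k t dT (S : measurableType dT) (X : O -> S) A B :
  adapted k t X -> measurable A -> measurable B ->
  (P (X @^-1` A `&` xi k t @^-1` B) = P (X @^-1` A) * PXi B)%E.
Proof.
move=> mX mA mB; rewrite -(xi_law samples k t mB).
apply: (adapted_indep (i := inl (inl (k, t))) mX) => //; last by exists B; rewrite ?setTI.
by rewrite /= ltnn eqxx ltnn.
Qed.

Lemma adapted_sg_indep k t dT (S : measurableType dT) (X : O -> S) A B :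
  adapted k t X -> measurable A -> measurable B ->
  (P (X @^-1` A `&` sg k t @^-1` B) = P (X @^-1` A) * PSg B)%E.
Proof.
move=> mX mA mB; rewrite -(sg_law samples k t mB).
apply: (adapted_indep (i := inl (inr (k, t))) mX) => //; last by exists B; rewrite ?setTI.
by rewrite /= ltnn eqxx ltnn.
Qed.

Lemma adapted_tau_indep k t dT (S : measurableType dT) (X : O -> S) A B :
  adapted k t X -> measurable A ->
  (P (X @^-1` A `&` tau @^-1` B) = P (X @^-1` A) * P (tau @^-1` B))%E.
Proof.
move=> mX mA; apply: (adapted_indep (i := inr tt) mX) => //.
by exists B; rewrite ?setTI.
Qed.

Let sample_adapted k t i dT (S : measurableType dT) (Y : O -> S) :
  drawn_before k t i -> F i = generated_by Y -> adapted k t Y.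
Proof.
move=> Ji FE mT B mB; apply: sub_sigma_algebra; exists i => //.
by rewrite FE; exists B.
Qed.

(** [y k t] uses the samples of iterations up to t - 1 only, hence is adapted at t; the induction
    follows the closed form of the proximal step. *)
Lemma y_adapted k t : (1 <= k <= K)%N -> adapted k 1 (x k : O -> borelV R d) ->
  (1 <= t <= (T k).+1)%N -> adapted k t (y k t : O -> borelV R d).
Proof.
move=> kK mx; elim: t => // -[_ _|t IH tT].
  by rewrite (_ : y k 1 = x k)//; apply/funext => w; exact: (spg_init algo).
have tT' : (1 <= t.+1 <= T k)%N by [].
have my : adapted k t.+2 (y k t.+1 : O -> borelV R d).
  apply: adapted_mono (IH _); last by rewrite /= ltnS ltnW.
  by move=> [[[k' t']|[k' t']]|[]] //= /orP[->//|/andP[-> /ltnW H]]; apply/orP; right.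
have {}mx : adapted k t.+2 (x k : O -> borelV R d).
  apply: adapted_mono mx.
  by move=> [[[k' t']|[k' t']]|[]] //= /orP[->//|/andP[-> H]];
    apply/orP; right; exact: leq_trans H _.
have mxi : adapted k t.+2 (xi k t.+1).
  by apply: (sample_adapted (i := inl (inl (k, t.+1)))) => //=; rewrite eqxx ltnSn orbT.
have msg : adapted k t.+2 (sg k t.+1).
  by apply: (sample_adapted (i := inl (inr (k, t.+1)))) => //=; rewrite eqxx ltnSn orbT.
have eta0 : 0 < spg_eta (gamma k) t.+1.
  by rewrite divr_gt0// mulr_gt0// gamma_gt0.
rewrite (_ : y k t.+2 = fun w => (mu^-1 + gamma k + (spg_eta (gamma k) t.+1)^-1)^-1 *:
    (gamma k *: x k w + (spg_eta (gamma k) t.+1)^-1 *: y k t.+1 w -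
     (dg (y k t.+1 w) (xi k t.+1 w) - dh (x k w) (sg k t.+1 w) - mu^-1 *: pr (x k w)))); last first.
  apply/funext => w.
  exact: (spg_argminE mu_gt0 (gamma_gt0 kK) eta0 (spg_step algo w kK tT')).
apply: measurable_borelVZ => //; apply: measurable_borelVB.
  by apply: measurable_borelVD; apply: measurable_borelVZ.
apply: measurable_borelVB; last first.
  by apply: measurable_borelVZ => //; exact: (measurableT_comp pr_measurable mx).
apply: measurable_borelVB.
  exact: (measurableT_comp (oracle_measurable g_oracle) (measurable_fun_pair my mxi)).
exact: (measurableT_comp (oracle_measurable h_oracle) (measurable_fun_pair mx msg)).
Qed.

Lemma x_adapted k : (1 <= k <= K.+1)%N -> adapted k 1 (x k : O -> borelV R d).
Proof.
elim: k => // -[_ _|k IH kK].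
  rewrite (_ : x 1%N = cst x1); first exact: measurable_cst.
  by apply/funext => w; exact: (stage_init algo).
have kK' : (1 <= k.+1 <= K)%N by [].
have mx := IH (ltnW kK).
rewrite (_ : x k.+2 = fun w => (\sum_(2 <= t < (T k.+1).+2) t%:R)^-1 *:
    (\sum_(2 <= t < (T k.+1).+2) t%:R *: y k.+1 t w)); last first.
  by apply/funext => w; exact: (spg_output algo).
apply: measurable_borelVZ => //; apply: measurable_borelV_sum => t.
rewrite mem_index_iota => /andP[t2 tT].
apply: measurable_borelVZ => //.
apply: adapted_mono (y_adapted (t := t) kK' mx _); last by rewrite (ltnW t2).
by move=> [[[k' t']|[k' t']]|[]] //= /orP[H|/andP[/eqP -> _]];
  rewrite ltnS ?leqnn// (ltnW H).
Qed.

End run.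

(** * Averaging over the stages *)

Section weighted_average.
Variable R : realType.

(** Summation by parts leaves the non-negative increments w_{k+1} - w_k multiplied by values of [a],
    each at most [Delta]; the increments add up to at most w_n. *)
Lemma abel_sum_le (w a : nat -> R) (Delta : R) n : (1 <= n)%N ->
  (forall k, 0 <= w k) -> (forall k, w k <= w k.+1) ->
  (forall k, (1 <= k <= n)%N -> a k <= Delta) ->
  \sum_(1 <= k < n.+1) w k * (a k - a k.+1) <= w n * (Delta - a n.+1).
Proof.
move=> n1 w0 wS; elim: n n1 => // -[_ _|n IH _] aD.
  by rewrite big_nat1 ler_wpM2l// lerB// aD.
rewrite big_nat_recr//=.
have {}IH := IH isT (fun k kn => aD k (andb_true_intro
  (conj (andP kn).1 (leq_trans (andP kn).2 (leqnSn n.+1))))).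
have : 0 <= (w n.+2 - w n.+1) * (Delta - a n.+2).
  by rewrite mulr_ge0 ?subr_ge0// aD//= leqnn.
by move: IH; lra.
Qed.

(** Pair j with n + 1 - j. One of the two is at least n/2, so each pair contributes at least
    (n/2)^alpha to twice the sum. *)
Lemma powR_sum_ge (alpha : R) n : 1 <= alpha ->
  n%:R * n%:R `^ alpha <= 2 `^ (alpha + 1) * \sum_(1 <= j < n.+1) j%:R `^ alpha.
Proof.
move=> alpha1; have alpha0 : 0 <= alpha by lra.
have two : 2 `^ (alpha + 1) = 2 `^ alpha * 2 :> R.
  by rewrite powRD ?powRr1// pnatr_eq0 implybT.
set W := \sum_(1 <= j < n.+1) _.
have WE : W = \sum_(1 <= j < n.+1) (1 + n.+1 - j.+1)%:R `^ alpha by rewrite /W big_nat_rev.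
have -> : 2 `^ (alpha + 1) * W = 2 `^ alpha * (W + W) by rewrite two; ring.
rewrite {2}WE /W -big_split/= mulr_sumr.
have -> : n%:R * n%:R `^ alpha = \sum_(1 <= j < n.+1) n%:R `^ alpha :> R.
  by rewrite sumr_const_nat subn1/= mulr_natl.
rewrite big_seq [leRHS]big_seq; apply: ler_sum => j; rewrite mem_index_iota => /andP[j1 jn].
rewrite mulrDr -!powRM// -!natrM.
have mono (a b : nat) : (a <= b)%N -> a%:R `^ alpha <= b%:R `^ alpha :> R.
  by move=> ab; rewrite ge0_ler_powR// ?nnegrE// ler_nat.
have [nj|nj] := leqP n (2 * j).
  by apply: le_trans (mono _ _ nj) _; rewrite lerDl powR_ge0.
have nj' : (n <= 2 * (1 + n.+1 - j.+1))%N by lia.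
by apply: le_trans (mono _ _ nj') _; rewrite lerDr powR_ge0.
Qed.

Lemma powR_average_le (alpha Delta c Lam : R) (a b : nat -> R) n : (1 <= n)%N ->
  1 <= alpha -> 0 <= c -> 0 < Lam ->
  (forall k, 0 <= a k) -> (forall k, (1 <= k <= n)%N -> a k <= Delta) ->
  (forall k, (1 <= k < n)%N -> a k.+1 + Lam^-1 * b k <= a k + c / k%:R) ->
  Lam^-1 * b n <= a n + c / n%:R ->
  \sum_(1 <= k < n.+1) (k%:R `^ alpha / \sum_(1 <= j < n.+1) j%:R `^ alpha) * b k <=
  2 `^ (alpha + 1) * Lam * (Delta + c) / n%:R.
Proof.
move=> n1 alpha1 c0 Lam0 a0 aD step last_step.
have n0 : 0 < n%:R :> R by rewrite ltr0n.
have alpha0 : 0 <= alpha by lra.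
pose w k : R := k%:R `^ alpha.
(* Nothing bounds a_{n+1}; replacing it by 0 is allowed because [last_step] has no such term. *)
pose a' k := if (k <= n)%N then a k else 0.
have bE k : (1 <= k <= n)%N -> b k <= Lam * (a' k - a' k.+1 + c / k%:R).
  move=> /andP[k1 kn]; rewrite -ler_pdivrMl// /a' kn.
  move: (kn); rewrite leq_eqVlt => /orP[/eqP ->|ltkn].
    by rewrite ltnn subr0.
  by rewrite ltkn; have := step k; rewrite k1 ltkn => /(_ isT); lra.
have w0 k : 0 <= w k by exact: powR_ge0.
have wS k : w k <= w k.+1 by rewrite ge0_ler_powR// ?nnegrE// ler_nat.
have wn : w n * (Delta + c) = w n * Delta + w n * c by rewrite mulrDr.
have H : \sum_(1 <= k < n.+1) w k * b k <= Lam * (w n * (Delta + c)).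
  apply: (@le_trans _ _ (\sum_(1 <= k < n.+1) Lam *
      (w k * (a' k - a' k.+1) + w k * (c / k%:R)))).
    rewrite big_seq [leRHS]big_seq; apply: ler_sum => k; rewrite mem_index_iota ltnS => kn.
    by rewrite -mulrDr mulrCA ler_wpM2l// bE.
  rewrite -mulr_sumr ler_pM2l// big_split/= wn lerD//.
    apply: le_trans (@abel_sum_le w a' Delta n n1 w0 wS _) _.
      by move=> k kn; rewrite /a' (andP kn).2; exact: aD.
    by rewrite /a' ltnn subr0.
  (* The weighted noise k^alpha c/k is increasing in k because alpha >= 1, so n times its last value
     bounds the sum without a logarithm. *)
  apply: (@le_trans _ _ (\sum_(1 <= k < n.+1) w n * c / n%:R)); last first.
    by rewrite sumr_const_nat subn1/= -[leLHS]mulr_natl mulrCA mulfV ?gt_eqF// mulr1.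
  rewrite big_seq [leRHS]big_seq; apply: ler_sum => k; rewrite mem_index_iota ltnS => /andP[k1 kn].
  have k0 : 0 < k%:R :> R by rewrite ltr0n.
  have -> : w k * (c / k%:R) = c * (w k / k%:R) by ring.
  have -> : w n * c / n%:R = c * (w n / n%:R) by ring.
  have aE (m : nat) : 0 < m%:R :> R -> w m / m%:R = m%:R `^ (alpha - 1).
    move=> m0; rewrite powRB ?powRr1 ?(ltW m0)//.
    by apply/implyP => _; rewrite gt_eqF.
  rewrite ler_wpM2l// !aE//.
  by rewrite ge0_ler_powR ?nnegrE ?subr_ge0// ler_nat.
have W0 : 0 < \sum_(1 <= j < n.+1) j%:R `^ alpha :> R.
  rewrite big_ltn// ltr_pwDl ?powR_gt0//.
  by rewrite sumr_ge0// => j _; exact: powR_ge0.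
set W := \sum_(1 <= j < n.+1) j%:R `^ alpha in W0 *.
have -> : \sum_(1 <= k < n.+1) k%:R `^ alpha / W * b k = (\sum_(1 <= k < n.+1) w k * b k) / W.
  by rewrite mulr_suml; apply: eq_bigr => k _; rewrite mulrAC.
rewrite ler_pdivrMr//; apply: le_trans H _.
have := powR_sum_ge n alpha1; rewrite -/W -/(w n) => HW.
have D0 : 0 <= Delta + c by rewrite addr_ge0// (le_trans (a0 1%N))// aD// n1.
have -> : 2 `^ (alpha + 1) * Lam * (Delta + c) / n%:R * W =
    Lam * (Delta + c) * (2 `^ (alpha + 1) * W / n%:R) by ring.
have -> : Lam * (w n * (Delta + c)) = Lam * (Delta + c) * w n by ring.
rewrite ler_wpM2l ?mulr_ge0 ?(ltW Lam0)// ler_pdivlMr//.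
by rewrite mulrC.
Qed.

End weighted_average.

Section random_index.
Context {R : realType} {d : nat} {dO : measure_display} {O : measurableType dO}.
Variables (P : probability O R) (K : nat) (p : nat -> R) (tau : {RV P >-> nat})
  (x : nat -> O -> 'rV[R]_d).
Hypotheses (tau_K : forall w, (1 <= tau w <= K)%N)
  (tau_p : forall k, (1 <= k <= K)%N -> P (tau @^-1` [set k]) = (p k)%:E)
  (x_meas : forall k, (1 <= k <= K)%N -> measurable_fun setT (x k : O -> borelV R d))
  (x_tau_indep : forall k (A : set (borelV R d)) (B : set nat), (1 <= k <= K)%N ->
     measurable A -> (P (x k @^-1` A `&` tau @^-1` B) = P (x k @^-1` A) * P (tau @^-1` B))%E).

(** Split along the events tau = k; on each of them independence factors the integral. *)
Lemma random_index_integral (psi : 'rV[R]_d -> R) :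
  measurable_fun setT (psi : borelV R d -> R) -> (forall v, 0 <= psi v) ->
  (\int[P]_w (psi (x (tau w) w))%:E =
   \sum_(1 <= k < K.+1) (p k)%:E * \int[P]_w (psi (x k w))%:E)%E.
Proof.
move=> mpsi psi0.
pose f k (z : borelV R d * nat) : \bar R := ((z.2 == k)%:R * psi z.1)%:E.
have mf k : measurable_fun setT (f k).
  apply/measurable_EFinP; apply: measurable_funM.
    exact: (measurableT_comp (_ : measurable_fun setT (fun n : nat => (n == k)%:R : R)) measurable_snd).
  exact: (measurableT_comp mpsi measurable_fst).
have f0 k z : (0 <= f k z)%E by rewrite lee_fin mulr_ge0.
have mx k : (1 <= k <= K)%N -> measurable_fun setT (fun w => f k (x k w, tau w)).
  move=> kK; apply: (measurableT_comp (mf k)); apply: measurable_fun_pair => //.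
  exact: x_meas.
(* The guard turns terms outside 1..K into constants, as [ge0_integral_sum] asks for measurability
   at every index. *)
have E w : (psi (x (tau w) w))%:E = (\sum_(1 <= k < K.+1)
    (if (1 <= k <= K)%N then f k (x k w, tau w) else 0))%E.
  rewrite (bigD1_seq (tau w)) ?mem_index_iota ?iota_uniq ?ltnS//= tau_K /f/= eqxx mul1r.
  rewrite big1 ?adde0// => k /negbTE kt; case: ifP => // _.
  by rewrite eq_sym kt mul0r.
under eq_integral do rewrite E.
rewrite ge0_integral_sum//; last 2 first.
- by move=> k; case: (boolP (1 <= k <= K)%N) => kK; [exact: mx|exact: measurable_cst].
- by move=> k w _; case: ifPn.
rewrite big_seq [RHS]big_seq; apply: eq_bigr => k; rewrite mem_index_iota ltnS => kK.
rewrite kK.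
rewrite (indep_integral (Q := distribution P tau) (x_meas kK) (measurable_funPT tau)
  _ (mf k) (f0 k)); last by move=> A B mA mB; exact: x_tau_indep.
under eq_integral => w _.
  rewrite (_ : (\int[distribution P tau]_s f k (x k w, s))%E = (p k)%:E * (psi (x k w))%:E)%E; last first.
    rewrite /f/=; under eq_integral => n _.
      rewrite mulrC EFinM (_ : (n == k)%:R = \1_[set k] n :> R); last first.
        by rewrite indicE; case: eqP => [->|nk]; [rewrite mem_set|rewrite memNset].
      over.
    rewrite ge0_integralZl_EFin//.
    by rewrite integral_indic// setIT /= /distribution /pushforward tau_p// muleC.
  over.
rewrite ge0_integralZl_EFin//.
- by move=> w _; rewrite lee_fin.
- by apply/measurable_EFinP; exact: (measurableT_comp mpsi (x_meas kK)).
- by rewrite -lee_fin -(tau_p kK).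
Qed.

Hypothesis p_sum1 : \sum_(1 <= k < K.+1) p k = 1.

Lemma random_index_enorm_le (V : 'rV[R]_d -> 'rV[R]_d) (eps B : R) : 0 < eps ->
  measurable_fun setT (V : borelV R d -> borelV R d) ->
  (\sum_(1 <= k < K.+1) (p k)%:E * (\int[P]_w (dotv (V (x k w)) (V (x k w)))%:E) <= B%:E)%E ->
  (\int[P]_w (enorm (V (x (tau w) w)))%:E <= (eps / 2 + B / (2 * eps))%:E)%E.
Proof.
move=> eps0 mV VB.
pose psi v := eps / 2 + dotv (V v) (V v) / (2 * eps).
have psiE v : (psi v)%:E =
    ((eps / 2)%:E + ((2 * eps)^-1)%:E * (dotv (V v) (V v))%:E)%E.
  by rewrite /psi -EFinM -EFinD [_^-1 * _]mulrC.
have e2 : 0 <= (2 * eps)^-1 by rewrite invr_ge0 mulr_ge0// ltW.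
have mdV : measurable_fun setT ((fun v => dotv (V v) (V v)) : borelV R d -> R).
  exact: measurable_dotv.
apply: (@le_trans _ _ (\int[P]_w (psi (x (tau w) w))%:E)%E).
  apply: le_nonmeasurable_integral => w; first by rewrite lee_fin enorm_ge0.
  by rewrite lee_fin enorm_le_sqr.
rewrite random_index_integral//; last 2 first.
- by apply: measurable_funD => //; exact: measurable_funM.
- by move=> v; rewrite addr_ge0 ?divr_ge0 ?dotv_ge0 ?mulr_ge0 ?(ltW eps0).
have p0 k : (1 <= k <= K)%N -> 0 <= p k.
  by move=> kK; rewrite -lee_fin -(tau_p kK).
rewrite big_seq.
under eq_bigr => k.
  rewrite mem_index_iota ltnS => kK.
  rewrite (_ : (\int[P]_w (psi (x k w))%:E)%E = (eps / 2)%:E +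
      ((2 * eps)^-1)%:E * (\int[P]_w (dotv (V (x k w)) (V (x k w)))%:E))%E; last first.
    have mk : measurable_fun setT (fun w => (dotv (V (x k w)) (V (x k w)))%:E).
      by apply/measurable_EFinP; exact: (measurableT_comp mdV (x_meas kK)).
    under eq_integral do rewrite psiE.
    rewrite ge0_integralD//.
    - rewrite probability_integral_cst ge0_integralZl_EFin// => w _.
      by rewrite lee_fin dotv_ge0.
    - by move=> w _; rewrite lee_fin divr_ge0// ltW.
    - by move=> w _; rewrite -EFinM lee_fin mulr_ge0 ?dotv_ge0.
    - exact: measurable_funeM.
  rewrite ge0_muleDr; last 2 first.
  - by rewrite lee_fin divr_ge0// ltW.
  - by rewrite mule_ge0// integral_ge0// => w _; rewrite lee_fin dotv_ge0.
  over.
rewrite big_split/= -[X in (X + _)%E]big_seq.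
rewrite [leRHS]EFinD; apply: leeD.
  under eq_bigr do rewrite -EFinM.
  by rewrite sumEFin -mulr_suml p_sum1 mul1r.
under eq_bigr do rewrite muleCA.
rewrite -ge0_sume_distrr; last first.
  move=> k; rewrite mem_index_iota ltnS => kK; rewrite mule_ge0 ?lee_fin ?p0//.
  by apply: integral_ge0 => w _; rewrite lee_fin dotv_ge0.
rewrite -big_seq [B / _]mulrC [leRHS]EFinM; exact: lee_wpmul2l.
Qed.

End random_index.

(** * Second moments of random vectors *)

Section square_integrable.
Context {R : realType} {d : nat} {dO : measure_display} {O : measurableType dO}.
Variable P : probability O R.
Implicit Types X Y : O -> 'rV[R]_d.

Definition sqr_integral X : \bar R := (\int[P]_w (dotv (X w) (X w))%:E)%E.

Lemma measurable_sqr X : measurable_fun setT (X : O -> borelV R d) ->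
  measurable_fun setT (fun w => (dotv (X w) (X w))%:E).
Proof. by move=> mX; apply/measurable_EFinP; exact: measurable_dotv. Qed.

Lemma sqr_integral_lin X Y a b :
  measurable_fun setT (X : O -> borelV R d) ->
  measurable_fun setT (Y : O -> borelV R d) -> 0 <= a -> 0 <= b ->
  (\int[P]_w (a * dotv (X w) (X w) + b * dotv (Y w) (Y w))%:E =
   a%:E * sqr_integral X + b%:E * sqr_integral Y)%E.
Proof.
move=> mX mY a0 b0; under eq_integral do rewrite EFinD !EFinM.
rewrite ge0_integralD//.
- by rewrite !ge0_integralZl_EFin//; [move=> w _; rewrite lee_fin dotv_ge0|exact: measurable_sqr
    |move=> w _; rewrite lee_fin dotv_ge0|exact: measurable_sqr].
- by move=> w _; rewrite -EFinM lee_fin mulr_ge0 ?dotv_ge0.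
- by apply: measurable_funeM; exact: measurable_sqr.
- by move=> w _; rewrite -EFinM lee_fin mulr_ge0 ?dotv_ge0.
- by apply: measurable_funeM; exact: measurable_sqr.
Qed.

Lemma sqr_integralD X Y :
  measurable_fun setT (X : O -> borelV R d) ->
  measurable_fun setT (Y : O -> borelV R d) ->
  (sqr_integral (fun w => X w + Y w)%R <=
   2%:E * sqr_integral X + 2%:E * sqr_integral Y)%E.
Proof.
move=> mX mY; rewrite -sqr_integral_lin//; apply: le_nonmeasurable_integral => w.
  by rewrite lee_fin dotv_ge0.
by rewrite lee_fin dotvD_le.
Qed.

Lemma sqr_integralZ a X : measurable_fun setT (X : O -> borelV R d) ->
  (sqr_integral (fun w => a *: X w)%R = (a ^+ 2)%:E * sqr_integral X)%E.
Proof.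
move=> mX; rewrite /sqr_integral -ge0_integralZl_EFin ?sqr_ge0//.
- by apply: eq_integral => w _; rewrite dotvZl dotvZr mulrA -expr2 EFinM.
- by move=> w _; rewrite lee_fin dotv_ge0.
- exact: measurable_sqr.
Qed.

Lemma sqr_integralN X : sqr_integral (fun w => - X w)%R = sqr_integral X.
Proof. by apply: eq_integral => w _; rewrite dotvNl dotvNr opprK. Qed.

Lemma sqr_integral_ge0 X : (0 <= sqr_integral X)%E.
Proof. by apply: integral_ge0 => w _; rewrite lee_fin dotv_ge0. Qed.

Lemma sqr_integralD_lty X Y :
  measurable_fun setT (X : O -> borelV R d) ->
  measurable_fun setT (Y : O -> borelV R d) ->
  (sqr_integral X < +oo -> sqr_integral Y < +oo ->
   sqr_integral (fun w => X w + Y w)%R < +oo)%E.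
Proof.
move=> mX mY Xy Yy; apply: le_lt_trans (sqr_integralD mX mY) _.
by rewrite lte_add_pinfty// lte_mul_pinfty.
Qed.

Lemma sqr_integralZ_lty a X : measurable_fun setT (X : O -> borelV R d) ->
  (sqr_integral X < +oo -> sqr_integral (fun w => a *: X w)%R < +oo)%E.
Proof.
by move=> mX Xy; rewrite sqr_integralZ// lte_mul_pinfty// lee_fin sqr_ge0.
Qed.

Lemma sqr_integralB_lty X Y :
  measurable_fun setT (X : O -> borelV R d) ->
  measurable_fun setT (Y : O -> borelV R d) ->
  (sqr_integral X < +oo -> sqr_integral Y < +oo ->
   sqr_integral (fun w => X w - Y w)%R < +oo)%E.
Proof.
move=> mX mY Xy Yy; apply: sqr_integralD_lty => //; first exact: measurable_borelVN.
by rewrite sqr_integralN.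
Qed.

Lemma sqr_integral_gradient_lty (f : 'rV[R]_d -> R) (L : R) X Y :
  0 < L -> L_smooth L f ->
  measurable_fun setT (X : O -> borelV R d) ->
  measurable_fun setT (Y : O -> borelV R d) ->
  (sqr_integral (fun w => X w - Y w)%R < +oo ->
   sqr_integral (fun w => gradient f (X w) - gradient f (Y w))%R < +oo)%E.
Proof.
move=> L0 sf mX mY XY.
apply: (@le_lt_trans _ _ ((L ^+ 2)%:E * sqr_integral (fun w => X w - Y w)%R)%E).
  rewrite -ge0_integralZl_EFin ?sqr_ge0//; last 2 first.
  - by move=> w _; rewrite lee_fin dotv_ge0.
  - by apply: measurable_sqr; exact: measurable_borelVB.
  apply: le_nonmeasurable_integral => w; first by rewrite lee_fin dotv_ge0.
  by rewrite -EFinM lee_fin gradient_sqr_le.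
by rewrite lte_mul_pinfty// lee_fin sqr_ge0.
Qed.

End square_integrable.

Section weighted_sums.
Context {R : realType} {d : nat} {dO : measure_display} {O : measurableType dO}.
Variable P : probability O R.

Lemma integrable_sum_mean0 (I : eqType) (s : seq I) (c : I -> R) (f : I -> O -> R) :
  (forall i, i \in s -> P.-integrable setT (EFin \o f i) /\
                        (\int[P]_w (f i w)%:E = 0)%E) ->
  P.-integrable setT (fun w => (\sum_(i <- s) c i * f i w)%:E) /\
  (\int[P]_w (\sum_(i <- s) c i * f i w)%:E = 0)%E.
Proof.
elim: s => [|i s IH] fs.
  have -> : (fun w => (\sum_(i <- [::]) c i * f i w)%:E) = cst 0%E.
    by apply/funext => w; rewrite big_nil.
  by split; [exact: integrable0|exact: integral0].
have [j s' | is_ i0] := IH; first by apply: fs; rewrite inE s' orbT.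
have [ii ii0] := fs i (mem_head i s).
have E : (fun w => (\sum_(j <- i :: s) c j * f j w)%:E) =
    (fun w => (c i)%:E * (f i w)%:E + (\sum_(j <- s) c j * f j w)%:E)%E.
  by apply/funext => w; rewrite big_cons EFinD EFinM.
have iz : P.-integrable setT (fun w => (c i)%:E * (f i w)%:E)%E by exact: integrableZl.
by rewrite E; split; [exact: integrableD|rewrite integralD// i0 integralZl// ii0 mule0 add0e].
Qed.

Lemma sum_sqr_integral_le (I : eqType) (s : seq I) (c B : R) (X : I -> O -> 'rV[R]_d) :
  (forall i, i \in s -> measurable_fun setT (X i : O -> borelV R d) /\
                        (sqr_integral P (X i) <= B%:E)%E) ->
  measurable_fun setT (fun w => \sum_(i <- s) c * dotv (X i w) (X i w)) /\
  (0 <= c -> (\int[P]_w (\sum_(i <- s) c * dotv (X i w) (X i w))%:E <=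
     ((size s)%:R * (c * B))%:E)%E).
Proof.
elim: s => [|i s IH] Xs.
  under eq_fun do rewrite big_nil; split=> [|c0]; first exact: measurable_cst.
  by under eq_integral do rewrite big_nil; rewrite integral0 lee_fin mul0r.
have [j s'|ms Is] := IH; first by apply: Xs; rewrite inE s' orbT.
have [mi Ii] := Xs i (mem_head i s).
have mi' : measurable_fun setT (fun w => c * dotv (X i w) (X i w)).
  by apply: measurable_funM => //; exact: measurable_dotv.
split=> [|c0].
  by under eq_fun do rewrite big_cons; exact: measurable_funD.
under eq_integral do rewrite big_cons EFinD.
rewrite ge0_integralD//; last 4 first.
- by move=> w _; rewrite lee_fin mulr_ge0 ?dotv_ge0.
- exact/measurable_EFinP.
- by move=> w _; rewrite lee_fin; apply: sumr_ge0 => j _; rewrite mulr_ge0 ?dotv_ge0.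
- exact/measurable_EFinP.
have -> : (size (i :: s))%:R * (c * B) = c * B + (size s)%:R * (c * B).
  by rewrite /= -natr1 mulrDl mul1r addrC.
rewrite [leRHS]EFinD; apply: leeD; last exact: Is.
under eq_integral do rewrite EFinM.
rewrite ge0_integralZl_EFin//.
- by rewrite EFinM; apply: lee_wpmul2l => //; rewrite lee_fin.
- by move=> w _; rewrite lee_fin dotv_ge0.
- exact: measurable_sqr.
Qed.

End weighted_sums.

(** * Expected decrease over one stage *)

Section stage_expectation.
Context {R : realType} {d : nat} {dXi dSg dO : measure_display}
  {Xi : measurableType dXi} {Sg : measurableType dSg} {O : measurableType dO}.
Variables (PXi : probability Xi R) (PSg : probability Sg R) (P : probability O R)
  (g h : 'rV[R]_d -> R) (gs : 'rV[R]_d -> Xi -> R) (hs : 'rV[R]_d -> Sg -> R)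
  (dg : 'rV[R]_d -> Xi -> 'rV[R]_d) (dh : 'rV[R]_d -> Sg -> 'rV[R]_d)
  (r : 'rV[R]_d -> \bar R)
  (alpha mu L G Delta Fmin : R) (K : nat) (gamma : nat -> R) (T : nat -> nat)
  (pr : 'rV[R]_d -> 'rV[R]_d) (x1 : 'rV[R]_d)
  (xi : nat -> nat -> {RV P >-> Xi}) (sg : nat -> nat -> {RV P >-> Sg})
  (tau : {RV P >-> nat})
  (x : nat -> O -> 'rV[R]_d) (y : nat -> nat -> O -> 'rV[R]_d).
Hypotheses (g_convex : convex_function (E := 'rV[R]_d) [set: 'rV[R]_d] g)
  (h_convex : convex_function (E := 'rV[R]_d) [set: 'rV[R]_d] h)
  (g_oracle : stochastic_oracle PXi g gs dg)
  (h_oracle : stochastic_oracle PSg h hs dh)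
  (r_proper : proper_fun r) (r_lsc : lower_semicontinuous r)
  (pr_prox : forall x, prox mu r x (pr x))
  (pr_measurable : measurable_fun setT (pr : borelV R d -> borelV R d))
  (L_gt0 : 0 < L) (g_smooth : L_smooth L g) (h_smooth : L_smooth L h)
  (noise_bound : bounded_variance PXi PSg dg dh G)
  (mu_gt0 : 0 < mu) (gamma_ge : forall k, (1 <= k <= K)%N -> 3 * L <= gamma k)
  (T_ge3 : forall k, (1 <= k <= K)%N -> (3 <= T k)%N)
  (gammaT : forall k, (1 <= k <= K)%N -> 3 * L * k%:R <= gamma k * (T k)%:R)
  (samples : run_samples PXi PSg alpha K xi sg tau)
  (algo : stagewise_spg dg dh pr mu gamma T K x1
            (fun k t => xi k t) (fun k t => sg k t) x y)
  (Fmin_le : forall v, Fmin <= dc_real g h r mu v)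
  (Delta_bound : forall k, (1 <= k <= K)%N ->
     (\int[P]_w (dc_real g h r mu (x k w) - Fmin)%:E <= Delta%:E)%E).

Let gamma_gt0 k : (1 <= k <= K)%N -> 0 < gamma k.
Proof. by move=> /gamma_ge; apply: lt_le_trans; rewrite mulr_gt0. Qed.

Let res := dc_residual g h mu pr.
Let obj := dc_real g h r mu.

Lemma measurable_dc_residual : measurable_fun setT (res : borelV R d -> borelV R d).
Proof.
apply: measurable_borelVD.
  apply: measurable_borelVB;
    [exact: (measurable_gradient g_smooth)|exact: (measurable_gradient h_smooth)].
by apply: measurable_borelVZ => //; exact: measurable_borelVB.
Qed.

(** The envelope is evaluated at the selected minimizer, which reduces the claim to measurability of
    [pr] and of the lower semicontinuous [r]. *)
Lemma measurable_dc_real : measurable_fun setT (obj : borelV R d -> R).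
Proof.
apply: measurable_funD.
  apply: measurable_funB; [exact: (measurable_smooth g_smooth)|exact: (measurable_smooth h_smooth)].
under eq_fun do rewrite (fine_moreau_prox r_proper (pr_prox _)).
apply: measurable_funD.
  apply: measurable_funM => //; apply: measurable_dotv; exact: measurable_borelVB.
apply: measurableT_comp => //.
exact: (measurableT_comp (lower_semicontinuous_borelV_measurable r_lsc) pr_measurable).
Qed.

Lemma x_measurable k : (1 <= k <= K.+1)%N -> measurable_fun setT (x k : O -> borelV R d).
Proof.
move=> kK; apply: (adapted_measurable (tau := tau) (xi := xi) (sg := sg)).
exact: (x_adapted g_oracle h_oracle mu_gt0 gamma_gt0 pr_measurable algo).
Qed.

Section one_stage.
Variable k : nat.
Hypothesis kK : (1 <= k <= K)%N.

Let Lam := L + mu^-1 + gamma k.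
Let z w : 'rV[R]_d := x k w - Lam^-1 *: res (x k w).
Let e t w : 'rV[R]_d :=
  noise g dg (y k t w) (xi k t w) - noise h dh (x k w) (sg k t w).

Let Lam_gt0 : 0 < Lam.
Proof. by rewrite /Lam !addr_gt0 ?invr_gt0// gamma_gt0. Qed.

Let kK1 : (1 <= k <= K.+1)%N.
Proof. by have /andP[-> kK'] := kK; rewrite ltnW. Qed.

Let x_ad : adapted xi sg tau k 1 (x k : O -> borelV R d).
Proof. exact: (x_adapted g_oracle h_oracle mu_gt0 gamma_gt0 pr_measurable algo). Qed.

Let y_ad t : (1 <= t <= (T k).+1)%N -> adapted xi sg tau k t (y k t : O -> borelV R d).
Proof. exact: (y_adapted g_oracle h_oracle mu_gt0 gamma_gt0 pr_measurable algo kK x_ad). Qed.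

Let mx : measurable_fun setT (x k : O -> borelV R d).
Proof. exact: x_measurable. Qed.

Let my t : (1 <= t <= (T k).+1)%N -> measurable_fun setT (y k t : O -> borelV R d).
Proof. by move=> tT; exact: (adapted_measurable (y_ad tT)). Qed.

Let mres : measurable_fun setT ((fun w => res (x k w)) : O -> borelV R d).
Proof. exact: (measurableT_comp measurable_dc_residual mx). Qed.

Let drawn_mono t : (1 <= t)%N -> drawn_before k 1 `<=` drawn_before k t.
Proof.
by move=> t1 [[[k' t']|[k' t']]|[]] //= /orP[->//|/andP[-> H]];
  apply/orP; right; exact: leq_trans H t1.
Qed.

Let x_ad' t : (1 <= t)%N -> adapted xi sg tau k t (x k : O -> borelV R d).
Proof. by move=> t1; apply: adapted_mono x_ad; exact: drawn_mono. Qed.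

Let z_ad t : (1 <= t)%N -> adapted xi sg tau k t (z : O -> borelV R d).
Proof.
move=> t1; apply: measurable_borelVB; first exact: x_ad'.
apply: measurable_borelVZ => //.
exact: (measurableT_comp measurable_dc_residual (x_ad' t1)).
Qed.

Let noise_g t : (1 <= t <= (T k).+1)%N ->
  measurable_fun setT ((fun w => noise g dg (y k t w) (xi k t w)) : O -> borelV R d) /\
  (sqr_integral P (fun w => noise g dg (y k t w) (xi k t w)) <= (G ^+ 2)%:E)%E.
Proof.
move=> tT; split.
  exact: (measurable_noise_comp g_oracle g_smooth (my tT) (measurable_funPT _)).
apply: (noise_sqr_integral_le g_oracle g_smooth (my tT) (my tT) (measurable_funPT _)).
  move=> A B mA mB; apply: (adapted_xi_indep samples) => //.
  by apply: measurable_fun_pair; exact: y_ad.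
exact: (variance_g_le g_oracle h_oracle g_smooth h_smooth noise_bound).
Qed.

Let noise_h t : (1 <= t <= (T k).+1)%N ->
  measurable_fun setT ((fun w => noise h dh (x k w) (sg k t w)) : O -> borelV R d) /\
  (sqr_integral P (fun w => noise h dh (x k w) (sg k t w)) <= (G ^+ 2)%:E)%E.
Proof.
move=> /andP[t1 _]; split.
  exact: (measurable_noise_comp h_oracle h_smooth mx (measurable_funPT _)).
apply: (noise_sqr_integral_le h_oracle h_smooth mx mx (measurable_funPT _)).
  move=> A B mA mB; apply: (adapted_sg_indep samples) => //.
  by apply: measurable_fun_pair; exact: x_ad'.
exact: (variance_h_le g_oracle h_oracle g_smooth h_smooth noise_bound).
Qed.

Let me t : (1 <= t <= (T k).+1)%N -> measurable_fun setT (e t : O -> borelV R d).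
Proof.
by move=> tT; apply: measurable_borelVB; [exact: (noise_g tT).1|exact: (noise_h tT).1].
Qed.

Let e_sqr t : (1 <= t <= (T k).+1)%N -> (sqr_integral P (e t) <= (4 * G ^+ 2)%:E)%E.
Proof.
move=> tT; apply: le_trans (sqr_integralD _ _ _) _; first exact: (noise_g tT).1.
  by apply: measurable_borelVN; exact: (noise_h tT).1.
rewrite sqr_integralN (_ : 4 * G ^+ 2 = 2 * G ^+ 2 + 2 * G ^+ 2); last by lra.
rewrite -[leRHS]/((2 * G ^+ 2)%:E + (2 * G ^+ 2)%:E)%E.
apply: leeD; rewrite EFinM; apply: lee_wpmul2l => //.
  exact: (noise_g tT).2.
exact: (noise_h tT).2.
Qed.

Let step t w : (1 <= t <= T k)%N ->
  argmin (spg_objective mu (gamma k) (spg_eta (gamma k) t)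
    (gradient g (y k t w) + e t w - dc_linear h mu pr (x k w)) (x k w) (y k t w)) (y k t.+1 w).
Proof.
move=> tT; rewrite (_ : _ - _ = dg (y k t w) (xi k t w) - dh (x k w) (sg k t w)
    - mu^-1 *: pr (x k w)); first exact: (spg_step algo w kK tT).
by rewrite /e /noise /dc_linear; apply/rowP => i; rewrite !mxE; ring.
Qed.

Lemma residual_sqr_le w : (4 * Lam)^-1 * dotv (res (x k w)) (res (x k w)) <=
  obj (x k w) - Fmin.
Proof.
have := dc_residual_le g_convex h_convex L_gt0 g_smooth h_smooth r_proper mu_gt0 pr_prox
  (x k w) (gamma_ge kK) (erefl Lam).
by have := Fmin_le (x k w - Lam^-1 *: res (x k w)); rewrite /obj /res; lra.
Qed.

Let res_sqr_lty : (sqr_integral P (fun w => res (x k w)) < +oo)%E.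
Proof.
have L4 : 0 < (4 * Lam)^-1 by rewrite invr_gt0 mulr_gt0.
have : ((4 * Lam)^-1%:E * sqr_integral P (fun w => res (x k w)) < +oo)%E.
  rewrite -ge0_integralZl_EFin ?(ltW L4)//; last 2 first.
  - by move=> w _; rewrite lee_fin dotv_ge0.
  - exact: measurable_sqr.
  apply: le_lt_trans (ltry Delta); apply: le_trans (Delta_bound kK).
  apply: le_nonmeasurable_integral => w; first by rewrite -EFinM lee_fin mulr_ge0 ?dotv_ge0// ltW.
  by rewrite -EFinM lee_fin residual_sqr_le.
by case: (sqr_integral P _) (sqr_integral_ge0 P (fun w => res (x k w))) => [s||]//= _;
  rewrite ?ltry// gt0_muley// lte_fin.
Qed.

(** Subtracting [x k] from the closed form of the step leaves the previous difference, the noise, a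
    gradient difference bounded by Lipschitz continuity, and the residual at [x k]; each is
    square-integrable. *)
Let yx_sqr_lty t : (1 <= t <= (T k).+1)%N ->
  (sqr_integral P (fun w => y k t w - x k w)%R < +oo)%E.
Proof.
elim: t => // -[_ _|t IH tT].
  rewrite (_ : sqr_integral P _ = 0)%E ?ltry//; apply: integral0_eq => w _.
  by rewrite (spg_init algo w kK) subrr /dotv big1// => i _; rewrite mxE mul0r.
have tT0 : (1 <= t.+1 <= T k)%N by [].
have tT' : (1 <= t.+1 <= (T k).+1)%N by rewrite /= ltnS ltnW.
have {}IH := IH tT'.
have eta0 : 0 < spg_eta (gamma k) t.+1 by rewrite divr_gt0// mulr_gt0// gamma_gt0.
set q := (spg_eta (gamma k) t.+1)^-1; set m := mu^-1 + gamma k + q.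
have m0 : 0 < m by rewrite /m !addr_gt0 ?invr_gt0// gamma_gt0.
have yE w : y k t.+2 w - x k w = m^-1 *: (q *: (y k t.+1 w - x k w) -
    (e t.+1 w + (gradient g (y k t.+1 w) - gradient g (x k w)) + res (x k w))).
  apply: (scalerI (lt0r_neq0 m0)); rewrite (spg_argminE mu_gt0 (gamma_gt0 kK) eta0 (step w tT0)).
  rewrite -/q -/m scalerBr !scalerA !mulfV ?gt_eqF// !scale1r /m /res dc_residualE.
  by apply/rowP => i; rewrite !mxE; ring.
rewrite (_ : (fun w => _) = fun w => m^-1 *: (q *: (y k t.+1 w - x k w) -
    (e t.+1 w + (gradient g (y k t.+1 w) - gradient g (x k w)) + res (x k w)))); last first.
  exact/funext.
have mye := my tT'; have mee := me tT'.
have mgrad (X : O -> borelV R d) : measurable_fun setT X ->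
    measurable_fun setT ((fun w => gradient g (X w)) : O -> borelV R d).
  exact: (measurableT_comp (measurable_gradient g_smooth)).
have mgg : measurable_fun setT
    ((fun w => gradient g (y k t.+1 w) - gradient g (x k w)) : O -> borelV R d).
  by apply: measurable_borelVB; exact: mgrad.
have myx : measurable_fun setT ((fun w => y k t.+1 w - x k w) : O -> borelV R d).
  exact: measurable_borelVB.
have mD : measurable_fun setT ((fun w => e t.+1 w +
    (gradient g (y k t.+1 w) - gradient g (x k w)) + res (x k w)) : O -> borelV R d).
  by apply: measurable_borelVD => //; exact: measurable_borelVD.
have mqyx : measurable_fun setT ((fun w => q *: (y k t.+1 w - x k w)) : O -> borelV R d).
  exact: measurable_borelVZ.
apply: sqr_integralZ_lty; first exact: measurable_borelVB.
apply: sqr_integralB_lty => //; first exact: sqr_integralZ_lty.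
apply: sqr_integralD_lty => //; first exact: measurable_borelVD.
apply: sqr_integralD_lty => //; first by apply: le_lt_trans (e_sqr tT') (ltry _).
exact: (sqr_integral_gradient_lty L_gt0 g_smooth mye mx IH).
Qed.

Let V t w : 'rV[R]_d := y k t w - z w.

Let V_ad t : (1 <= t <= (T k).+1)%N -> adapted xi sg tau k t (V t : O -> borelV R d).
Proof.
by move=> tT; apply: measurable_borelVB; [exact: y_ad|apply: z_ad; case/andP: tT].
Qed.

Let V_sqr_lty t : (1 <= t <= (T k).+1)%N -> (sqr_integral P (V t) < +oo)%E.
Proof.
move=> tT; have mye := my tT.
have -> : V t = fun w => (y k t w - x k w) + Lam^-1 *: res (x k w).
  by apply/funext => w; rewrite /V /z opprB addrCA addrC.
apply: sqr_integralD_lty; [exact: measurable_borelVB|exact: measurable_borelVZ|exact: yx_sqr_lty|].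
exact: sqr_integralZ_lty.
Qed.

(** The two oracles are treated separately: V_t is known before iteration t, and each sample of that
    iteration is independent of it. *)
Let martingale t : (1 <= t <= (T k).+1)%N ->
  P.-integrable setT (fun w => (dotv (e t w) (V t w))%:E) /\
  (\int[P]_w (dotv (e t w) (V t w))%:E = 0)%E.
Proof.
move=> tT; have t1 : (1 <= t)%N by case/andP: tT.
have mV := adapted_measurable (V_ad tT).
have [ig ig0] := noise_dotv_mean0 g_oracle g_smooth (my tT) mV (measurable_funPT (xi k t))
  (fun A B mA mB => adapted_xi_indep samples (measurable_fun_pair (y_ad tT) (V_ad tT)) mA mB)
  (variance_g_le g_oracle h_oracle g_smooth h_smooth noise_bound) (V_sqr_lty tT).
have [ih ih0] := noise_dotv_mean0 h_oracle h_smooth mx mV (measurable_funPT (sg k t))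
  (fun A B mA mB => adapted_sg_indep samples (measurable_fun_pair (x_ad' t1) (V_ad tT)) mA mB)
  (variance_h_le g_oracle h_oracle g_smooth h_smooth noise_bound) (V_sqr_lty tT).
have E : (fun w => (dotv (e t w) (V t w))%:E) = (fun w =>
    (dotv (noise g dg (y k t w) (xi k t w)) (V t w))%:E -
    (dotv (noise h dh (x k w) (sg k t w)) (V t w))%:E)%E.
  by apply/funext => w; rewrite /e dotvDl dotvNl EFinB.
rewrite E; split; first exact: integrableB.
by rewrite (integralB measurableT ig ih) ig0 ih0 sube0.
Qed.

Let S : R := \sum_(2 <= t < (T k).+2) t%:R.

Let S_ge : (T k)%:R ^+ 2 <= 2 * S.
Proof.
rewrite /S; elim: (T k) => [|n IH]; first by rewrite big_geq// expr0n mulr0.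
by rewrite big_nat_recr//= mulrDr -(natr1 n.+1) -!(natr1 n); move: IH; lra.
Qed.

(** The noise constant: E|e|^2 <= 2 G^2 + 2 G^2, the weighted sum gives 24 G^2 T/(gamma S), T/S <=
    2/T, and gamma T >= 3 L k turn it into 48 G^2/(3 L k). *)
Lemma stage_expectation :
  (\int[P]_w ((obj (x k.+1 w) - Fmin) +
     ((8 * Lam)^-1 * dotv (res (x k w)) (res (x k w))
      + gamma k / 2 * dotv (x k.+1 w - x k w) (x k.+1 w - x k w)))%:E <=
   \int[P]_w (obj (x k w) - Fmin)%:E + (16 * G ^+ 2 / (L * k%:R))%:E)%E.
Proof.
have T0 : 0 < (T k)%:R :> R by rewrite ltr0n (leq_trans _ (T_ge3 kK)).
have S0 : 0 < S by have := exprn_gt0 2 T0; have := S_ge; lra.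
have mx' : measurable_fun setT (x k.+1 : O -> borelV R d).
  by apply: x_measurable; case/andP: kK => _; rewrite ltnS.
have tT t : t \in index_iota 1 (T k).+1 -> (1 <= t <= (T k).+1)%N.
  by rewrite mem_index_iota => /andP[-> /ltnW].
have [ixi xi0] := integrable_sum_mean0 (s := index_iota 1 (T k).+1)
  (fun t => S^-1 * t.+1%:R) (fun t ts => martingale (tT t ts)).
have mobj (X : O -> borelV R d) : measurable_fun setT X ->
    measurable_fun setT (fun w => obj (X w) - Fmin).
  by move=> mX; apply: measurable_funB => //; exact: (measurableT_comp measurable_dc_real mX).
have obj0 v : 0 <= obj v - Fmin by rewrite subr_ge0.
have mE : measurable_fun setT (fun w => \sum_(1 <= t < (T k).+1)
    S^-1 * (6 / gamma k) * dotv (e t w) (e t w)).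
  exact: (sum_sqr_integral_le _ (fun t ts => conj (me (tT t ts)) (e_sqr (tT t ts)))).1.
have E0 w : 0 <= \sum_(1 <= t < (T k).+1) S^-1 * (6 / gamma k) * dotv (e t w) (e t w).
  by apply: sumr_ge0 => t _; rewrite !mulr_ge0 ?dotv_ge0 ?invr_ge0 ?(ltW S0) ?(ltW (gamma_gt0 kK)).
apply: (@le_trans _ _ (\int[P]_w ((obj (x k w) - Fmin) + \sum_(1 <= t < (T k).+1)
    S^-1 * (6 / gamma k) * dotv (e t w) (e t w))%:E)%E).
  (* For k = K no integrability of F(x_{K+1}) is available beforehand; this comparison removes the
     centred term without it. *)
  apply: (le_integral_mean0 _ _ _ _ ixi xi0).
  - apply: measurable_funD; first exact: mobj.
    apply: measurable_funD; apply: measurable_funM => //; apply: measurable_dotv => //;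
      exact: measurable_borelVB.
  - by apply: measurable_funD => //; exact: mobj.
  - move=> w; apply: addr_ge0 => //; apply: addr_ge0; rewrite mulr_ge0 ?dotv_ge0//.
      by rewrite invr_ge0 mulr_ge0// ltW.
    by rewrite divr_ge0// ltW// gamma_gt0.
  - by move=> w; apply: addr_ge0.
  - move=> w.
    have := spg_stage_dc_le g_convex h_convex L_gt0 g_smooth h_smooth r_proper mu_gt0 pr_prox
      (x' := x k.+1 w) (y := fun t => y k t w) (e := fun t => e t w)
      (gamma_ge kK) (T_ge3 kK) (spg_init algo w kK) (fun t tT => step w tT) (erefl S)
      (spg_output algo w kK) (erefl Lam) (erefl (z w)).
    have -> : S^-1 * (\sum_(1 <= t < (T k).+1) (- (t.+1%:R * dotv (e t w) (y k t w - z w))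
        + 6 / gamma k * dotv (e t w) (e t w))) =
        - (\sum_(1 <= t < (T k).+1) S^-1 * t.+1%:R * dotv (e t w) (V t w))
        + \sum_(1 <= t < (T k).+1) S^-1 * (6 / gamma k) * dotv (e t w) (e t w).
      rewrite big_split/= mulrDr sumrN mulrN !mulr_sumr.
      by congr (- _ + _); apply: eq_bigr => t _; rewrite mulrA.
    by rewrite -/res -/obj; lra.
under eq_integral do rewrite EFinD.
rewrite ge0_integralD//; last 4 first.
- by move=> w _; rewrite lee_fin.
- by apply/measurable_EFinP; exact: mobj.
- by move=> w _; rewrite lee_fin.
- exact/measurable_EFinP.
apply: leeD => //.
have c0 : 0 <= S^-1 * (6 / gamma k).
  by rewrite mulr_ge0 ?divr_ge0 ?invr_ge0 ?(ltW S0) ?(ltW (gamma_gt0 kK)).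
apply: le_trans ((sum_sqr_integral_le _ (fun t ts => conj (me (tT t ts)) (e_sqr (tT t ts)))).2 c0) _.
rewrite lee_fin size_iota subn1/=.
have k0 : 0 < k%:R :> R by rewrite ltr0n; case/andP: kK.
have g0 := gamma_gt0 kK; have gT := gammaT kK.
have TS : (T k)%:R / S <= 2 / (T k)%:R.
  by rewrite ler_pdivrMr// mulrAC ler_pdivlMr// -expr2.
have gTV : (gamma k * (T k)%:R)^-1 <= (3 * L * k%:R)^-1.
  by rewrite lef_pV2 ?posrE ?mulr_gt0.
have G0 : 0 <= G ^+ 2 := sqr_ge0 G.
apply: (@le_trans _ _ (24 * G ^+ 2 / gamma k * (2 / (T k)%:R))).
  have -> : (T k)%:R * (S^-1 * (6 / gamma k) * (4 * G ^+ 2)) =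
      24 * G ^+ 2 / gamma k * ((T k)%:R / S) by ring.
  have c1 : 0 <= 24 * G ^+ 2 / gamma k by rewrite divr_ge0// ?(ltW g0)// mulr_ge0.
  exact: ler_wpM2l.
have -> : 24 * G ^+ 2 / gamma k * (2 / (T k)%:R) =
    48 * G ^+ 2 * (gamma k * (T k)%:R)^-1 by field; rewrite !gt_eqF.
apply: le_trans (ler_wpM2l _ gTV) _; first by rewrite mulr_ge0.
rewrite le_eqVlt; apply/orP; left; apply/eqP.
by field; rewrite !gt_eqF.
Qed.

End one_stage.

Let x_tau_indep k (A : set (borelV R d)) (B : set nat) : (1 <= k <= K)%N ->
  measurable A -> (P (x k @^-1` A `&` tau @^-1` B) = P (x k @^-1` A) * P (tau @^-1` B))%E.
Proof.
move=> /andP[k1 kK] mA; have kK1 : (1 <= k <= K.+1)%N by rewrite k1 ltnW.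
have mx : adapted xi sg tau k 1 (x k : O -> borelV R d).
  exact: (x_adapted g_oracle h_oracle mu_gt0 gamma_gt0 pr_measurable algo).
exact: (adapted_tau_indep samples B mx mA).
Qed.

Let x_meas k : (1 <= k <= K)%N -> measurable_fun setT (x k : O -> borelV R d).
Proof. by move=> /andP[k1 kK]; apply: x_measurable; rewrite k1 ltnW. Qed.

Let x_measS k : (1 <= k <= K)%N -> measurable_fun setT (x k.+1 : O -> borelV R d).
Proof. by move=> /andP[k1 kK]; exact: x_measurable. Qed.

Let Phi k : \bar R := (\int[P]_w (obj (x k w) - Fmin)%:E)%E.

Let obj_ge0 v : 0 <= obj v - Fmin.
Proof. by rewrite subr_ge0. Qed.

Let Phi_ge0 k : (0 <= Phi k)%E.
Proof. by apply: integral_ge0 => w _; rewrite lee_fin. Qed.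

Let Phi_fin k : (1 <= k <= K)%N -> Phi k \is a fin_num.
Proof.
move=> kK; rewrite ge0_fin_numE//; apply: le_lt_trans (Delta_bound kK) _; exact: ltry.
Qed.

Let mobj (X : O -> borelV R d) : measurable_fun setT X ->
  measurable_fun setT (fun w => (obj (X w) - Fmin)%:E).
Proof.
move=> mX; apply/measurable_EFinP; apply: measurable_funB => //.
exact: (measurableT_comp measurable_dc_real mX).
Qed.

Let noise_const : R := 16 * G ^+ 2 / L.

Let noise_const_ge0 : 0 <= noise_const.
Proof.
by apply: divr_ge0; [apply: mulr_ge0; rewrite ?sqr_ge0|exact: ltW].
Qed.

Let noise_constE k : 16 * G ^+ 2 / (L * k%:R) = noise_const / k%:R.
Proof. by rewrite /noise_const -[RHS]mulrA -invfM. Qed.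

Let mresx k : (1 <= k <= K)%N ->
  measurable_fun setT ((fun w => res (x k w)) : O -> borelV R d).
Proof. by move=> kK; exact: (measurableT_comp measurable_dc_residual (x_meas kK)). Qed.

(** From gamma_k >= 3 L; the bound depends neither on mu nor on K, as the drift estimate of part (b)
    demands. *)
Lemma increment_sqr_le k : (1 <= k <= K)%N ->
  (sqr_integral P (fun w => x k.+1 w - x k w)%R <=
   (2 / (3 * L) * (Delta + 16 * G ^+ 2 / L))%:E)%E.
Proof.
move=> kK; have g0 := gamma_gt0 kK.
have mdx : measurable_fun setT ((fun w => x k.+1 w - x k w) : O -> borelV R d).
  by apply: measurable_borelVB; [exact: x_measS|exact: x_meas].
have k1 : 1 <= k%:R :> R by rewrite ler1n; case/andP: kK.
have H : ((gamma k / 2)%:E * sqr_integral P (fun w => x k.+1 w - x k w)%R <=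
    (Delta + noise_const)%:E)%E.
  rewrite -ge0_integralZl_EFin; last 4 first.
  - by [].
  - by move=> w _; rewrite lee_fin dotv_ge0.
  - exact: measurable_sqr.
  - by rewrite divr_ge0// ltW.
  apply: (@le_trans _ _ (Phi k + (noise_const / k%:R)%:E)%E); last first.
    rewrite EFinD; apply: leeD; first exact: Delta_bound.
    by rewrite lee_fin ler_piMr// invf_le1// ltr0n; case/andP: kK.
  rewrite -noise_constE; apply: le_trans (stage_expectation kK).
  apply: le_nonmeasurable_integral => w; rewrite -EFinM lee_fin.
    by rewrite mulr_ge0 ?dotv_ge0// divr_ge0// ltW.
  have := obj_ge0 (x k.+1 w).
  have : 0 <= (8 * (L + mu^-1 + gamma k))^-1 * dotv (res (x k w)) (res (x k w)).
    by rewrite mulr_ge0 ?dotv_ge0// invr_ge0 mulr_ge0// ltW// !addr_gt0 ?invr_gt0.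
  by lra.
rewrite -(@lee_pmul2l _ (gamma k / 2)%:E) ?lte_fin ?divr_gt0//.
apply: le_trans H _; rewrite -EFinM lee_fin mulrA -[leLHS]mul1r ler_wpM2r//.
  by rewrite addr_ge0// -lee_fin (le_trans (Phi_ge0 k))// Delta_bound.
have := gamma_ge kK => gk.
have -> : gamma k / 2 * (2 / (3 * L)) = gamma k / (3 * L) by field; rewrite gt_eqF.
by rewrite ler_pdivlMr ?mul1r ?mulr_gt0.
Qed.

Hypotheses (K_gt0 : (1 <= K)%N) (alpha_ge1 : 1 <= alpha).
Variable Lam : R.
Hypothesis Lam_ge : forall k, (1 <= k <= K)%N -> L + mu^-1 + gamma k <= Lam.

Let p k : R := k%:R `^ alpha / \sum_(1 <= j < K.+1) j%:R `^ alpha.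

Let Lam_gt0 : 0 < Lam.
Proof.
have kK : (1 <= 1 <= K)%N by rewrite K_gt0.
by apply: lt_le_trans (Lam_ge kK); rewrite !addr_gt0 ?invr_gt0// gamma_gt0.
Qed.

Let stage_residual k : (1 <= k <= K)%N ->
  (Phi k.+1 + ((8 * Lam)^-1)%:E * sqr_integral P (fun w => res (x k w)) <=
   Phi k + (noise_const / k%:R)%:E)%E.
Proof.
move=> kK; rewrite -noise_constE; apply: le_trans (stage_expectation kK).
have c0 : 0 <= (8 * Lam)^-1 by rewrite invr_ge0 mulr_ge0// ltW.
rewrite -ge0_integralZl_EFin//; last 2 first.
- by move=> w _; rewrite lee_fin dotv_ge0.
- by apply: measurable_sqr; exact: mresx.
rewrite -ge0_integralD//; last 4 first.
- by move=> w _; rewrite lee_fin.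
- by apply: mobj; exact: x_measS.
- by move=> w _; rewrite -EFinM lee_fin mulr_ge0 ?dotv_ge0.
- by apply: measurable_funeM; apply: measurable_sqr; exact: mresx.
apply: le_nonmeasurable_integral => w; rewrite -EFinM -EFinD lee_fin.
  by rewrite addr_ge0// mulr_ge0 ?dotv_ge0.
rewrite lerD2l -[leLHS]addr0 lerD//.
  rewrite ler_wpM2r ?dotv_ge0// lef_pV2 ?posrE ?mulr_gt0//; last first.
    by rewrite !addr_gt0 ?invr_gt0// gamma_gt0.
  by rewrite ler_pM2l// Lam_ge.
by rewrite mulr_ge0 ?dotv_ge0// divr_ge0// ltW// gamma_gt0.
Qed.

Let res_fin k : (1 <= k <= K)%N ->
  sqr_integral P (fun w => res (x k w)) \is a fin_num.
Proof.
move=> kK; rewrite ge0_fin_numE ?sqr_integral_ge0//.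
have c0 : 0 < (8 * Lam)^-1 by rewrite invr_gt0 mulr_gt0.
have : (((8 * Lam)^-1)%:E * sqr_integral P (fun w => res (x k w)) < +oo)%E.
  apply: le_lt_trans (le_trans (leeDr _ (Phi_ge0 k.+1)) (stage_residual kK)) _.
  by rewrite -(fineK (Phi_fin kK)) -EFinD ltry.
by case: (sqr_integral P _) (sqr_integral_ge0 P (fun w => res (x k w))) => [s||]//= _;
  rewrite ?ltry// gt0_muley// lte_fin.
Qed.

Lemma residual_average_le :
  (\sum_(1 <= k < K.+1) (p k)%:E * sqr_integral P (fun w => res (x k w)) <=
   (2 `^ (alpha + 1) * (8 * Lam) * (Delta + 16 * G ^+ 2 / L) / K%:R)%:E)%E.
Proof.
pose b k := fine (sqr_integral P (fun w => res (x k w))).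
have bE k : k \in index_iota 1 K.+1 ->
    ((p k)%:E * sqr_integral P (fun w => res (x k w)))%E = (p k * b k)%:E.
  by rewrite mem_index_iota ltnS => kK; rewrite /b [RHS]EFinM fineK// res_fin.
rewrite big_seq (eq_bigr _ bE) -big_seq sumEFin lee_fin.
apply: (powR_average_le (a := fun k => fine (Phi k))) => //.
- by rewrite mulr_gt0.
- by move=> k; rewrite fine_ge0.
- by move=> k kK; rewrite -lee_fin fineK ?Phi_fin//; exact: Delta_bound.
- move=> k /andP[k1 kK]; have kK' : (1 <= k <= K)%N by rewrite k1 ltnW.
  rewrite /b; move: (stage_residual kK') (Phi_fin kK') (Phi_fin (kK : (1 <= k.+1 <= K)%N)) (res_fin kK').
  case: (Phi k.+1) => [u||]//; case: (Phi k) => [v||]//; case: (sqr_integral P _) => [s||]//.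
have KK : (1 <= K <= K)%N by rewrite K_gt0 leqnn.
rewrite /b; move: (le_trans (leeDr _ (Phi_ge0 K.+1)) (stage_residual KK)) (Phi_fin KK) (res_fin KK).
case: (Phi K) => [v||]//; case: (sqr_integral P _) => [s||]//.
Qed.

Let p_sum1 : \sum_(1 <= k < K.+1) p k = 1.
Proof.
rewrite /p -mulr_suml mulfV// gt_eqF// big_ltn// ltr_pwDl ?powR_gt0//.
by rewrite sumr_ge0// => j _; exact: powR_ge0.
Qed.

Let p_ge0 k : (1 <= k <= K)%N -> 0 <= p k.
Proof. by move=> kK; rewrite -lee_fin -(tau_law samples kK). Qed.

Let prox_sqr_average B :
  (forall k, (1 <= k <= K)%N -> (sqr_integral P (fun w => x k w - pr (x k w))%R <= B%:E)%E) ->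
  (\sum_(1 <= k < K.+1) (p k)%:E * sqr_integral P (fun w => x k w - pr (x k w))%R <= B%:E)%E.
Proof.
move=> HB; rewrite -[B in leRHS]mul1r -p_sum1 mulr_suml -sumEFin big_seq [leRHS]big_seq.
apply: lee_sum => k; rewrite mem_index_iota ltnS => kK; rewrite [leRHS]EFinM.
by apply: lee_wpmul2l; rewrite ?lee_fin ?p_ge0// HB.
Qed.

Lemma prox_distance_average_le (eps B : R) : 0 < eps ->
  (forall k, (1 <= k <= K)%N -> (sqr_integral P (fun w => x k w - pr (x k w))%R <= B%:E)%E) ->
  (\int[P]_w (enorm (x (tau w) w - pr (x (tau w) w)))%:E <= (eps / 2 + B / (2 * eps))%:E)%E.
Proof.
move=> eps0 HB.
apply: (random_index_enorm_le (tau_range samples) (tau_law samples) x_meas x_tau_indep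
  p_sum1 (V := fun v => v - pr v) eps0 _ (prox_sqr_average HB)).
exact: measurable_borelVB.
Qed.

(** The residual is small only on average over the stages, whereas the proximal distance is bounded
    at every stage and keeps its bound because the weights sum to one. *)
Lemma stationarity_gap_average_le (eps B : R) : 0 < eps ->
  (forall k, (1 <= k <= K)%N -> (sqr_integral P (fun w => x k w - pr (x k w))%R <= B%:E)%E) ->
  (\int[P]_w stationarity_gap g h r (pr (x (tau w) w)) <=
   (eps / 2 + (2 * (2 `^ (alpha + 1) * (8 * Lam) * (Delta + 16 * G ^+ 2 / L) / K%:R)
               + 8 * L ^+ 2 * B) / (2 * eps))%:E)%E.
Proof.
move=> eps0 HB.
apply: (@le_trans _ _ (\int[P]_w (enorm (prox_gap g h mu pr (x (tau w) w)))%:E)%E).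
  apply: le_nonmeasurable_integral => w; first exact: stationarity_gap_ge0.
  exact: stationarity_gap_le.
have mgrad (f : 'rV[R]_d -> R) : L_smooth L f ->
    measurable_fun setT ((fun v => gradient f (pr v)) : borelV R d -> borelV R d).
  by move=> sf; exact: (measurableT_comp (measurable_gradient sf) pr_measurable).
have mvp : measurable_fun setT ((fun v => v - pr v) : borelV R d -> borelV R d).
  exact: measurable_borelVB.
have mgap : measurable_fun setT (prox_gap g h mu pr : borelV R d -> borelV R d).
  apply: measurable_borelVB; last exact: measurable_borelVZ.
  by apply: measurable_borelVB; exact: mgrad.
apply: (random_index_enorm_le (tau_range samples) (tau_law samples) x_meas x_tau_indep
  p_sum1 (V := prox_gap g h mu pr) eps0 mgap).
have c8 : 0 <= 8 * L ^+ 2 by apply: mulr_ge0; rewrite ?sqr_ge0.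
apply: (@le_trans _ _ (2%:E * (\sum_(1 <= k < K.+1) (p k)%:E * sqr_integral P (fun w => res (x k w)))
  + (8 * L ^+ 2)%:E * (\sum_(1 <= k < K.+1) (p k)%:E *
      sqr_integral P (fun w => x k w - pr (x k w))%R))%E); last first.
  rewrite [leRHS]EFinD; apply: leeD; rewrite [leRHS]EFinM; apply: lee_wpmul2l => //.
    exact: residual_average_le.
  exact: prox_sqr_average.
rewrite big_seq [X in (_ <= _ * X + _)%E]big_seq [X in (_ <= _ + _ * X)%E]big_seq.
rewrite ge0_sume_distrr; last first.
  by move=> k; rewrite mem_index_iota ltnS => kK; rewrite mule_ge0 ?lee_fin ?p_ge0 ?sqr_integral_ge0.
rewrite ge0_sume_distrr; last first.
  by move=> k; rewrite mem_index_iota ltnS => kK; rewrite mule_ge0 ?lee_fin ?p_ge0 ?sqr_integral_ge0.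
rewrite -big_split/=; apply: lee_sum => k; rewrite mem_index_iota ltnS => kK.
rewrite [X in (_ <= X + _)%E]muleCA [X in (_ <= _ + X)%E]muleCA -ge0_muleDr; last 2 first.
- by rewrite mule_ge0 ?sqr_integral_ge0.
- by rewrite mule_ge0 ?sqr_integral_ge0.
apply: lee_wpmul2l; first by rewrite lee_fin p_ge0.
have mk : measurable_fun setT ((fun w => x k w - pr (x k w)) : O -> borelV R d).
  exact: (measurableT_comp mvp (x_meas kK)).
rewrite -sqr_integral_lin//; last exact: mresx.
apply: le_nonmeasurable_integral => w; first by rewrite lee_fin dotv_ge0.
by rewrite lee_fin prox_gap_sqr_le.
Qed.

End stage_expectation.

(** * Rates *)

Section parameters.
Variable R : realType.

Lemma nceilE (a : R) : 0 <= a -> (nceil a)%:R = (Num.ceil a)%:~R :> R.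
Proof.
by move=> a0; rewrite /nceil natr_absz ger0_norm// ceil_ge0 (lt_le_trans _ a0)// ltrN10.
Qed.

Lemma nceil_ge (a : R) : 0 <= a -> a <= (nceil a)%:R.
Proof. by move=> a0; rewrite nceilE// ceil_ge. Qed.

Lemma nceil_le (a : R) : 0 <= a -> (nceil a)%:R <= a + 1.
Proof.
by move=> a0; rewrite nceilE// -lerBlDr ltW//; have := ceilB1_lt a; rewrite intrB.
Qed.

(* Parts (a) and (b) are the cases m = 1, theta = 1/3 and m = 2, theta = 1/2, with
   mu = eps^m, gamma_k = 3 L k^theta and K of order eps^-(m+2). *)
Section exponents.
Variables (m : nat) (theta : R).
Hypotheses (theta01 : 0 <= theta <= 1) (thetaE : theta * m.+2%:R = m%:R).

Let K (eps : R) := nceil (1 * (1 / eps ^+ m.+2)).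
Let T (L : R) (k : nat) := nceil (3 * L * k%:R / (3 * L * k%:R `^ theta) + 3).

Let inv_eps_ge1 (eps : R) n : 0 < eps < 1 -> 1 <= (eps ^+ n)^-1.
Proof.
by move=> /andP[e0 e1]; rewrite invf_ge1 ?exprn_gt0// exprn_ile1// ltW.
Qed.

Lemma stages_ge eps : 0 < eps < 1 -> (eps ^+ m.+2)^-1 <= (K eps)%:R.
Proof.
move=> e01; rewrite -[leLHS]div1r -[leLHS]mul1r; apply: nceil_ge.
by rewrite mul1r div1r (le_trans _ (inv_eps_ge1 _ e01)).
Qed.

Lemma stages_gt0 eps : 0 < eps < 1 -> (1 <= K eps)%N.
Proof.
move=> e01; rewrite -(ler_nat R); apply: le_trans (stages_ge e01).
exact: inv_eps_ge1.
Qed.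

Lemma stages_le eps : 0 < eps < 1 -> (K eps)%:R <= 2 * (eps ^+ m.+2)^-1.
Proof.
move=> e01; have e1 := inv_eps_ge1 m.+2 e01.
apply: le_trans (nceil_le _) _; rewrite mul1r div1r; first by lra.
by lra.
Qed.

Let stages_powR_le eps s n : 0 < eps < 1 -> 0 <= s -> s * m.+2%:R = n%:R ->
  (K eps)%:R `^ s <= 2 `^ s * (eps ^+ n)^-1.
Proof.
move=> /[dup] e01 /andP[e0 _] s0 sE.
have ie0 : 0 <= eps^-1 by rewrite invr_ge0 ltW.
apply: (@le_trans _ _ ((2 * (eps ^+ m.+2)^-1) `^ s)).
  by rewrite ge0_ler_powR// ?nnegrE ?stages_le// mulr_ge0// invr_ge0 exprn_ge0// ltW.
rewrite powRM// ?invr_ge0 ?exprn_ge0 ?(ltW e0)// -!exprVn -!powR_mulrn//.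
by rewrite -powRrM [_ * s]mulrC sE.
Qed.

(** K^theta is of order eps^-m = 1/mu: this balance of gamma_K against 1/mu determines theta. *)
Lemma stages_theta_le eps : 0 < eps < 1 -> (K eps)%:R `^ theta <= 2 * (eps ^+ m)^-1.
Proof.
move=> e01; apply: le_trans (stages_powR_le e01 (andP theta01).1 thetaE) _.
rewrite ler_wpM2r// ?invr_ge0 ?exprn_ge0 ?(ltW (andP e01).1)//.
rewrite -[leRHS]powRr1//; apply: ler_powR; first by lra.
by case/andP: theta01.
Qed.

(** The exponent is (2 - theta)(m + 2) = 2 (m + 2) - m = m + 4. *)
Lemma stages_complexity_le eps beta : 0 < eps < 1 -> beta = 2 - theta ->
  (K eps)%:R `^ beta <= 4 * (1 / eps ^+ m.+4).
Proof.
move=> e01 betaE; have /andP[t0 t1] := theta01.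
have b0 : 0 <= beta by lra.
rewrite div1r; apply: le_trans (stages_powR_le (n := m.+4) e01 b0 _) _.
  by rewrite betaE mulrBl thetaE -!(natr1 m.+3) -!(natr1 m.+2) -!(natr1 m.+1) -!(natr1 m); lra.
rewrite ler_wpM2r// ?invr_ge0 ?exprn_ge0 ?(ltW (andP e01).1)//.
have -> : 4 = 2 `^ 2 :> R by rewrite powR_mulrn// expr2; lra.
by apply: ler_powR; lra.
Qed.

Variable L : R.
Hypothesis L_gt0 : 0 < L.

Let ratioE k : (0 < k)%N -> 3 * L * k%:R / (3 * L * k%:R `^ theta) = k%:R `^ (1 - theta) :> R.
Proof.
move=> k0; have k0' : 0 < k%:R :> R by rewrite ltr0n.
have p0 : 0 < k%:R `^ theta :> R by rewrite powR_gt0.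
rewrite powRB ?powRr1 ?ler0n//; last by apply/implyP => _; rewrite gt_eqF.
by field; rewrite !gt_eqF.
Qed.

Lemma iterations_ge k : (0 < k)%N -> k%:R `^ (1 - theta) + 3 <= (T L k)%:R :> R.
Proof.
by move=> k0; rewrite -ratioE//; apply: nceil_ge; rewrite ratioE// addr_ge0// powR_ge0.
Qed.

Lemma iterations_ge3 k : (0 < k)%N -> (3 <= T L k)%N.
Proof.
move=> k0; rewrite -(ler_nat R); apply: le_trans (iterations_ge k0).
by rewrite lerDr powR_ge0.
Qed.

Lemma gamma_iterations_ge k : (0 < k)%N ->
  3 * L * k%:R <= 3 * L * k%:R `^ theta * (T L k)%:R.
Proof.
move=> k0; have p0 : 0 < 3 * L * k%:R `^ theta by rewrite !mulr_gt0 ?powR_gt0 ?ltr0n.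
rewrite -ler_pdivrMl// mulrC ratioE//; apply: le_trans (iterations_ge k0).
by rewrite lerDl.
Qed.

Lemma gamma_ge_3L k : (0 < k)%N -> 3 * L <= 3 * L * k%:R `^ theta.
Proof.
move=> k0; rewrite ler_peMr ?mulr_ge0 ?(ltW L_gt0)//.
by rewrite -[leLHS](powRr0 k%:R) ler_powR ?ler1n// (andP theta01).1.
Qed.

Lemma iterations_sum_le n beta : (0 < n)%N -> beta = 2 - theta ->
  (\sum_(1 <= k < n.+1) T L k)%:R <= 5 * n%:R `^ beta :> R.
Proof.
move=> n0 betaE; have /andP[t0 t1] := theta01.
have -> : n%:R `^ beta = n%:R * n%:R `^ (1 - theta) :> R.
  rewrite (_ : beta = 1 + (1 - theta)); last by rewrite betaE; lra.
  by rewrite powRD ?powRr1//; apply/implyP => _; rewrite pnatr_eq0 -lt0n.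
rewrite natr_sum.
(* Each T_k is at most k^(1 - theta) + 3 + 1, the last 1 from rounding up, and 1 <= n^(1 -
   theta). *)
apply: (@le_trans _ _ (\sum_(1 <= k < n.+1) 5 * n%:R `^ (1 - theta))); last first.
  by rewrite sumr_const_nat subn1/= -[leLHS]mulr_natl mulrCA.
rewrite big_seq [leRHS]big_seq; apply: ler_sum => k; rewrite mem_index_iota ltnS => /andP[k0 kn].
apply: le_trans (nceil_le _) _; rewrite ratioE//.
have kn' : k%:R `^ (1 - theta) <= n%:R `^ (1 - theta) :> R.
  by rewrite ge0_ler_powR ?nnegrE ?ler_nat ?subr_ge0.
have : 1 <= n%:R `^ (1 - theta) :> R.
  by rewrite -[leLHS](powRr0 n%:R) ler_powR ?ler1n// subr_ge0.
lra.
Qed.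

End exponents.
End parameters.

(** * Bounds with constants independent of eps *)

Section rate.
Variables (R : realType) (d : nat)
  (dXi dSg : measure_display) (Xi : measurableType dXi) (Sg : measurableType dSg)
  (PXi : probability Xi R) (PSg : probability Sg R)
  (g h : 'rV[R]_d -> R) (gs : 'rV[R]_d -> Xi -> R) (hs : 'rV[R]_d -> Sg -> R)
  (dg : 'rV[R]_d -> Xi -> 'rV[R]_d) (dh : 'rV[R]_d -> Sg -> 'rV[R]_d)
  (r : 'rV[R]_d -> \bar R) (px : R -> 'rV[R]_d -> 'rV[R]_d)
  (L G alpha Delta : R) (x1 : 'rV[R]_d).
Hypotheses (g_convex : lsc_convex g) (h_convex : lsc_convex h)
  (g_oracle : stochastic_oracle PXi g gs dg)
  (h_oracle : stochastic_oracle PSg h hs dh)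
  (r_proper : proper_fun r) (r_lsc : lower_semicontinuous r)
  (px_sel : prox_selection r px)
  (L_gt0 : 0 < L) (g_smooth : L_smooth L g) (h_smooth : L_smooth L h)
  (noise_bound : bounded_variance PXi PSg dg dh G)
  (alpha_ge1 : 1 <= alpha) (Delta_gt0 : 0 < Delta).

Definition bounded_run (mu : R) (gamma : nat -> R) (T : nat -> nat) (K : nat)
  (dO : measure_display) (O : measurableType dO) (P : probability O R)
  (xi : nat -> nat -> {RV P >-> Xi}) (sg : nat -> nat -> {RV P >-> Sg})
  (tau : {RV P >-> nat}) (x : nat -> O -> 'rV[R]_d) (y : nat -> nat -> O -> 'rV[R]_d) :=
  [/\ run_samples PXi PSg alpha K xi sg tau,
      stagewise_spg dg dh (px mu) mu gamma T K x1
        (fun k t => xi k t) (fun k t => sg k t) x y &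
      forall k, (1 <= k <= K)%N ->
        (\int[P]_w (dc_objective g h r mu (x k w)
                    - ereal_inf (range (dc_objective g h r mu))) <= Delta%:E)%E].

(** The existence of a bounded run forces the infimum to be finite: if it were -oo, the integrand at
    stage 1 would be +oo everywhere. *)
Lemma bounded_run_min mu gamma T K dO (O : measurableType dO) (P : probability O R)
    xi sg tau x y : 0 < mu -> (1 <= K)%N ->
  bounded_run mu gamma T K (P := P) xi sg tau x y ->
  exists2 Fmin : R, forall v, Fmin <= dc_real g h r mu v &
    forall k, (1 <= k <= K)%N ->
      (\int[P]_w (dc_real g h r mu (x k w) - Fmin)%:E <= Delta%:E)%E.
Proof.
move=> mu0 K0 [_ _ bound].
have objE v : dc_objective g h r mu v = (dc_real g h r mu v)%:E.
  exact: (dc_objective_EFin g h r_proper mu0 (fun v => px_prox px_sel v mu0)).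
have infle v : (ereal_inf (range (dc_objective g h r mu)) <= (dc_real g h r mu v)%:E)%E.
  by apply: ereal_inf_lbound; exists v.
case E : (ereal_inf _) infle bound => [Fmin||] infle bound.
- exists Fmin => [v|k kK]; first by rewrite -lee_fin infle.
  apply: le_trans (bound k kK); rewrite le_eqVlt; apply/orP; left; apply/eqP.
  by apply: eq_integral => w _; rewrite objE EFinB.
- by have := infle 0.
- have := bound 1%N; rewrite /= K0 => /(_ isT) H.
  suff : ((Delta + 1)%:E <= Delta%:E)%E by rewrite lee_fin gerDl ler10.
  apply: le_trans H; rewrite -(probability_integral_cst P (Delta + 1)).
  apply: le_nonmeasurable_integral => w; first by rewrite lee_fin addr_ge0// ltW.
  by rewrite objE /= leey.
Qed.

Variables (m : nat) (theta : R).
Hypotheses (theta01 : 0 <= theta <= 1) (thetaE : theta * m.+2%:R = m%:R).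

Let gamma (k : nat) : R := 3 * L * k%:R `^ theta.
Let T (k : nat) : nat := nceil (3 * L * k%:R / gamma k + 3).
Let K (eps : R) : nat := nceil (1 * (1 / eps ^+ m.+2)).

Lemma run_increment_sqr_le eps dO (O : measurableType dO) (P : probability O R)
    xi sg tau x y : 0 < eps < 1 ->
  bounded_run (eps ^+ m) gamma T (K eps) (P := P) xi sg tau x y ->
  forall k, (1 <= k <= K eps)%N ->
    measurable_fun setT (x k : O -> borelV R d) /\
    measurable_fun setT (x k.+1 : O -> borelV R d) /\
    (sqr_integral P (fun w => x k.+1 w - x k w)%R <=
      (2 / (3 * L) * (Delta + 16 * G ^+ 2 / L))%:E)%E.
Proof.
move=> e01 run k kK; have mu0 : 0 < eps ^+ m by rewrite exprn_gt0// (andP e01).1.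
have [Fmin Fmin_le Fbound] := bounded_run_min mu0 (stages_gt0 m e01) run.
have [samples algo _] := run.
have pm := px_measurable px_sel mu0.
have gL j : (1 <= j <= K eps)%N -> 3 * L <= gamma j.
  by move=> /andP[j1 _]; exact: gamma_ge_3L.
have /andP[k1 kK'] := kK.
split; first by apply: (x_measurable tau g_oracle h_oracle pm L_gt0 mu0 gL algo); rewrite k1 ltnW.
split; first exact: (x_measurable tau g_oracle h_oracle pm L_gt0 mu0 gL algo).
apply: (increment_sqr_le g_convex.2 h_convex.2 g_oracle h_oracle r_proper r_lsc
  (fun v => px_prox px_sel v mu0) pm L_gt0 g_smooth h_smooth noise_bound mu0 gL _ _
  samples algo Fmin_le Fbound kK).
- by move=> j /andP[j1 _]; exact: iterations_ge3.
- by move=> j /andP[j1 _]; exact: gamma_iterations_ge.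
Qed.

Let residual_const : R :=
  2 `^ (alpha + 1) * (8 * (7 * L + 1)) * (Delta + 16 * G ^+ 2 / L).

Lemma run_rate eps D dO (O : measurableType dO) (P : probability O R)
    xi sg tau x y : 0 < eps < 1 ->
  bounded_run (eps ^+ m) gamma T (K eps) (P := P) xi sg tau x y ->
  (forall k, (1 <= k <= K eps)%N ->
    (sqr_integral P (fun w => x k w - px (eps ^+ m) (x k w))%R <= (D * eps ^+ 2)%:E)%E) ->
  (\int[P]_w (enorm (x (tau w) w - px (eps ^+ m) (x (tau w) w)))%:E <=
    ((1 + D) / 2 * eps)%:E)%E /\
  (\int[P]_w stationarity_gap g h r (px (eps ^+ m) (x (tau w) w)) <=
    ((1 + 2 * residual_const + 8 * L ^+ 2 * D) / 2 * eps)%:E)%E.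
Proof.
move=> e01 run DB; have /andP[e0 e1] := e01.
have mu0 : 0 < eps ^+ m by rewrite exprn_gt0.
have [Fmin Fmin_le Fbound] := bounded_run_min mu0 (stages_gt0 m e01) run.
have [samples algo _] := run.
have pm := px_measurable px_sel mu0.
have gL j : (1 <= j <= K eps)%N -> 3 * L <= gamma j.
  by move=> /andP[j1 _]; exact: gamma_ge_3L.
split.
  apply: le_trans (prox_distance_average_le g_oracle h_oracle pm L_gt0 mu0 gL samples algo
    (stages_gt0 m e01) e0 DB) _.
  rewrite lee_fin le_eqVlt; apply/orP; left; apply/eqP.
  by field; rewrite gt_eqF.
(* gamma_k <= 6 L/mu and, as mu <= 1, L <= L/mu; with 1/mu this adds up to (7 L + 1)/mu. *)
pose Lam := (7 * L + 1) * (eps ^+ m)^-1.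
have imu1 : 1 <= (eps ^+ m)^-1 by rewrite invf_ge1// exprn_ile1// ltW.
have LamP k : (1 <= k <= K eps)%N -> L + (eps ^+ m)^-1 + gamma k <= Lam.
  move=> /andP[k1 kK].
  have gk : gamma k <= 3 * L * (2 * (eps ^+ m)^-1).
    rewrite /gamma ler_wpM2l ?mulr_ge0 ?(ltW L_gt0)//.
    apply: le_trans (stages_theta_le theta01 thetaE e01).
    by rewrite ge0_ler_powR ?nnegrE ?ler_nat// (andP theta01).1.
  have : L * 1 <= L * (eps ^+ m)^-1 by rewrite ler_wpM2l// ltW.
  rewrite /Lam; lra.
have T3 j : (1 <= j <= K eps)%N -> (3 <= T j)%N.
  by move=> /andP[j1 _]; exact: iterations_ge3.
have gT j : (1 <= j <= K eps)%N -> 3 * L * j%:R <= gamma j * (T j)%:R.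
  by move=> /andP[j1 _]; exact: gamma_iterations_ge.
have := stationarity_gap_average_le g_convex.2 h_convex.2 g_oracle h_oracle r_proper r_lsc
  (fun v => px_prox px_sel v mu0) pm L_gt0 g_smooth h_smooth noise_bound mu0 gL T3 gT
  samples algo Fmin_le Fbound (stages_gt0 m e01) alpha_ge1 LamP e0 DB.
move=> /le_trans; apply.
rewrite lee_fin.
set Q := 2 `^ (alpha + 1) * (8 * Lam) * (Delta + 16 * G ^+ 2 / L) / (K eps)%:R.
have QE : Q <= residual_const * eps ^+ 2.
  have K0 : 0 < (K eps)%:R :> R by rewrite ltr0n stages_gt0.
  rewrite /Q ler_pdivrMr// /residual_const /Lam.
  have c0 : 0 <= 2 `^ (alpha + 1) * (8 * (7 * L + 1)) * (Delta + 16 * G ^+ 2 / L).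
    have G0 : 0 <= 16 * G ^+ 2 / L.
      by apply: divr_ge0; [apply: mulr_ge0; rewrite ?sqr_ge0|exact: ltW].
    apply: mulr_ge0; last by rewrite addr_ge0// ltW.
    apply: mulr_ge0; first exact: powR_ge0.
    by apply: mulr_ge0 => //; have := L_gt0; lra.
  have -> : 2 `^ (alpha + 1) * (8 * ((7 * L + 1) / eps ^+ m)) * (Delta + 16 * G ^+ 2 / L) =
    2 `^ (alpha + 1) * (8 * (7 * L + 1)) * (Delta + 16 * G ^+ 2 / L) * (eps ^+ m)^-1 by ring.
  rewrite -[leRHS]mulrA ler_wpM2l//.
  rewrite -ler_pdivrMl ?exprn_gt0//; apply: le_trans (stages_ge m e01).
  by rewrite -invfM -exprD add2n.
have -> : (1 + 2 * residual_const + 8 * L ^+ 2 * D) / 2 * eps =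
    eps / 2 + (2 * (residual_const * eps ^+ 2) + 8 * L ^+ 2 * (D * eps ^+ 2)) / (2 * eps).
  by field; rewrite gt_eqF.
rewrite lerD2l ler_wpM2r ?invr_ge0 ?mulr_ge0 ?(ltW e0)// lerD2r.
by rewrite ler_pM2l.
Qed.

(** From 2 D0 + 2 4^k D0 <= 4^(k+1) D0. Exponential growth is harmless, as the bound serves only
    when [eps], and hence the number of stages, is bounded. *)
Lemma run_drift_sqr_le eps dO (O : measurableType dO) (P : probability O R)
    xi sg tau x y : 0 < eps < 1 ->
  bounded_run (eps ^+ m) gamma T (K eps) (P := P) xi sg tau x y ->
  forall k, (1 <= k <= K eps)%N ->
    (sqr_integral P (fun w => x k w - x1)%R <=
      (4 ^+ k * (2 / (3 * L) * (Delta + 16 * G ^+ 2 / L)))%:E)%E.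
Proof.
move=> e01 run; set D0 := 2 / (3 * L) * _.
have D00 : 0 <= D0.
  apply: mulr_ge0; first by rewrite divr_ge0// mulr_ge0// ltW.
  rewrite addr_ge0 ?(ltW Delta_gt0)//.
  by apply: divr_ge0; [apply: mulr_ge0; rewrite ?sqr_ge0|exact: ltW].
have [_ algo _] := run.
elim=> // -[_ _|k IH kK].
  rewrite (_ : sqr_integral P _ = 0)%E; first by rewrite lee_fin mulr_ge0.
  apply: integral0_eq => w _.
  by rewrite (stage_init algo) subrr /dotv big1// => i _; rewrite mxE mul0r.
have kK' : (1 <= k.+1 <= K eps)%N by rewrite /= ltnW.
have [mx [mx' dx]] := run_increment_sqr_le e01 run kK'.
have -> : (fun w => x k.+2 w - x1) = (fun w => (x k.+2 w - x k.+1 w) + (x k.+1 w - x1)).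
  by apply/funext => w; rewrite addrA subrK.
apply: le_trans (sqr_integralD _ _ _) _.
- exact: measurable_borelVB.
- exact: measurable_borelVB.
apply: (@le_trans _ _ (2%:E * D0%:E + 2%:E * (4 ^+ k.+1 * D0)%:E)%E).
  by apply: leeD; apply: lee_wpmul2l => //; exact: IH.
rewrite -!EFinM -EFinD lee_fin [4 ^+ k.+2]exprS.
have : D0 <= 4 ^+ k.+1 * D0 by rewrite ler_peMl// exprn_ege1// ler1n.
by rewrite -mulrA; lra.
Qed.

(* If F_mu0 is bounded below for one mu0, then |x - prox x|^2 / (4 mu) is at most
   F_mu(x) - inf F_mu0 as soon as mu <= mu0 / 2; the larger mu leave boundedly many
   stages, during which x_k cannot drift far from x1. If no F_mu0 is bounded below,
   there is no run to consider. *)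
Lemma lower_bounded_prox_sqr_le : m = 2%N ->
  (exists c : R, forall v, (c%:E <= r v)%E) -> (forall v, r v \is a fin_num) ->
  exists2 D, 0 <= D & forall eps, 0 < eps < 1 ->
    forall dO (O : measurableType dO) (P : probability O R) xi sg tau x y,
    bounded_run (eps ^+ m) gamma T (K eps) (P := P) xi sg tau x y ->
    forall k, (1 <= k <= K eps)%N ->
    (sqr_integral P (fun w => x k w - px (eps ^+ m) (x k w))%R <= (D * eps ^+ 2)%:E)%E.
Proof.
move=> m2 [c rc] rfin.
have mu01 (eps : R) : 0 < eps < 1 -> 0 < eps ^+ m < 1.
  by move=> /andP[e0 e1]; rewrite exprn_gt0// exprn_ilt1 ?(ltW e0)// m2.
have [[mu0 [B0 [/andP[mu00 mu0lt1] B0le]]]|nobound] := pselect (exists mu0 B0 : R,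
    0 < mu0 < 1 /\ forall v, B0 <= dc_real g h r mu0 v); last first.
  exists 0 => // eps e01 dO O P xi sg tau x y run; exfalso; apply: nobound.
  have [Fmin Fle _] := bounded_run_min (andP (mu01 _ e01)).1 (stages_gt0 m e01) run.
  by exists (eps ^+ m), Fmin; split; [exact: mu01|].
have real_le mu : 0 < mu -> dc_real g h r mu x1 <= g x1 - h x1 + fine (r x1).
  move=> mu1; rewrite /dc_real lerD2l.
  apply: le_trans (fine_moreau_le r_proper (px_prox px_sel x1 mu1) (rfin x1)) _.
  by rewrite subrr /dotv big1 ?mulr0 ?add0r// => i _; rewrite mxE mul0r.
(* Bounds Fmin - B0 uniformly in mu, by evaluating F_mu at [x1]. *)
pose C1 := g x1 - h x1 + fine (r x1) - B0.
have C10 : 0 <= C1 by rewrite subr_ge0; exact: le_trans (B0le x1) (real_le _ mu00).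
pose A := fine (r x1) - c.
have cr v : c <= fine (r v) by rewrite -lee_fin fineK.
have A0 : 0 <= A by rewrite subr_ge0.
pose D0 := 2 / (3 * L) * (Delta + 16 * G ^+ 2 / L).
have D00 : 0 <= D0.
  apply: mulr_ge0; first by rewrite divr_ge0// mulr_ge0// ltW.
  rewrite addr_ge0 ?(ltW Delta_gt0)//.
  by apply: divr_ge0; [apply: mulr_ge0; rewrite ?sqr_ge0|exact: ltW].
(* If mu > mu0/2 then K <= 2/mu^2 < 8/mu0^2, which bounds the drift from [x1]; 2 A is the cost of
   comparing the proximal point with [x1]. Multiplying by 2 mu/mu0 > 1 gives the required order
   mu. *)
pose E1 := 4 ^+ nceil (8 / mu0 ^+ 2) * D0 + 2 * A.
have E10 : 0 <= E1 by rewrite addr_ge0// mulr_ge0.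
have DC0 : 0 <= 4 * (Delta + C1) by rewrite mulr_ge0// addr_ge0// ltW.
have EM0 : 0 <= E1 * (2 / mu0) by rewrite mulr_ge0// divr_ge0// ltW.
exists (4 * (Delta + C1) + E1 * (2 / mu0)); first exact: addr_ge0.
move=> eps e01 dO O P xi sg tau x y run k kK.
have /andP[mu1 mult1] := mu01 _ e01.
have epsE : eps ^+ 2 = eps ^+ m by rewrite m2.
rewrite epsE.
have [mx _] := run_increment_sqr_le e01 run kK.
have prx v := px_prox px_sel v mu1.
have pm := px_measurable px_sel mu1.
case: (lerP (2 * eps ^+ m) mu0) => mumu0.
  have [Fmin Fle Fbound] := bounded_run_min mu1 (stages_gt0 m e01) run.
  (* Using the point prox_mu(v) as a competitor in the envelope with mu0, F_mu(v) - F_mu0(v) is at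
     least (1/(2 mu) - 1/(2 mu0)) times the squared distance, hence at least 1/(4 mu) times it. *)
  have pointwise v : dotv (v - px (eps ^+ m) v) (v - px (eps ^+ m) v) <=
      4 * eps ^+ m * (dc_real g h r (eps ^+ m) v - Fmin) + 4 * eps ^+ m * C1.
    rewrite -mulrDr -ler_pdivrMl ?mulr_gt0// dotv_distC.
    have := fine_moreau_prox r_proper (prx v).
    have := fine_moreau_le r_proper (px_prox px_sel v mu00) (rfin (px (eps ^+ m) v)).
    have := B0le v; have := Fle x1; have := real_le _ mu1.
    rewrite /C1 /dc_real.
    set Q := dotv _ _; have Q0 : 0 <= Q by exact: dotv_ge0.
    have : (2 * mu0)^-1 * Q <= (4 * eps ^+ m)^-1 * Q.
      rewrite ler_wpM2r// lef_pV2 ?posrE ?mulr_gt0//.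
      by move: mumu0; lra.
    have -> : (4 * eps ^+ m)^-1 * Q = (2 * eps ^+ m)^-1 * Q / 2.
      by field; rewrite gt_eqF.
    lra.
  have mPhi : measurable_fun setT (fun w => (dc_real g h r (eps ^+ m) (x k w) - Fmin)%:E).
    apply/measurable_EFinP; apply: measurable_funB => //.
    exact: (measurableT_comp (measurable_dc_real r_proper r_lsc prx pm g_smooth h_smooth) mx).
  have mu4 : 0 <= 4 * eps ^+ m by rewrite mulr_ge0// ltW.
  apply: (@le_trans _ _ (\int[P]_w ((4 * eps ^+ m)%:E *
      (dc_real g h r (eps ^+ m) (x k w) - Fmin)%:E + (4 * eps ^+ m * C1)%:E))%E).
    apply: le_nonmeasurable_integral => w; first by rewrite lee_fin dotv_ge0.
    by rewrite -EFinM -EFinD lee_fin pointwise.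
  rewrite ge0_integralD//; last 3 first.
  - by move=> w _; rewrite -EFinM lee_fin mulr_ge0// subr_ge0.
  - exact: measurable_funeM.
  - by move=> w _; rewrite lee_fin mulr_ge0.
  rewrite probability_integral_cst ge0_integralZl_EFin//; last first.
    by move=> w _; rewrite lee_fin subr_ge0.
  apply: (@le_trans _ _ ((4 * eps ^+ m)%:E * Delta%:E + (4 * eps ^+ m * C1)%:E)%E).
    by apply: leeD => //; apply: lee_wpmul2l => //; exact: Fbound.
  rewrite -EFinM -EFinD lee_fin.
  have : 0 <= E1 * (2 / mu0) * eps ^+ m by rewrite mulr_ge0// ltW.
  lra.
have pointwise v : dotv (v - px (eps ^+ m) v) (v - px (eps ^+ m) v) <=
    dotv (v - x1) (v - x1) + 2 * A.
  have := moreau_ge_prox r_proper (prx v) (rfin x1).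
  have := cr (px (eps ^+ m) v); rewrite (dotv_distC v (px _ v)) (dotv_distC v x1) /A => cpx.
  set Q := dotv (px _ _ - v) _; set Q1 := dotv (x1 - v) _ => H.
  have : Q <= Q1 + 2 * eps ^+ m * (fine (r x1) - c).
    have mu2 : 0 < 2 * eps ^+ m by rewrite mulr_gt0.
    have {}H : (2 * eps ^+ m)^-1 * (Q - Q1) <= fine (r x1) - c by lra.
    by rewrite ler_pdivrMl// in H; lra.
  have : eps ^+ m * (fine (r x1) - c) <= 1 * (fine (r x1) - c).
    by rewrite ler_wpM2r// ltW.
  lra.
apply: (@le_trans _ _ E1%:E); last first.
  have : E1 <= E1 * (2 / mu0) * eps ^+ m.
    rewrite -mulrA ler_peMr// mulrAC ler_pdivlMr// mul1r ltW//.
  rewrite lee_fin; have : 0 <= 4 * (Delta + C1) * eps ^+ m by rewrite mulr_ge0// ltW.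
  lra.
apply: (@le_trans _ _ (\int[P]_w ((dotv (x k w - x1) (x k w - x1))%:E + (2 * A)%:E))%E).
  apply: le_nonmeasurable_integral => w; first by rewrite lee_fin dotv_ge0.
  by rewrite -EFinD lee_fin pointwise.
rewrite ge0_integralD//; last 3 first.
- by move=> w _; rewrite lee_fin dotv_ge0.
- by apply: measurable_sqr; exact: measurable_borelVB.
- by move=> w _; rewrite lee_fin mulr_ge0.
rewrite probability_integral_cst /E1 [leRHS]EFinD; apply: leeD => //.
apply: le_trans (run_drift_sqr_le e01 run kK) _.
rewrite lee_fin ler_wpM2r// ler_eXn2l ?ltr1n//.
rewrite -(ler_nat R); apply: (@le_trans _ _ (K eps)%:R); first by rewrite ler_nat; case/andP: kK.
apply: le_trans (stages_le m e01) _.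
apply: (@le_trans _ _ (8 / mu0 ^+ 2)); last by apply: nceil_ge; rewrite divr_ge0// exprn_ge0// ltW.
rewrite m2 in mumu0 *.
have -> : eps ^+ 4 = (eps ^+ 2) ^+ 2 by rewrite -exprM.
rewrite ler_pdivlMr ?exprn_gt0// mulrAC ler_pdivrMr ?exprn_gt0 ?(andP e01).1//.
have : 0 < mu0 by []; move: mumu0; set u := eps ^+ 2.
by move=> H1 H2; nra.
Qed.

End rate.

(** Testing optimality of [u] against [x] gives n^2/(2 mu) <= r x - r u <= M n with n = |x - u|, so
    n <= 2 mu M. Finiteness of r x follows from the Lipschitz bound and that of r u. *)
Lemma lipschitz_prox_sqr_le (R : realType) (d : nat) (r : 'rV[R]_d -> \bar R)
    (M mu : R) (x u : 'rV[R]_d) : proper_fun r ->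
  (forall x y, (`|r x - r y| <= (M * enorm (x - y))%:E)%E) -> 0 < mu ->
  prox mu r x u -> dotv (x - u) (x - u) <= 4 * M ^+ 2 * mu ^+ 2.
Proof.
move=> r_proper rM mu0 ux; have ru := prox_fin_num r_proper ux.
have rx : r x \is a fin_num.
  have := rM x u; rewrite -(fineK ru).
  by case: (r x) (r_proper.1 x) => [s||]//.
have := moreau_ge_prox r_proper ux rx; rewrite subrr [dotv 0 0](_ : _ = 0); last first.
  by rewrite /dotv big1// => i _; rewrite mxE mul0r.
have := rM x u; rewrite -(fineK ru) -(fineK rx) -EFinB abse_EFin lee_fin => /(le_trans (ler_norm _)).
rewrite dotv_distC -enorm_sqr /=; set n := enorm _; have n0 : 0 <= n by exact: enorm_ge0.
move=> H1 H2.
have H : (2 * mu)^-1 * n ^+ 2 <= M * n by lra.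
rewrite ler_pdivrMl ?mulr_gt0// in H.
have [->|npos] := eqVneq n 0; first by rewrite expr0n /=; nra.
have {}npos : 0 < n by rewrite lt_def npos.
have nle : n <= 2 * mu * M by rewrite -(ler_pM2r npos); lra.
have -> : 4 * M ^+ 2 * mu ^+ 2 = (2 * mu * M) ^+ 2 by ring.
by apply: lerXn2r => //; rewrite ?nnegrE//; exact: le_trans nle.
Qed.

Theorem theorem12 (R : realType) (d : nat)
  (dXi dSg : measure_display) (Xi : measurableType dXi) (Sg : measurableType dSg)
  (PXi : probability Xi R) (PSg : probability Sg R)
  (g h : 'rV[R]_d -> R) (gs : 'rV[R]_d -> Xi -> R) (hs : 'rV[R]_d -> Sg -> R)
  (dg : 'rV[R]_d -> Xi -> 'rV[R]_d) (dh : 'rV[R]_d -> Sg -> 'rV[R]_d)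
  (r : 'rV[R]_d -> \bar R) (px : R -> 'rV[R]_d -> 'rV[R]_d)
  (L G alpha Delta : R) (x1 : 'rV[R]_d)
  (g_convex : lsc_convex g) (h_convex : lsc_convex h)
  (g_oracle : stochastic_oracle PXi g gs dg)
  (h_oracle : stochastic_oracle PSg h hs dh)
  (r_proper : proper_fun r) (r_lsc : lower_semicontinuous r)
  (px_sel : prox_selection r px)
  (L_gt0 : 0 < L) (g_smooth : L_smooth L g) (h_smooth : L_smooth L h)
  (G_gt0 : 0 < G) (noise_bound : bounded_variance PXi PSg dg dh G)
  (alpha_ge1 : 1 <= alpha) (Delta_gt0 : 0 < Delta) :
  (* (a) *)
  ((exists M : R, forall x y, (`|r x - r y| <= (M * enorm (x - y))%:E)%E) ->
   exists C c1 c2 c3 c4 : R,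
     [/\ 0 < C, 0 < c1, 0 < c2, 0 < c3 & 0 < c4] /\
     forall eps : R, 0 < eps < 1 ->
     let mu := eps in
     let gamma := fun k : nat => 3 * L * k%:R `^ (1 / 3) in
     let T := fun k : nat => nceil (3 * L * k%:R / gamma k + 3) in
     let K := nceil (C * (1 / eps ^+ 3)) in
     [/\ forall (dO : measure_display) (O : measurableType dO)
           (P : probability O R)
           (xi : nat -> nat -> {RV P >-> Xi}) (sg : nat -> nat -> {RV P >-> Sg})
           (tau : {RV P >-> nat})
           (x : nat -> O -> 'rV[R]_d) (y : nat -> nat -> O -> 'rV[R]_d),
           run_samples PXi PSg alpha K xi sg tau ->
           stagewise_spg dg dh (px mu) mu gamma T K x1
             (fun k t => xi k t) (fun k t => sg k t) x y ->
           (forall k, (1 <= k <= K)%N ->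
              (\int[P]_w (dc_objective g h r mu (x k w)
                          - ereal_inf (range (dc_objective g h r mu)))
               <= Delta%:E)%E) ->
           let x_tau := fun w => x (tau w) w in
           let w_tau := fun w => px mu (x_tau w) in
           (\int[P]_w (enorm (x_tau w - w_tau w))%:E <= (c1 * eps)%:E)%E /\
           (\int[P]_w stationarity_gap g h r (w_tau w) <= (c2 * eps)%:E)%E,
         (\sum_(1 <= k < K.+1) T k)%:R <= c3 * K%:R `^ (5 / 3) &
         K%:R `^ (5 / 3) <= c4 * (1 / eps ^+ 5)])
  /\
  (* (b) *)
  ((exists m : R, forall x, (m%:E <= r x)%E) ->
   (forall x, r x \is a fin_num) ->
   exists C c1 c2 c3 c4 : R,
     [/\ 0 < C, 0 < c1, 0 < c2, 0 < c3 & 0 < c4] /\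
     forall eps : R, 0 < eps < 1 ->
     let mu := eps ^+ 2 in
     let gamma := fun k : nat => 3 * L * k%:R `^ (1 / 2) in
     let T := fun k : nat => nceil (3 * L * k%:R / gamma k + 3) in
     let K := nceil (C * (1 / eps ^+ 4)) in
     [/\ forall (dO : measure_display) (O : measurableType dO)
           (P : probability O R)
           (xi : nat -> nat -> {RV P >-> Xi}) (sg : nat -> nat -> {RV P >-> Sg})
           (tau : {RV P >-> nat})
           (x : nat -> O -> 'rV[R]_d) (y : nat -> nat -> O -> 'rV[R]_d),
           run_samples PXi PSg alpha K xi sg tau ->
           stagewise_spg dg dh (px mu) mu gamma T K x1
             (fun k t => xi k t) (fun k t => sg k t) x y ->
           (forall k, (1 <= k <= K)%N ->
              (\int[P]_w (dc_objective g h r mu (x k w)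
                          - ereal_inf (range (dc_objective g h r mu)))
               <= Delta%:E)%E) ->
           let x_tau := fun w => x (tau w) w in
           let w_tau := fun w => px mu (x_tau w) in
           (\int[P]_w (enorm (x_tau w - w_tau w))%:E <= (c1 * eps)%:E)%E /\
           (\int[P]_w stationarity_gap g h r (w_tau w) <= (c2 * eps)%:E)%E,
         (\sum_(1 <= k < K.+1) T k)%:R <= c3 * K%:R `^ (3 / 2) &
         K%:R `^ (3 / 2) <= c4 * (1 / eps ^+ 6)]).
Proof.
(* Both parts share everything but the bound on the proximal distance; [D] is quantified before
   [eps] and the probability space so that the final constants do not depend on them. *)
have rate (m : nat) (theta beta : R) (D : R) : 0 <= theta <= 1 ->
    theta * m.+2%:R = m%:R -> beta = 2 - theta -> 0 <= D ->
    (forall eps, 0 < eps < 1 ->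
      forall dO (O : measurableType dO) (P : probability O R) xi sg tau x y,
      let gamma := fun k : nat => 3 * L * k%:R `^ theta in
      bounded_run PXi PSg g h dg dh r px alpha Delta x1 (eps ^+ m) gamma
        (fun k => nceil (3 * L * k%:R / gamma k + 3)) (nceil (1 * (1 / eps ^+ m.+2)))
        (P := P) xi sg tau x y ->
      forall k, (1 <= k <= nceil (1 * (1 / eps ^+ m.+2)))%N ->
      (sqr_integral P (fun w => x k w - px (eps ^+ m) (x k w))%R <= (D * eps ^+ 2)%:E)%E) ->
    exists C c1 c2 c3 c4 : R,
    [/\ 0 < C, 0 < c1, 0 < c2, 0 < c3 & 0 < c4] /\
    forall eps : R, 0 < eps < 1 ->
    let mu := eps ^+ m in
    let gamma := fun k : nat => 3 * L * k%:R `^ theta in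
    let T := fun k : nat => nceil (3 * L * k%:R / gamma k + 3) in
    let K := nceil (C * (1 / eps ^+ m.+2)) in
    [/\ forall (dO : measure_display) (O : measurableType dO)
           (P : probability O R)
           (xi : nat -> nat -> {RV P >-> Xi}) (sg : nat -> nat -> {RV P >-> Sg})
           (tau : {RV P >-> nat})
           (x : nat -> O -> 'rV[R]_d) (y : nat -> nat -> O -> 'rV[R]_d),
           run_samples PXi PSg alpha K xi sg tau ->
           stagewise_spg dg dh (px mu) mu gamma T K x1
             (fun k t => xi k t) (fun k t => sg k t) x y ->
           (forall k, (1 <= k <= K)%N ->
              (\int[P]_w (dc_objective g h r mu (x k w)
                          - ereal_inf (range (dc_objective g h r mu)))
               <= Delta%:E)%E) ->
           let x_tau := fun w => x (tau w) w in
           let w_tau := fun w => px mu (x_tau w) in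
           (\int[P]_w (enorm (x_tau w - w_tau w))%:E <= (c1 * eps)%:E)%E /\
           (\int[P]_w stationarity_gap g h r (w_tau w) <= (c2 * eps)%:E)%E,
         (\sum_(1 <= k < K.+1) T k)%:R <= c3 * K%:R `^ beta &
         K%:R `^ beta <= c4 * (1 / eps ^+ m.+4)].
  move=> theta01 thetaE betaE D0 DB.
  exists 1, ((1 + D) / 2), ((1 + 2 * (2 `^ (alpha + 1) * (8 * (7 * L + 1)) *
    (Delta + 16 * G ^+ 2 / L)) + 8 * L ^+ 2 * D) / 2), 5, 4.
  split.
    have L20 := sqr_ge0 L; have G20 := sqr_ge0 G; have p0 := powR_ge0 2 (alpha + 1).
    have G0 : 0 <= 16 * G ^+ 2 / L by rewrite divr_ge0 ?(ltW L_gt0)//; lra.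
    have LD : 0 <= 8 * L ^+ 2 * D by apply: mulr_ge0 => //; lra.
    have Q0 : 0 <= 2 `^ (alpha + 1) * (8 * (7 * L + 1)) * (Delta + 16 * G ^+ 2 / L).
      apply: mulr_ge0; last by rewrite addr_ge0// ltW.
      by apply: mulr_ge0 => //; have := L_gt0; lra.
    by split=> //; lra.
  move=> eps e01 mu gamma T K; split.
  - move=> dO O P xi sg tau x y samples algo bound x_tau w_tau.
    have run : bounded_run PXi PSg g h dg dh r px alpha Delta x1 mu gamma T K
      (P := P) xi sg tau x y by split.
    exact: (run_rate g_convex h_convex g_oracle h_oracle r_proper r_lsc px_sel L_gt0
      g_smooth h_smooth noise_bound alpha_ge1 Delta_gt0 theta01 thetaE e01 run
      (DB eps e01 dO O P xi sg tau x y run)).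
  - by apply: iterations_sum_le => //; exact: stages_gt0.
  - exact: (stages_complexity_le theta01 thetaE).
split=> [[M rM]|[c rc] rfin].
  (* Here mu = eps, so the Lipschitz bound 4 M^2 mu^2 has exactly the form D eps^2. *)
  have := rate 1%N (1 / 3) (5 / 3) (4 * M ^+ 2).
  apply.
  - by apply/andP; split; lra.
  - by lra.
  - by lra.
  - by apply: mulr_ge0; rewrite ?sqr_ge0.
  - move=> eps /andP[e0 e1] dO O P xi sg tau x y gamma run k kK.
    rewrite -(probability_integral_cst P).
    apply: le_nonmeasurable_integral => w; first by rewrite lee_fin dotv_ge0.
    rewrite lee_fin; apply: (lipschitz_prox_sqr_le r_proper rM e0).
    by have := px_prox px_sel (x k w) e0.
have theta01 : 0 <= (1 / 2 : R) <= 1 by apply/andP; split; lra.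
have [D D0 HD] := lower_bounded_prox_sqr_le alpha x1 g_convex h_convex g_oracle h_oracle
  r_proper r_lsc px_sel L_gt0 g_smooth h_smooth noise_bound Delta_gt0 theta01 erefl (ex_intro _ c rc) rfin.
by apply: (rate 2%N (1 / 2) (3 / 2) D) => //; lra.
Qed.
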